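(* Suppose that $\omega,\sigma\in C^0(M,\mathbb{R})$ are bounded. Then for any $m\in M$ and initial state $X_0\in\mathbb{R}^N$ the stochastic reservoir system $$dX_t=-AX_t\,dt+C\,\omega\phi^t(m)\,dt+C\,\sigma\phi^t(m)\,dW_t$$ admits a unique solution $X_t$, which converges in distribution as $t\to\infty$ to $$Y_t:=f_{(\omega,\mathcal{V},F)}\phi^t(m)+\int_0^\infty e^{-A\tau}C\,\sigma\phi^{-\tau+t}(m)\,dW_\tau ,$$ in the sense that $\mathbb{E}[g(X_t)]-\mathbb{E}[g(Y_t)]\to0$ as $t\to\infty$ for every bounded continuous $g:\mathbb{R}^N\to\mathbb{R}$.
   Context: $M$ is a smooth manifold and $\mathcal{V}$ is a smooth vector field on $M$ with evolution operators (flow) $\{\phi^t\in\mathrm{Diff}^1(M)\mid t\in\mathbb{R}\}$, defined for all times and satisfying $\phi^{t_1+t_2}=\phi^{t_1}\phi^{t_2}$. Juxtaposition denotes composition, e.g. $\sigma\phi^t(m)=\sigma(\phi^t(m))$. $A$ is a real symmetric positive definite $N\times N$ matrix, $C$ is a real $N\times1$ matrix (a vector in $\mathbb{R}^N$), and $F(x,z)=-Ax+Cz$. $W$ is a standard one-dimensional Brownian motion and stochastic integrals are Itô (Wiener) integrals. The generalised synchronisation of the noiseless linear system $\dot{x}(t)=-Ax(t)+C\,\omega\phi^t(m)$ is $$f_{(\omega,\mathcal{V},F)}(m)=\int_0^\infty e^{-A\tau}C\,\omega\phi^{-\tau}(m)\,d\tau .$$ *)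

(* Defs.v *)
From HB Require Import structures.
From mathcomp Require Export all_boot all_order all_algebra.
From mathcomp Require Export all_classical all_reals all_analysis.
Export Order.TTheory GRing.Theory Num.Theory.
Export numFieldNormedType.Exports.

Set Implicit Arguments.
Unset Strict Implicit.
Unset Printing Implicit Defensive.

Local Open Scope classical_set_scope.
Local Open Scope ring_scope.

(* f is C^k on the open set U: all partial derivatives of order at most k
   exist and are continuous at every point of U. *)
Fixpoint Ck_on (R : realType) (n p k : nat) (U : set 'rV[R]_n)
    (f : 'rV[R]_n -> 'rV[R]_p) : Prop :=
  match k with
  | 0 => forall x, U x -> {for x, continuous f}
  | k'.+1 => (forall x, U x -> {for x, continuous f}) /\
      forall j : 'I_n,
        (forall x, U x -> derivable f x (delta_mx 0 j)) /\
        Ck_on k' U ('D_(delta_mx 0 j) f)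
  end.

Definition smooth_on (R : realType) (n p : nat) (U : set 'rV[R]_n)
    (f : 'rV[R]_n -> 'rV[R]_p) : Prop := forall k, Ck_on k U f.

(* An n-dimensional smooth manifold structure on the topological space M. The
   maps [chart i] and [chart_inv i] are total functions, but only their values
   on [chart_dom i] and on [chart i @` chart_dom i] are meaningful. *)
Record smooth_manifold (R : realType) (n : nat) (M : topologicalType) := {
  manifold_hausdorff : hausdorff_space M ;
  manifold_second_countable : @second_countable M ;
  chart_idx : Type ;
  chart_dom : chart_idx -> set M ;
  chart : chart_idx -> M -> 'rV[R]_n ;
  chart_inv : chart_idx -> 'rV[R]_n -> M ;
  chart_cover : forall m, exists i, chart_dom i m ;
  chart_dom_open : forall i, open (chart_dom i) ;
  chart_img_open : forall i, open (chart i @` chart_dom i) ;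
  chartK : forall i m, chart_dom i m -> chart_inv i (chart i m) = m ;
  chart_continuous : forall i m, chart_dom i m -> {for m, continuous (chart i)} ;
  chart_inv_continuous : forall i x, (chart i @` chart_dom i) x ->
    {for x, continuous (chart_inv i)} ;
  chart_transition : forall i j,
    smooth_on (chart i @` (chart_dom i `&` chart_dom j))
      (chart j \o chart_inv i)
}.

(* A smooth vector field, given by its components in each chart; on overlaps
   these transform by the differential of the transition map. *)
Record vector_field (R : realType) (n : nat) (M : topologicalType)
    (S : smooth_manifold R n M) := {
  vf : chart_idx S -> M -> 'rV[R]_n ;
  vf_smooth : forall i,
    smooth_on (chart i @` chart_dom i) (vf i \o chart_inv i) ;
  vf_transition : forall i j m, chart_dom i m -> chart_dom j m ->
    vf j m = 'D_(vf i m) (chart j \o chart_inv i) (chart i m)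
}.

Definition C1_map (R : realType) (n : nat) (M : topologicalType)
    (S : smooth_manifold R n M) (f : M -> M) : Prop :=
  continuous f /\
  forall i j : chart_idx S,
    Ck_on 1 (chart i @` (chart_dom i `&` f @^-1` chart_dom j))
      (chart j \o f \o chart_inv i).

Definition C1_diffeo (R : realType) (n : nat) (M : topologicalType)
    (S : smooth_manifold R n M) (f : M -> M) : Prop :=
  C1_map S f /\
  exists g : M -> M, [/\ cancel f g, cancel g f & C1_map S g].

Record is_flow (R : realType) (n : nat) (M : topologicalType)
    (S : smooth_manifold R n M) (V : vector_field S) (phi : R -> M -> M) : Prop := {
  flow_diffeo : forall t, C1_diffeo S (phi t) ;
  flow0 : forall m, phi 0 m = m ;
  flowD : forall t1 t2 m, phi (t1 + t2) m = phi t1 (phi t2 m) ;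
  flow_continuous : forall m, continuous (fun t => phi t m) ;
  flow_integral_curve : forall m (t : R) (i : chart_idx S),
    chart_dom i (phi t m) ->
    is_derive t 1 (fun s : R => chart i (phi s m)) (vf V i (phi t m))
}.

Definition spd_mx (R : realType) (N : nat) (A : 'M[R]_N) : Prop :=
  A^T = A /\ forall v : 'cV[R]_N, v != 0 -> 0 < (v^T *m A *m v) 0 0.

Definition expmx (R : realType) (N : nat) (B : 'M[R]_N) : 'M[R]_N :=
  limn (fun k : nat => \sum_(l < k) (l`!%:R)^-1 *: B ^+ l).

Definition vintegral (R : realType) (N : nat) (D : set R) (h : R -> 'cV[R]_N) :
    'cV[R]_N :=
  \col_i \int[lebesgue_measure]_(x in D) (h x i 0).

Definition reservoir (R : realType) (N : nat) (A : 'M[R]_N) (C : 'cV[R]_N)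
    (x : 'cV[R]_N) (z : R) : 'cV[R]_N :=
  - (A *m x) + z *: C.

(* f_(omega, V, F) for F = reservoir A C and V with flow phi. *)
Definition gen_sync (R : realType) (N : nat) (M : Type) (A : 'M[R]_N)
    (C : 'cV[R]_N) (phi : R -> M -> M) (omega : M -> R) (m : M) : 'cV[R]_N :=
  vintegral `[0, +oo[
    (fun tau => omega (phi (- tau) m) *: (expmx (- (tau *: A)) *m C)).

(* Standard one-dimensional Brownian motion; W t is only constrained for
   0 <= t. Each event B k may be setT, so the product rule gives the
   independence of every subfamily of the increments. *)
Record is_brownian (R : realType) (d : measure_display) (T : measurableType d)
    (P : probability T R) (W : R -> T -> R) : Prop := {
  bm_measurable : forall t, 0 <= t -> measurable_fun setT (W t) ;
  bm_start : {ae P, forall w, W 0 w = 0} ;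
  bm_indep : forall (n : nat) (t : nat -> R) (B : nat -> set R),
    0 <= t 0%N -> (forall k, t k <= t k.+1) -> (forall k, measurable (B k)) ->
    P (\bigcap_(k in `I_n) (fun w => W (t k.+1) w - W (t k) w) @^-1` B k) =
    (\prod_(k < n) P ((fun w => (W (t k.+1) w - W (t k) w)%R) @^-1` B k))%E ;
  bm_normal : forall s t (B : set R), 0 <= s -> s < t -> measurable B ->
    P ((fun w => W t w - W s w) @^-1` B) = normal_prob 0 (Num.sqrt (t - s)) B ;
  bm_continuous :
    {ae P, forall w, {within `[0, +oo[, continuous (fun t => W t w)}}
}.

Definition step_fun (R : realType) (s : seq (R * R * R)) (x : R) : R :=
  \sum_(p <- s) p.2 * \1_(`]p.1.1, p.1.2]) x.

Definition step_integral (R : realType) (T : Type) (W : R -> T -> R)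
    (s : seq (R * R * R)) (w : T) : R :=
  \sum_(p <- s) p.2 * (W p.1.2 w - W p.1.1 w).

(* I is a version of the Ito integral over [0, +oo[ of the deterministic
   integrand h with respect to W: the L^2(P) limit of the integrals of step
   functions that converge to h in L^2([0, +oo[). *)
Definition is_wiener_integral (R : realType) (d : measure_display)
    (T : measurableType d) (P : probability T R) (W : R -> T -> R)
    (h : R -> R) (I : T -> R) : Prop :=
  [/\ measurable_fun (`[0, +oo[ : set R) h, measurable_fun setT I &
    exists s : nat -> seq (R * R * R),
    [/\ forall k, all (fun p => 0 <= p.1.1 <= p.1.2) (s k),
        (\int[lebesgue_measure]_(x in `[0%R, +oo[)
           ((step_fun (s k) x - h x) ^+ 2)%:E)%E @[k --> \oo] --> 0%E &
        (\int[P]_w ((step_integral W (s k) w - I w) ^+ 2)%:E)%E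
           @[k --> \oo] --> 0%E]].

Definition is_vwiener_integral (R : realType) (N : nat) (d : measure_display)
    (T : measurableType d) (P : probability T R) (W : R -> T -> R)
    (h : R -> 'cV[R]_N) (I : T -> 'cV[R]_N) : Prop :=
  forall i, is_wiener_integral P W (fun x => h x i 0) (fun w => I w i 0).

Definition continuous_paths (R : realType) (N : nat) (d : measure_display)
    (T : measurableType d) (P : probability T R) (X : R -> T -> 'cV[R]_N) : Prop :=
  {ae P, forall w, {within `[0, +oo[, continuous (fun t => X t w)}}.

(* J t = \int_0^t h dW for all t >= 0, with continuous paths. *)
Definition is_ito_process (R : realType) (N : nat) (d : measure_display)
    (T : measurableType d) (P : probability T R) (W : R -> T -> R)
    (h : R -> 'cV[R]_N) (J : R -> T -> 'cV[R]_N) : Prop :=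
  continuous_paths P J /\
  forall t, 0 <= t -> is_vwiener_integral P W (h \_ `[0, t]) (J t).

(* The filtration generated by W, augmented by the P-null events. *)
Definition bm_filtration (R : realType) (d : measure_display)
    (T : measurableType d) (P : probability T R) (W : R -> T -> R) (t : R) :
    set (set T) :=
  <<s [set E | exists s (B : set R),
         [/\ 0 <= s <= t, measurable B & E = W s @^-1` B]]
      `|` [set E | measurable E /\ P E = 0%E] >>.

Definition adapted (R : realType) (N : nat) (d : measure_display)
    (T : measurableType d) (P : probability T R) (W : R -> T -> R)
    (X : R -> T -> 'cV[R]_N) : Prop :=
  forall t, 0 <= t -> forall (i : 'I_N) (B : set R), measurable B ->
    bm_filtration P W t ((fun w => X t w i 0) @^-1` B).

(* X solves dX_t = F(X_t, u t) dt + v t dW_t, X_0 = x0, in integrated form. *)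
Definition sde_solution (R : realType) (N : nat) (d : measure_display)
    (T : measurableType d) (P : probability T R) (W : R -> T -> R)
    (F : 'cV[R]_N -> R -> 'cV[R]_N) (u : R -> R) (v : R -> 'cV[R]_N)
    (x0 : 'cV[R]_N) (X : R -> T -> 'cV[R]_N) : Prop :=
  [/\ adapted P W X, continuous_paths P X &
    exists J : R -> T -> 'cV[R]_N, is_ito_process P W v J /\
      {ae P, forall w, forall t, 0 <= t ->
        X t w = x0 + vintegral `[0, t] (fun s => F (X s w) (u s)) + J t w}].

Definition indistinguishable (R : realType) (N : nat) (d : measure_display)
    (T : measurableType d) (P : probability T R)
    (X X' : R -> T -> 'cV[R]_N) : Prop :=
  {ae P, forall w, forall t, 0 <= t -> X t w = X' t w}.

(* Y t is f(phi^t m) plus a version of the stochastic integral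
   \int_0^oo e^{-A tau} C sigma(phi^{-tau+t} m) dW_tau, for all t >= 0. *)
Definition is_limit_process (R : realType) (N : nat) (M : Type)
    (d : measure_display) (T : measurableType d) (P : probability T R)
    (W : R -> T -> R) (A : 'M[R]_N) (C : 'cV[R]_N) (phi : R -> M -> M)
    (omega sigma : M -> R) (m : M) (Y : R -> T -> 'cV[R]_N) : Prop :=
  forall t, 0 <= t ->
    exists I : T -> 'cV[R]_N,
      is_vwiener_integral P W
        (fun tau => sigma (phi (- tau + t) m) *: (expmx (- (tau *: A)) *m C)) I /\
      forall w, Y t w = gen_sync A C phi omega (phi t m) + I w.

(* Main.v *)
(* The noise enters additively, so path by path the equation for X_t is a linear
   ODE with continuous forcing once C J_t is subtracted, where J_t is a
   continuous version of the integral of sigma(phi^s m) dW_s: variation of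
   constants solves it, and coercivity of A makes the solution unique.

   Integration by parts shows that X_t is d_t, a deterministic drift, plus a
   limit of Riemann-Stieltjes sums of e^{-A(t-s)}C against J. In L^2 these sums
   are close to sums against the increments of W over a uniform grid of [0, t].
   Reversing the order of these independent, identically distributed increments
   does not change their law, and the reversed sums approximate the integral in
   Y_t in L^2, up to an exponentially small tail beyond t. As d_t - f(phi^t m)
   tends to 0 and Y_t has bounded second moments, bounded continuous test
   functions do not separate X_t from Y_t in the limit.

   The continuous version J is an almost sure uniform limit of integrals of
   dyadic step functions, by a maximal inequality and the Borel-Cantelli lemma. *)

(* The integrals behind X_t and Y_t read the same Brownian path in opposite time directions, so X_t
   - Y_t need not be small and only laws can be compared. The grid index n lives at fixed t and
   disappears from the final bound. The order of choices is: tolerance, L^2 distance [kappa], time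
   t, index n. [kappa] must not depend on t, which is why second moments are bounded uniformly in t.
   The reversal is used twice: for the test function, and for second moments, whose bound is known
   near Y_t and must be carried to the sums near X_t.

   Independence enters only through joint laws of finitely many increments. The isometry rests on
   E(W_b - W_a)^2 = |b - a| and polarisation, the maximal inequality on the sign symmetry of the
   last increment. L^2 estimates concern squared norms in [\bar R]; their factors 2, 4 and 8 come
   from (a + b)^2 <= 2 a^2 + 2 b^2.

   Positive definiteness is used through a single rate [lam], which gives uniqueness, the semigroup
   law of the exponential and its decay. *)
Require Import Defs.
From mathcomp Require Import interval_inference measurable_realfun ring lra.

Set Implicit Arguments.
Unset Strict Implicit.
Unset Printing Implicit Defensive.

Local Open Scope classical_set_scope.
Local Open Scope ring_scope.

(** * Second moment of the normal law *)

Section normal_second_moment.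
Context {R : realType}.
Notation mu := (@lebesgue_measure R).
Implicit Types s x : R.

(** The abstract Radon-Nikodym derivative of [normal_prob] agrees almost everywhere with
    [normal_pdf], since both integrate to the same value over every measurable set. *)
Lemma ge0_integral_normal_prob s (f : R -> \bar R) :
  measurable_fun setT f -> (forall x, 0 <= f x)%E ->
  (\int[normal_prob 0%R s]_x f x = \int[mu]_x (f x * (normal_pdf 0%R s x)%:E))%E.
Proof.
move=> mf f0.
pose nu : {finite_measure set (measurableTypeR R) -> \bar R} := normal_prob 0 s.
have numu : nu `<< mu by exact: normal_prob_dominates.
rewrite -(Radon_Nikodym_SigmaFinite.change_of_variables numu f0 measurableT mf).
have mrn := measurable_int _ (Radon_Nikodym_SigmaFinite.f_integrable numu).
have mpdf : measurable_fun setT (fun x : R => (normal_pdf 0 s x)%:E).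
  by apply/measurable_EFinP; exact: measurable_normal_pdf.
apply: ge0_ae_eq_integral => //.
- exact: emeasurable_funM.
- exact: emeasurable_funM.
- by move=> x _; rewrite mule_ge0// Radon_Nikodym_SigmaFinite.f_ge0.
- by move=> x _; rewrite mule_ge0// lee_fin normal_pdf_ge0.
have : ae_eq mu setT (Radon_Nikodym_SigmaFinite.f nu mu)
    (fun x => (normal_pdf 0 s x)%:E).
  apply: integral_ae_eq => //; first exact: Radon_Nikodym_SigmaFinite.f_integrable.
  by move=> E _ mE; rewrite -Radon_Nikodym_SigmaFinite.f_integral.
by apply: filterS => x + _ => /(_ I) ->.
Qed.

Lemma is_derive_normal_pdf s x : s != 0 ->
  is_derive x 1 (normal_pdf 0 s) (- (x / s ^+ 2) * normal_pdf 0 s x).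
Proof.
move=> s0; rewrite normal_pdfE// /normal_fun.
have -> : (fun x0 => normal_peak s * expR (- (x0 - 0) ^+ 2 / (s ^+ 2 *+ 2))) =
    (fun x0 => normal_peak s * expR (- (s ^+ 2 *+ 2)^-1 * x0 ^+ 2)).
  by apply/funext => y; congr (_ * expR _); rewrite subr0 mulNr mulrC mulNr.
apply: is_derive_eq.
rewrite /GRing.scale /= !mulr1 !subr0 !mulNr [x ^+ 2 / _]mulrC -mulr_natr.
by field.
Qed.

(** Integration by parts: the density p has derivative -(x / s^2) p, so x^2 p = (-s^2 x) p'. *)
Lemma normal_second_moment_itv s (n : nat) : 0 < s -> (0 < n)%N ->
  (\int[mu]_(x in `[0%R, n%:R%R]) (x ^+ 2 * normal_pdf 0%R s x)%:E =
   (- s ^+ 2 * n%:R * normal_pdf 0 s n%:R)%:E +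
   (s ^+ 2)%:E * \int[mu]_(x in `[0%R, n%:R%R]) (normal_pdf 0%R s x)%:E)%E.
Proof.
move=> s0 n0.
have sn0 : s != 0 by rewrite gt_eqF.
have cp := @continuous_normal_pdf R 0 s sn0.
pose F (x : R) : R := - s ^+ 2 * x.
pose g (x : R) : R := - (x / s ^+ 2) * normal_pdf 0 s x.
have dF x : is_derive x 1 F (- s ^+ 2).
  by apply: is_derive_eq; rewrite /GRing.scale/= mulr1.
have cF : continuous F.
  by move=> x; apply/differentiable_continuous/derivable1_diffP; case: (dF x).
have cg : continuous g.
  by move=> x; apply: cvgM (cp x); apply: cvgN; apply: cvgM; [exact: cvg_id|exact: cvg_cst].
transitivity (\int[mu]_(x in `[0%R, n%:R%R]) (F x * g x)%:E)%E.
  by apply: eq_integral => x _; congr EFin; rewrite /F /g; field.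
rewrite (@integration_by_parts _ F (normal_pdf 0 s) (cst (- s ^+ 2)) g)//.
- rewrite /F mulr0 mul0r subr0.
  under eq_integral do rewrite /cst mulNr EFinN EFinM.
  rewrite integral_ge0N; last first.
    by move=> x _; rewrite -EFinM lee_fin mulr_ge0 ?sqr_ge0 ?normal_pdf_ge0.
  rewrite oppeK ge0_integralZl//.
  + by apply/measurable_EFinP/measurable_funTS; exact: measurable_normal_pdf.
  + by move=> x _; rewrite lee_fin normal_pdf_ge0.
  + by rewrite lee_fin sqr_ge0.
- by rewrite ltr0n.
- exact/continuous_subspaceT/cst_continuous.
- split=> [x _| |]; first by case: (dF x).
  + exact/cvg_at_right_filter/cF.
  + exact/cvg_at_left_filter/cF.
- by move=> x _; rewrite derive1E; apply: derive_val.
- exact/continuous_subspaceT.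
- split=> [x _| |]; first by case: (is_derive_normal_pdf x sn0).
  + exact/cvg_at_right_filter/cp.
  + exact/cvg_at_left_filter/cp.
- by move=> x _; rewrite derive1E; apply: (@derive_val _ _ _ _ _ _ _ (is_derive_normal_pdf x sn0)).
Qed.

(** The boundary term of the integration by parts is O(1/n), because expR y >= y at y = n^2 / (2
    s^2). *)
Lemma cvg_mul_normal_pdf s : 0 < s ->
  - s ^+ 2 * n%:R * normal_pdf 0 s n%:R @[n --> \oo] --> 0.
Proof.
move=> s0; have sn0 : s != 0 by rewrite gt_eqF.
apply/cvgr0Pnorm_le => e e0; near=> n.
have n0 : 0 < n%:R :> R by rewrite ltr0n; near: n; exact: nbhs_infty_gt.
rewrite !normrM normrN (ger0_norm (sqr_ge0 _)) ger0_norm// ger0_norm ?normal_pdf_ge0//.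
rewrite normal_pdfE// /normal_fun subr0 mulNr expRN.
set y := n%:R ^+ 2 / _.
have y0 : 0 < y by rewrite /y divr_gt0 ?exprn_gt0// pmulrn_lgt0// exprn_gt0.
have ly : y <= expR y by apply: le_trans (expR_ge1Dx y); rewrite lerDr.
apply: (@le_trans _ _ (s ^+ 2 * n%:R * (normal_peak s * y^-1))).
  rewrite ler_wpM2l ?(mulr_ge0 (sqr_ge0 _) (ltW n0))//.
  rewrite ler_wpM2l ?normal_peak_ge0//.
  by rewrite lef_pV2 ?posrE// (lt_le_trans y0).
have -> : s ^+ 2 * n%:R * (normal_peak s * y^-1) =
    (s ^+ 2 * normal_peak s * (s ^+ 2 *+ 2)) / n%:R.
  by rewrite /y; field; rewrite gt_eqF// mulrn_eq0/= sqrf_eq0.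
rewrite ler_pdivrMr// -ler_pdivrMl//.
near: n; exact: nbhs_infty_ger.
Unshelve. all: by end_near. Qed.

(** Evenness reduces the claim to the half line, which carries mass 1/2 and where the identity on
    [0, n] passes to the limit. *)
Lemma normal_second_moment s : 0 < s ->
  (\int[normal_prob 0%R s]_x (x ^+ 2)%:E = (s ^+ 2)%:E)%E.
Proof.
move=> s0; have sn0 : s != 0 by rewrite gt_eqF.
rewrite ge0_integral_normal_prob//; last 2 first.
  exact/measurable_EFinP/measurable_funX.
  by move=> x; rewrite lee_fin sqr_ge0.
have cp := @continuous_normal_pdf R 0 s sn0.
have mp := @measurable_normal_pdf R 0 s.
have c2 : continuous (fun x => x ^+ 2 * normal_pdf 0 s x).
  by move=> x; apply: cvgM (cp x); exact: sqr_continuous.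
have pN : normal_pdf 0 s =1 normal_pdf 0 s \o -%R.
  by move=> x /=; rewrite normal_pdfE// /normal_fun !subr0 sqrrN.
under eq_integral do rewrite -EFinM.
rewrite ge0_symfun_integralT//; last 2 first.
  by move=> x; rewrite mulr_ge0 ?sqr_ge0 ?normal_pdf_ge0.
  by move=> x /=; rewrite sqrrN pN.
have := @integral_normal_pdf R 0 s.
rewrite ge0_symfun_integralT//; last exact: normal_pdf_ge0.
rewrite -set_itvcy => p1.
have l1 : (\int[mu]_(x in `[0%R, n%:R]) (x ^+ 2 * normal_pdf 0%R s x)%:E @[n --> \oo] -->
    \int[mu]_(x in `[0%R, +oo[) (x ^+ 2 * normal_pdf 0%R s x)%:E)%E.
  apply: ge0_cvgn_integral; first by move=> x; rewrite mulr_ge0 ?sqr_ge0 ?normal_pdf_ge0.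
  exact: continuous_measurable_fun.
have l2 : (\int[mu]_(x in `[0%R, n%:R]) (normal_pdf 0%R s x)%:E @[n --> \oo] -->
    \int[mu]_(x in `[0%R, +oo[) (normal_pdf 0%R s x)%:E)%E.
  by apply: ge0_cvgn_integral; [exact: normal_pdf_ge0|].
have half : (\int[mu]_(x in `[0%R, +oo[) (normal_pdf 0%R s x)%:E)%E = (2^-1)%:E.
  move: p1; case: (\int[mu]_(_ in _) _)%E => [r| |].
  - by rewrite -EFinM => -[r1]; congr EFin; lra.
  - by rewrite gt0_muley// lte_fin.
  - by rewrite gt0_muleNy// lte_fin.
have l3 : (\int[mu]_(x in `[0%R, n%:R]) (x ^+ 2 * normal_pdf 0%R s x)%:E @[n --> \oo] -->
   (0%:E + (s ^+ 2)%:E * (2^-1)%:E))%E.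
  apply: (@cvg_trans _ ((- s ^+ 2 * n%:R * normal_pdf 0 s n%:R)%:E +
   (s ^+ 2)%:E * \int[mu]_(x in `[0%R, n%:R]) (normal_pdf 0%R s x)%:E @[n --> \oo])%E).
    apply: near_eq_cvg; near=> n; rewrite normal_second_moment_itv//.
    by near: n; exact: nbhs_infty_gt.
  apply: cvgeD; first by [].
  - by apply: cvg_EFin; [near=> n|exact: cvg_mul_normal_pdf].
  - by apply: cvgeZl => //; rewrite -half.
rewrite (cvg_unique _ l1 l3)//= add0e -!EFinM; congr EFin; lra.
Unshelve. all: by end_near. Qed.

End normal_second_moment.

(** * The Ito isometry for step functions *)

Section sqnorm.
Context d (T : measurableType d) (R : realType).
Variable mu : {measure set T -> \bar R}.
Implicit Types (D : set T) (f g h : T -> R).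

(** The squared L^2 norm. Values in [\bar R] let the comparison lemmas below hold without
    integrability conditions. *)
Definition sqnorm D f : \bar R := (\int[mu]_(x in D) ((f x) ^+ 2)%:E)%E.

Lemma sqnorm_ge0 D f : (0 <= sqnorm D f)%E.
Proof. by apply: integral_ge0 => x _; rewrite lee_fin sqr_ge0. Qed.

Lemma eq_sqnorm D f g : {in D, f =1 g} -> sqnorm D f = sqnorm D g.
Proof. by move=> fg; apply: eq_integral => x xD; rewrite fg. Qed.

Lemma measurable_sqr D f : measurable_fun D f ->
  measurable_fun D (fun x => ((f x) ^+ 2)%:E).
Proof. by move=> mf; apply/measurable_EFinP; exact: measurable_funX. Qed.

Lemma sqnorm_le D f g : measurable D -> measurable_fun D f ->
  measurable_fun D g -> (forall x, D x -> `|f x| <= `|g x|) ->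
  (sqnorm D f <= sqnorm D g)%E.
Proof.
move=> mD mf mg fg; apply: ge0_le_integral => //.
- by move=> x _; rewrite lee_fin sqr_ge0.
- exact: measurable_sqr.
- exact: measurable_sqr.
- move=> x Dx; rewrite lee_fin -[leLHS]real_normK ?num_real//.
  by rewrite -[leRHS]real_normK ?num_real// lerXn2r ?nnegrE// fg.
Qed.

(** A triangle inequality for squared norms, from (a + b)^2 <= 2 a^2 + 2 b^2; it avoids square roots
    of extended reals. *)
Lemma sqnorm_leD D f g h : measurable D -> measurable_fun D f ->
  measurable_fun D g -> measurable_fun D h ->
  (forall x, D x -> `|f x| <= `|g x| + `|h x|) ->
  (sqnorm D f <= 2%:E * sqnorm D g + 2%:E * sqnorm D h)%E.
Proof.
move=> mD mf mg mh fgh.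
have pos (k : T -> R) : forall x, D x -> (0 <= ((k x) ^+ 2)%:E)%E by move=> x _; rewrite lee_fin sqr_ge0.
rewrite -!ge0_integralZl//; try exact: measurable_sqr.
rewrite -ge0_integralD//; first last.
- by apply: measurable_funeM; exact: measurable_sqr.
- by move=> x Dx; rewrite mule_ge0// pos.
- by apply: measurable_funeM; exact: measurable_sqr.
- by move=> x Dx; rewrite mule_ge0// pos.
apply: ge0_le_integral => //.
- by move=> x Dx; rewrite pos.
- exact: measurable_sqr.
- by apply: emeasurable_funD; apply: measurable_funeM; exact: measurable_sqr.
- move=> x Dx; rewrite -!EFinM -EFinD lee_fin.
  have := fgh x Dx; move: (normr_ge0 (f x)) (normr_ge0 (g x)) (normr_ge0 (h x)).
  rewrite -(real_normK (num_real (f x))) -(real_normK (num_real (g x))) -(real_normK (num_real (h x))).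
  move=> f0 g0 h0 fle.
  apply: (@le_trans _ _ ((`|g x| + `|h x|) ^+ 2)); first by rewrite lerXn2r ?nnegrE ?addr_ge0.
  by have := sqr_ge0 (`|g x| - `|h x|); nra.
- exact: pos.
- exact: pos.
Qed.

Lemma sqnorm_bound D f (c : R) : measurable D -> measurable_fun D f ->
  (forall x, D x -> `|f x| <= c) -> (sqnorm D f <= (c ^+ 2)%:E * mu D)%E.
Proof.
move=> mD mf fc; rewrite -integral_cst//; apply: ge0_le_integral => //.
- by move=> x _; rewrite lee_fin sqr_ge0.
- exact: measurable_sqr.
- move=> x Dx; rewrite lee_fin -[leLHS]real_normK ?num_real// lerXn2r ?nnegrE//.
  + by rewrite (le_trans _ (fc _ Dx)).
  + exact: fc.
Qed.

Lemma sqnormZ D f (c : R) : measurable D -> measurable_fun D f ->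
  sqnorm D (fun x => c * f x) = ((c ^+ 2)%:E * sqnorm D f)%E.
Proof.
move=> mD mf; rewrite /sqnorm; under eq_integral do rewrite exprMn EFinM.
rewrite ge0_integralZl//; first exact: measurable_sqr.
- by move=> x _; rewrite lee_fin sqr_ge0.
- by rewrite lee_fin sqr_ge0.
Qed.

End sqnorm.
Arguments sqnorm {d T R} mu D%_classical_set_scope f%_ring_scope.

(* Writing a combination whose coefficients add up to zero through the
   differences [x i - x j] reduces second moments of step integrals to those
   of the increments. *)
Lemma sqr_sum_polar (R : realType) (I : Type) (s : seq I) (d x : I -> R) :
  \sum_(i <- s) d i = 0 ->
  (\sum_(i <- s) d i * x i) ^+ 2 =
  \sum_(i <- s) \sum_(j <- s) (- (2^-1) * d i * d j) * (x i - x j) ^+ 2.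
Proof.
move=> d0.
have E : \sum_(i <- s) \sum_(j <- s) (- (2^-1) * d i * d j) * (x i - x j) ^+ 2 =
   - 2^-1 * (\sum_(i <- s) d i * x i ^+ 2) * (\sum_(j <- s) d j)
   + (\sum_(i <- s) d i * x i) * (\sum_(j <- s) d j * x j)
   - 2^-1 * (\sum_(i <- s) d i) * (\sum_(j <- s) d j * x j ^+ 2).
  rewrite [X in X * _ + _ - _]mulr_sumr [X in _ - X * _]mulr_sumr !mulr_suml.
  rewrite -sumrN -!big_split/=; apply: eq_bigr => i _.
  rewrite !mulr_sumr -sumrN -!big_split/=; apply: eq_bigr => j _.
  by field.
by rewrite E d0 !(mulr0, mul0r) subr0 add0r expr2.
Qed.

(** The norm depends on the X i only through their mutual squared distances, so two families with
    the same distances, even on different spaces, give combinations of the same norm. *)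
Lemma sqnorm_sum_polar d (T : measurableType d) (R : realType)
    (mu : {measure set T -> \bar R}) (D : set T) (I : Type) (s : seq I)
    (c : I -> R) (X : I -> T -> R) (v : I -> I -> R) :
  measurable D -> (forall i, measurable_fun D (X i)) ->
  (forall i j, sqnorm mu D (fun x => X i x - X j x) = (v i j)%:E) ->
  \sum_(i <- s) c i = 0 ->
  sqnorm mu D (fun x => \sum_(i <- s) c i * X i x) =
  (\sum_(i <- s) \sum_(j <- s) (- (2^-1) * c i * c j) * v i j)%:E.
Proof.
move=> mD mX Xv c0.
have mXX i j : measurable_fun D (fun x => X i x - X j x) by exact: measurable_funB.
have ij i j : mu.-integrable D (fun x => ((X i x - X j x) ^+ 2)%:E).
  apply/integrableP; split; first exact: measurable_sqr.
  under eq_integral do rewrite gee0_abs ?lee_fin ?sqr_ge0//.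
  by rewrite -/(sqnorm mu D (fun x => X i x - X j x)) Xv ltry.
have icj i j : mu.-integrable D
    (fun x => (- 2^-1 * c i * c j)%:E * ((X i x - X j x) ^+ 2)%:E)%E.
  exact: integrableZl.
rewrite /sqnorm; under eq_integral do rewrite sqr_sum_polar// -sumEFin.
under eq_integral do under eq_bigr do rewrite -sumEFin.
rewrite integral_sum//; last by move=> i; apply: integrable_sum => // j _; exact: icj.
rewrite -sumEFin; apply: eq_bigr => i _.
rewrite integral_sum//; last by move=> j; exact: icj.
rewrite -sumEFin; apply: eq_bigr => j _.
under eq_integral do rewrite EFinM.
by rewrite integralZl// -/(sqnorm mu D (fun x => X i x - X j x)) Xv EFinM.
Qed.

Section ito_isometry.
Context (R : realType) d (T : measurableType d) (P : probability T R).
Variables (W : R -> T -> R).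
Hypothesis hW : is_brownian P W.
Notation mu := (@lebesgue_measure R).
Notation R0 := (`[0%R, +oo[%classic : set R).
Implicit Types s : seq (R * R * R).

Lemma measurable_R0 : measurable (R0 : set (measurableTypeR R)).
Proof. exact: measurable_itv. Qed.

Lemma sqnorm_bm_incr (a b : R) : 0 <= a -> 0 <= b ->
  sqnorm P setT (fun w => W b w - W a w) = `|b - a|%:E.
Proof.
wlog ab : a b / a <= b.
  move=> H a0 b0; have [|/ltW] := leP a b; first by move=> ?; exact: H.
  move=> ba; rewrite distrC -H//; apply: eq_integral => w _.
  by congr EFin; ring.
move=> a0 b0; move: ab; rewrite le_eqVlt => /predU1P[<-|ab].
  rewrite subrr normr0 /sqnorm; under eq_integral do rewrite subrr expr0n/=.
  by rewrite integral0.
have mW : measurable_fun setT (fun w => W b w - W a w).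
  by apply: measurable_funB; exact: (bm_measurable hW).
have s0 : 0 < Num.sqrt (b - a) by rewrite sqrtr_gt0 subr_gt0.
rewrite ger0_norm ?subr_ge0 ?(ltW ab)//.
have -> : b - a = Num.sqrt (b - a) ^+ 2 by rewrite sqr_sqrtr// subr_ge0 ltW.
rewrite -(normal_second_moment s0).
have mW' : @measurable_fun _ _ T (measurableTypeR R) setT (fun w => W b w - W a w) by exact: mW.
pose X : {mfun T >-> measurableTypeR R} := @mfun_Sub _ _ T (measurableTypeR R) _ (mem_set mW').
transitivity (\int[distribution P X]_x (x ^+ 2)%:E)%E.
  rewrite ge0_integral_distribution//=.
  - exact/measurable_EFinP/measurable_funX.
  - by move=> x; rewrite lee_fin sqr_ge0.
apply: (@eq_measure_integral _ (measurableTypeR R) R setT (normal_prob 0 (Num.sqrt (b - a))) (distribution P X)) => B mB _.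
exact: (bm_normal hW).
Qed.

(** A step c on ]a, b] becomes the coefficient c at time b and -c at time a. The total is zero, as
    polarisation requires. *)
Definition time_coefs s : seq (R * R) :=
  [seq (p.1.2, p.2) | p <- s] ++ [seq (p.1.1, - p.2) | p <- s].

Lemma sum_time_coefs s : \sum_(q <- time_coefs s) q.2 = 0.
Proof. by rewrite big_cat/= !big_map/= -big_split/= big1// => p _; rewrite addrN. Qed.

(** [Num.max 0] leaves the times of s unchanged; it makes the family measurable for every index, W
    being constrained at nonnegative times only. *)
Lemma step_integral_time_coefs s w : all (fun p => 0 <= p.1.1 <= p.1.2) s ->
  step_integral W s w = \sum_(q <- time_coefs s) q.2 * W (Num.max 0 q.1) w.
Proof.
move=> /allP s0; rewrite big_cat/= !big_map/= -big_split/= /step_integral.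
apply: eq_big_seq => p /s0 /andP[a0 ab].
by rewrite !max_r// ?(le_trans a0)//; ring.
Qed.

(** The deterministic counterpart of W at time t: these indicators have the same mutual L^2
    distances as the values of W. *)
Definition past (t x : R) : R := \1_(`]0, Num.max 0 t]) x.

Lemma step_fun_time_coefs s x : all (fun p => 0 <= p.1.1 <= p.1.2) s ->
  step_fun s x = \sum_(q <- time_coefs s) q.2 * past q.1 x.
Proof.
move=> /allP s0; rewrite big_cat/= !big_map/= -big_split/= /step_fun.
apply: eq_big_seq => p /s0 /andP[a0 ab].
rewrite mulNr -mulrBr /past !max_r// ?(le_trans a0)// !indicE.
congr (_ * _); rewrite !mem_setE !in_itv/=.
have [ax|xa] := ltP p.1.1 x.
  by rewrite (le_lt_trans a0 ax)/= subr0.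
by rewrite (le_trans xa ab) subrr.
Qed.

Lemma sqnorm_past (s t : R) :
  sqnorm mu R0 (fun x => past s x - past t x) = `|Num.max 0 s - Num.max 0 t|%:E.
Proof.
wlog st : s t / s <= t.
  move=> H; have [|/ltW ts] := leP s t; first exact: H.
  rewrite distrC -H//; apply: eq_integral => x _; congr EFin; ring.
set a := Num.max 0 s; set b := Num.max 0 t.
have a0 : 0 <= a by rewrite le_max lexx.
have ab : a <= b by rewrite /a /b ge_max !le_max lexx st orbT.
rewrite distrC ger0_norm ?subr_ge0//.
transitivity (\int[mu]_(x in R0) (\1_(`]a, b]) x)%:E)%E.
  apply: eq_integral => x; rewrite inE/= in_itv/= andbT => x0.
  congr EFin; rewrite /past -/a -/b !indicE !mem_setE !in_itv/=.
  have [ax|xa] := ltP a x.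
    by rewrite (le_lt_trans a0 ax)/= sub0r sqrrN; case: (x <= b); rewrite ?expr1n ?expr0n.
  by rewrite (le_trans xa ab) subrr expr0n.
rewrite integral_indic//=.
rewrite setIidl; last first.
  by move=> x/=; rewrite !in_itv/= andbT => /andP[/ltW ax _]; exact: le_trans ax.
rewrite lebesgue_measure_itv/= lte_fin.
by move: ab; rewrite le_eqVlt => /predU1P[->|->//]; rewrite ltxx subrr.
Qed.

Lemma measurable_step_fun s D : measurable_fun D (step_fun s : R -> R).
Proof.
by apply: measurable_sum => p; exact: measurable_funM.
Qed.

Lemma measurable_step_integral s : all (fun p => 0 <= p.1.1 <= p.1.2) s ->
  measurable_fun setT (step_integral W s).
Proof.
move=> s0; rewrite (_ : step_integral W s = fun w => \sum_(q <- time_coefs s) q.2 * W (Num.max 0 q.1) w).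
  apply: measurable_sum => q; apply: measurable_funM => //.
  by apply: (bm_measurable hW); rewrite le_max lexx.
by apply/funext => w; exact: step_integral_time_coefs.
Qed.

(** Both sides are the same combination, once of values of W and once of the indicators [past], and
    squared distances are |b - a| in both families. *)
Lemma step_isometry s : all (fun p => 0 <= p.1.1 <= p.1.2) s ->
  sqnorm P setT (step_integral W s) = sqnorm mu R0 (step_fun s).
Proof.
move=> s0.
have max0 (x : R) : 0 <= Num.max 0 x by rewrite le_max lexx.
rewrite (@eq_sqnorm _ _ _ _ _ _ (fun w => \sum_(q <- time_coefs s) q.2 * W (Num.max 0 q.1) w)); last first.
  by move=> w _; exact: step_integral_time_coefs.
rewrite (@sqnorm_sum_polar _ _ _ _ _ _ _ _ _
    (fun p q => `|Num.max 0 p.1 - Num.max 0 q.1|)) ?sum_time_coefs//; first last.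
- by move=> p q; exact: sqnorm_bm_incr.
- by move=> q; apply: (bm_measurable hW).
transitivity (sqnorm mu R0 (fun x => \sum_(q <- time_coefs s) q.2 * past q.1 x)); last first.
  by apply: eq_sqnorm => x _; rewrite step_fun_time_coefs.
apply/esym/sqnorm_sum_polar; rewrite ?sum_time_coefs//.
- by move=> q; exact: measurable_indic.
- by move=> p q; exact: sqnorm_past.
Qed.

End ito_isometry.

(** * A maximal inequality for symmetric increments *)

Section tuple_law.
Context d (T : measurableType d) (R : realType) (P : probability T R) (n : nat).

Definition rect (B : 'I_n -> set R) : set (n.-tuple R) :=
  [set t | forall i, B i (tnth t i)].

(** Preimages under one coordinate, which generate the left side, are rectangles with all other
    sides full. Rectangles are moreover stable under intersection, as uniqueness of measures
    demands. *)
Lemma tuple_measurable_rect : (@measurable _ (n.-tuple R)) =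
  <<s [set A | exists2 B : 'I_n -> set R, (forall i, measurable (B i)) & A = rect B] >>.
Proof.
apply/seteqP; split; last first.
  apply: smallest_sub; first exact: sigma_algebra_measurable.
  move=> _ [B mB ->].
  rewrite (_ : rect B = \bigcap_(i in [set: 'I_n]) ((@tnth n R)^~ i @^-1` B i)).
    apply: fin_bigcap_measurable => // i _.
    by rewrite -[X in measurable X]setTI; exact: measurable_tnth.
  by apply/seteqP; split=> [t tB i _|t tB i]; [exact: tB|exact: tB].
apply: smallest_sub; first exact: smallest_sigma_algebra.
move=> A; rewrite -bigcup_seq => -[i /= _ [B mB <-]].
apply: sub_sigma_algebra; exists (fun j => if j == i then B else setT).
  by move=> j; case: ifP.
apply/seteqP; split=> [t [_ tB] j|t /(_ i)]; last by rewrite eqxx.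
by case: eqP => // ->.
Qed.

Variables Z Z' : T -> n.-tuple R.
Hypotheses (mZ : measurable_fun setT Z) (mZ' : measurable_fun setT Z').
Hypothesis ZZ' : forall B : 'I_n -> set R, (forall i, measurable (B i)) ->
  P (Z @^-1` rect B) = P (Z' @^-1` rect B).

Lemma eq_tuple_law (A : set (n.-tuple R)) : measurable A ->
  P (Z @^-1` A) = P (Z' @^-1` A).
Proof.
pose X := @mfun_Sub _ _ T (n.-tuple R) _ (mem_set mZ).
pose X' := @mfun_Sub _ _ T (n.-tuple R) _ (mem_set mZ').
move=> mA.
apply: (measure_unique _ (fun=> setT) tuple_measurable_rect _ _ _
  (distribution P X) (distribution P X')) => //.
- move=> _ _ [B mB ->] [C mC ->]; exists (fun i => B i `&` C i).
    by move=> i; exact: measurableI.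
  by apply/seteqP; split=> t; [move=> [tB tC] i; split|move=> tBC; split=> i; case: (tBC i)].
- by move=> _; exists (fun=> setT) => //; apply/seteqP; split.
- by rewrite bigcup_const//; exists 0%N.
- by move=> _ [B mB ->]; exact: ZZ'.
- by move=> _; rewrite (le_lt_trans (probability_le1 _ _))// ltry.
Qed.

Lemma eq_integral_tuple_law (f : n.-tuple R -> \bar R) : measurable_fun setT f ->
  (\int[P]_w f (Z w) = \int[P]_w f (Z' w))%E.
Proof.
move=> mf.
pose X := @mfun_Sub _ _ T (n.-tuple R) _ (mem_set mZ).
pose X' := @mfun_Sub _ _ T (n.-tuple R) _ (mem_set mZ').
have H (g : n.-tuple R -> \bar R) : measurable_fun setT g ->
    (forall t, 0 <= g t)%E -> (\int[P]_w g (Z w) = \int[P]_w g (Z' w))%E.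
  move=> mg g0.
  transitivity (\int[distribution P X]_x g x)%E.
    by rewrite ge0_integral_distribution.
  transitivity (\int[distribution P X']_x g x)%E; last by rewrite ge0_integral_distribution.
  by apply: eq_measure_integral => A mA _; exact: eq_tuple_law.
rewrite [LHS]integralE [RHS]integralE; congr (_ - _)%E.
- by have := H _ (measurable_funepos mf) (funepos_ge0 f); rewrite !unlock.
- by have := H _ (measurable_funeneg mf) (funeneg_ge0 f); rewrite !unlock.
Qed.

End tuple_law.

Lemma chebyshev_sqnorm d (T : measurableType d) (R : realType)
    (P : {measure set T -> \bar R}) (a : R) (f : T -> R) : 0 < a -> measurable_fun setT f ->
  (P [set w | a <= `|f w|]%R <= (a ^- 2)%:E * sqnorm P setT f)%E.
Proof.
move=> a0 mf.
have mA : measurable [set w | a <= `|f w|].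
  rewrite -[X in measurable X]setTI.
  by apply: measurable_fun_le => //; exact: measurableT_comp.
have -> : P [set w | a <= `|f w|] = (\int[P]_w (\1_[set w | a <= `|f w|]%R w)%:E)%E.
  by rewrite integral_indic// setIT.
rewrite /sqnorm -ge0_integralZl//; last 3 first.
- exact: measurable_sqr.
- by move=> w _; rewrite lee_fin sqr_ge0.
- by rewrite lee_fin invr_ge0 sqr_ge0.
apply: ge0_le_integral => //.
- by apply/measurable_EFinP; exact: measurable_indic.
- by apply: measurable_funeM; exact: measurable_sqr.
- move=> w _; rewrite -EFinM lee_fin indicE.
  case: (boolP (w \in _)) => [|_]; last by rewrite mulr_ge0 ?invr_ge0 ?sqr_ge0.
  rewrite inE/= => aw; rewrite ler_pdivlMl ?exprn_gt0// mulr1.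
  by rewrite -[leRHS]real_normK ?num_real// lerXn2r ?nnegrE// ltW.
Qed.

Section stopped_sum.
Context (R : realType).
Implicit Types (z : nat -> R) (a : R).

(** The partial sums of z, frozen from the first time their absolute value reaches a. *)
Fixpoint stopped_sum a z n : R :=
  if n is k.+1 then
    stopped_sum a z k + (if `|stopped_sum a z k| < a then z k else 0)
  else 0.

Lemma eq_stopped_sum a z z' n : (forall k, (k < n)%N -> z k = z' k) ->
  stopped_sum a z n = stopped_sum a z' n.
Proof.
elim: n => //= n IH zz'.
by rewrite IH ?zz'// => k kn; rewrite zz'// ltnS ltnW.
Qed.

Lemma stopped_sum_ge a z n k : (k <= n)%N -> a <= `|stopped_sum a z k| ->
  a <= `|stopped_sum a z n|.
Proof.
move=> /subnK <-; elim: (n - k)%N => //= j IH /IH h.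
by rewrite ltNge h /= addr0.
Qed.

Lemma stopped_sumE a z n : (forall k, (k < n)%N -> `|\sum_(i < k) z i| < a) ->
  stopped_sum a z n = \sum_(i < n) z i.
Proof.
elim: n => [|n IH] h; first by rewrite big_ord0.
by rewrite /= big_ord_recr /= IH ?h// => k kn; apply: h; rewrite ltnS ltnW.
Qed.

(** Up to the least passage index the stopped and plain sums agree, and afterwards the stopped one
    does not move. *)
Lemma max_sum_stopped a z n : (exists2 k, (k <= n)%N & a <= `|\sum_(i < k) z i|) ->
  a <= `|stopped_sum a z n|.
Proof.
move=> [k kn ka].
have := ex_minnP (ex_intro (fun k => a <= `|\sum_(i < k) z i|) k ka).
move=> [j ja jmin]; apply: (@stopped_sum_ge _ _ _ j).
  by rewrite (leq_trans _ kn)// jmin.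
rewrite stopped_sumE// => i ij; rewrite ltNge; apply/negP => /jmin.
by rewrite leqNgt ij.
Qed.

End stopped_sum.

Section maximal_inequality.
Context d (T : measurableType d) (R : realType) (P : probability T R).
Variable xi : nat -> T -> R.
Hypothesis mxi : forall k, measurable_fun setT (xi k).
(** Flipping the sign of the last variable preserves the joint law. For the increments of W this
    condenses their independence and the symmetry of the centred normal law. *)
Hypothesis sym : forall n (f : n.+1.-tuple R -> \bar R), measurable_fun setT f ->
  (\int[P]_w f [tuple xi i w | i < n.+1]%R =
   \int[P]_w f [tuple (if i == n :> nat then - xi i w else xi i w) | i < n.+1]%R)%E.
Variable c : nat -> R.

Let S a n w := stopped_sum a (fun k => c k * xi k w) n.

Lemma measurable_stopped_sum d' (T' : measurableType d') a (z : nat -> T' -> R) n :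
  (forall k, (k < n)%N -> measurable_fun setT (z k)) ->
  measurable_fun setT (fun w => stopped_sum a (fun k => z k w) n).
Proof.
elim: n => [|n IH] mz; first exact: measurable_cst.
have mS : measurable_fun setT (fun w => stopped_sum a (fun k => z k w) n).
  by apply: IH => k kn; apply: mz; rewrite ltnS ltnW.
apply: measurable_funD => //; apply: measurable_fun_ifT => //; last exact: mz.
by apply: measurable_fun_ltr => //; exact: measurableT_comp.
Qed.

(* The parallelogram identity between the last step and its reflection takes
   the place of the usual conditional independence argument. *)
Lemma sqnorm_stopped_sum a n :
  (sqnorm P setT (S a n) <= \sum_(i < n) sqnorm P setT (fun w => (c i * xi i w)%R))%E.
Proof.
elim: n => [|n IH].
  rewrite big_ord0 /sqnorm /S/=; under eq_integral do rewrite expr0n.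
  by rewrite integral0.
rewrite big_ord_recr/=.
have mcx k : measurable_fun setT (fun w => c k * xi k w) by exact: measurable_funM.
have mS : measurable_fun setT (S a n) by exact: measurable_stopped_sum.
pose H w := if `|S a n w| < a then c n * xi n w else 0.
have mH : measurable_fun setT H.
  apply: measurable_fun_ifT => //.
  by apply: measurable_fun_ltr => //; exact: measurableT_comp.
pose z (t : n.+1.-tuple R) k := c k * nth 0 t k.
have mz k : measurable_fun setT (fun t : n.+1.-tuple R => z t k).
  apply: measurable_funM => //.
  have [kn|nk] := ltnP k n.+1.
    have -> : (fun t : n.+1.-tuple R => nth 0 t k) = (fun t => tnth t (Ordinal kn)).
      by apply/funext => t; rewrite (tnth_nth 0).
    exact: measurable_tnth.
  have -> : (fun t : n.+1.-tuple R => nth 0 t k) = cst 0.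
    by apply/funext => t; rewrite nth_default// size_tuple.
  exact: measurable_cst.
(* The freezing test reads earlier variables only, so flipping the last one turns S + H into S -
   H. *)
have eqs : sqnorm P setT (S a n.+1) = sqnorm P setT (fun w => S a n w - H w).
  have mf : measurable_fun setT (fun t : n.+1.-tuple R => ((stopped_sum a (z t) n.+1) ^+ 2)%:E).
    apply/measurable_EFinP/measurable_funX.
    by apply: (@measurable_stopped_sum _ (n.+1.-tuple R) a (fun k t => z t k)) => k _; exact: mz.
  transitivity (\int[P]_w ((stopped_sum a (z [tuple xi i w | i < n.+1]) n.+1) ^+ 2)%:E)%E.
    apply: eq_integral => w _; congr (_ ^+ 2)%:E; apply: eq_stopped_sum => k kn.
    by rewrite /z -[k]/(nat_of_ord (Ordinal kn)) -tnth_nth tnth_mktuple.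
  rewrite (sym mf); apply: eq_integral => w _; congr (_ ^+ 2)%:E.
  have zk k : (k < n)%N -> z [tuple (if i == n :> nat then - xi i w else xi i w) | i < n.+1] k
      = c k * xi k w.
    move=> kn; have kn1 : (k < n.+1)%N by rewrite ltnS ltnW.
    rewrite /z -[k in nth _ _ k]/(nat_of_ord (Ordinal kn1)) -tnth_nth tnth_mktuple/=.
    by rewrite ltn_eqF.
  have zn : z [tuple (if i == n :> nat then - xi i w else xi i w) | i < n.+1] n
      = - (c n * xi n w).
    rewrite /z -[n in nth _ _ n]/(nat_of_ord (@ord_max n)) -tnth_nth tnth_mktuple/=.
    by rewrite eqxx mulrN.
  rewrite /= (eq_stopped_sum _ zk) zn /S /H /S; case: ifP => _ //; by rewrite oppr0.
have fin : (2%:E * sqnorm P setT (S a n.+1) <=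
    2%:E * (\sum_(i < n) sqnorm P setT (fun w => (c i * xi i w)%R) +
            sqnorm P setT (fun w => (c n * xi n w)%R)))%E.
  have -> : (2%:E * sqnorm P setT (S a n.+1) =
      sqnorm P setT (S a n.+1) + sqnorm P setT (fun w => (S a n w - H w)%R))%E.
    rewrite -eqs -[X in _ = (X + X)%E]mul1e -ge0_muleDl ?sqnorm_ge0//.
  rewrite -[X in (X <= _)%E]ge0_integralD//; last first.
  - by apply: measurable_sqr; exact: measurable_funB.
  - by move=> w _; rewrite lee_fin sqr_ge0.
  - by apply: measurable_sqr; exact: measurable_stopped_sum.
  - by move=> w _; rewrite lee_fin sqr_ge0.
  apply: (@le_trans _ _ (2%:E * (sqnorm P setT (S a n) + sqnorm P setT H))%E).
    rewrite -[X in (_ <= _ * X)%E]ge0_integralD//; last first.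
    - exact: measurable_sqr.
    - by move=> w _; rewrite lee_fin sqr_ge0.
    - exact: measurable_sqr.
    - by move=> w _; rewrite lee_fin sqr_ge0.
    rewrite -ge0_integralZl//; last first.
    - by move=> w _; rewrite adde_ge0// lee_fin sqr_ge0.
    - by apply: emeasurable_funD; exact: measurable_sqr.
    rewrite le_eqVlt; apply/orP; left; apply/eqP/eq_integral => w _.
    rewrite -!EFinD -EFinM; congr EFin.
    by rewrite {1}/S/= -/(S a n w) -/(H w); ring.
  rewrite lee_wpmul2l// leeD//.
  apply: sqnorm_le => // w _; rewrite /H; case: ifP => // _.
  by rewrite normr0.
by move: fin; rewrite lee_pmul2l.
Qed.

(** Kolmogorov's inequality: Chebyshev's bound for the stopped sum, whose value at n remembers any
    earlier passage. *)
Lemma maximal_inequality (a : R) n : 0 < a ->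
  (P [set w | (exists2 k, (k <= n)%N & a <= `|\sum_(i < k) c i * xi i w|)%R] <=
   (a ^- 2)%:E * \sum_(i < n) sqnorm P setT (fun w => (c i * xi i w)%R))%E.
Proof.
move=> a0.
have mcx k : measurable_fun setT (fun w => c k * xi k w) by exact: measurable_funM.
have mS : measurable_fun setT (S a n) by exact: measurable_stopped_sum.
have mA : measurable [set w | a <= `|S a n w|].
  rewrite -[X in measurable X]setTI.
  by apply: measurable_fun_le => //; exact: measurableT_comp.
have mE : measurable [set w | exists2 k, (k <= n)%N & a <= `|(\sum_(i < k) c i * xi i w)%R|].
  rewrite (_ : mkset _ = \bigcup_(k in [set k | (k <= n)%N]) [set w | a <= `|(\sum_(i < k) c i * xi i w)%R|]).
    apply: bigcup_measurable => k _.
    rewrite -[X in measurable X]setTI.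
    apply: measurable_fun_le => //; apply: measurableT_comp => //.
    exact: measurable_sum.
  by apply/seteqP; split=> [w [k kn ka]|w [k kn ka]]; exists k.
apply: (@le_trans _ _ (P [set w | a <= `|S a n w|])).
  by rewrite le_measure ?inE// => w /=; exact: max_sum_stopped.
apply: le_trans; first exact: chebyshev_sqnorm.
by rewrite lee_wpmul2l ?lee_fin ?invr_ge0 ?sqr_ge0//; exact: sqnorm_stopped_sum.
Qed.

End maximal_inequality.

(** * Reversal of Brownian increments *)

Lemma normal_prob_oppr (R : realType) (s : R) (B : set R) : s != 0 -> measurable B ->
  normal_prob 0 s (-%R @^-1` B) = normal_prob 0 s B.
Proof.
move=> s0 mB; rewrite /normal_prob.
have pN (x : R) : normal_pdf 0 s (- x) = normal_pdf 0 s x.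
  by rewrite normal_pdfE// /normal_fun !subr0 sqrrN.
have mpdf : measurable_fun setT (fun x : R => (normal_pdf 0 s x)%:E).
  by apply/measurable_EFinP; exact: measurable_normal_pdf.
transitivity (\int[pushforward (@lebesgue_measure R) (-%R : _ -> measurableTypeR R)]_(x in B)
    (normal_pdf 0 s x)%:E)%E.
  rewrite ge0_integral_pushforward//.
  - by apply: eq_integral => x _; rewrite /= pN.
  - exact: measurable_funTS.
  - by move=> x _; rewrite lee_fin normal_pdf_ge0.
by apply: eq_measure_integral => A mA _; exact: lebesgue_measureN.
Qed.

Section increments.
Context (R : realType) d (T : measurableType d) (P : probability T R).
Variables (W : R -> T -> R).
Hypothesis hW : is_brownian P W.
Variable t : nat -> R.
Hypotheses (t0 : 0 <= t 0%N) (tS : forall k, t k <= t k.+1).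

Definition incr k (w : T) : R := W (t k.+1) w - W (t k) w.

Lemma time_ge0 k : 0 <= t k.
Proof. by elim: k => // k IH; exact: le_trans IH (tS k). Qed.

Lemma measurable_incr k : measurable_fun setT (incr k).
Proof. by apply: measurable_funB; apply: (bm_measurable hW); exact: time_ge0. Qed.

Lemma measurable_mktuple n (f : 'I_n -> T -> R) :
  (forall i, measurable_fun setT (f i)) ->
  measurable_fun setT (fun w => [tuple f i w | i < n]).
Proof.
move=> mf; apply/measurable_fun_tnthP => i.
apply: (eq_measurable_fun (f i)) => // w _ /=.
by rewrite tnth_mktuple.
Qed.

Lemma incr_rect n (B : 'I_n -> set R) : (forall i, measurable (B i)) ->
  P ((fun w => [tuple incr i w | i < n]) @^-1` rect B) =
  (\prod_(i < n) P (incr i @^-1` B i))%E.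
Proof.
(* [bm_indep] takes a family of sets indexed by all natural numbers; the missing ones are filled
   with [setT]. *)
move=> mB; pose B' k := oapp B setT (insub k).
have B'E (i : 'I_n) : B' i = B i by rewrite /B' valK.
have mB' k : measurable (B' k) by rewrite /B'; case: (insub k : option 'I_n) => [i|]; [exact: mB|exact: measurableT].
transitivity (P (\bigcap_(k in `I_n) incr k @^-1` B' k)).
  congr (P _); apply/seteqP; split=> [w tB k /= kn|w wB i].
    by have := tB (Ordinal kn); rewrite tnth_mktuple -B'E.
  by rewrite tnth_mktuple -B'E; exact: (wB i (ltn_ord i)).
rewrite (bm_indep hW)//; apply: eq_bigr => i _; by rewrite B'E.
Qed.

Lemma incr_oppr k (B : set R) : measurable B ->
  P (incr k @^-1` (-%R @^-1` B)) = P (incr k @^-1` B).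
Proof.
move=> mB; have := tS k; rewrite le_eqVlt => /predU1P[tk|tk].
  by congr (P _); apply/seteqP; split=> w; rewrite /= /incr tk subrr oppr0.
rewrite (bm_normal hW)//; last 2 first.
  exact: time_ge0.
  by rewrite -[X in measurable X]setTI; apply: oppr_measurable.
rewrite (bm_normal hW)//; last exact: time_ge0.
by apply: normal_prob_oppr => //; rewrite gt_eqF// sqrtr_gt0 subr_gt0.
Qed.

(** On rectangles, flipping the last increment reflects the last side, and each increment has a
    symmetric law. This is the hypothesis [sym] of the maximal inequality. *)
Lemma incr_flip_last n (f : n.+1.-tuple R -> \bar R) : measurable_fun setT f ->
  (\int[P]_w f [tuple incr i w | i < n.+1]%R =
   \int[P]_w f [tuple (if i == n :> nat then - incr i w else incr i w) | i < n.+1]%R)%E.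
Proof.
move=> mf; apply: eq_integral_tuple_law => //.
- by apply: measurable_mktuple => i; exact: measurable_incr.
- apply: measurable_mktuple => i; case: (i == n :> nat); last exact: measurable_incr.
  by apply: measurableT_comp => //; exact: measurable_incr.
move=> B mB.
pose B' (i : 'I_n.+1) := if i == n :> nat then -%R @^-1` B i else B i.
have mB' i : measurable (B' i).
  rewrite /B'; case: ifP => // _.
  by rewrite -[X in measurable X]setTI; apply: oppr_measurable.
transitivity (P ((fun w => [tuple incr i w | i < n.+1]) @^-1` rect B')).
  rewrite !incr_rect//; apply: eq_bigr => i _; rewrite /B'; case: ifP => // _.
  by rewrite incr_oppr.
congr (P _); apply/seteqP; split=> w wB i; have := wB i; rewrite !tnth_mktuple /B';
  by case: ifP.
Qed.

(** Equal spacing makes the increments identically distributed, so permuting the sides of a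
    rectangle keeps the product of probabilities. *)
Lemma incr_rev n (f : n.-tuple R -> \bar R) (delta : R) : 0 < delta ->
  (forall k, t k.+1 - t k = delta) -> measurable_fun setT f ->
  (\int[P]_w f [tuple incr i w | i < n]%R =
   \int[P]_w f [tuple incr (rev_ord i) w | i < n]%R)%E.
Proof.
move=> delta0 tdelta mf; apply: eq_integral_tuple_law => //.
- by apply: measurable_mktuple => i; exact: measurable_incr.
- by apply: measurable_mktuple => i; exact: measurable_incr.
move=> B mB.
transitivity (P ((fun w => [tuple incr i w | i < n]) @^-1` rect (B \o @rev_ord n))).
  rewrite !incr_rect//; last by move=> i; exact: mB.
  rewrite [RHS](reindex_inj rev_ord_inj)/=; apply: eq_bigr => i _.
  have lt k : t k < t k.+1 by rewrite -subr_gt0 tdelta.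
  by rewrite rev_ordK !(bm_normal hW) ?tdelta// time_ge0.
congr (P _); apply/seteqP; split=> w wB i; have := wB (rev_ord i).
  by rewrite /= !tnth_mktuple rev_ordK.
by rewrite !tnth_mktuple rev_ordK.
Qed.

End increments.

(** * Wiener integrals *)

Lemma lee_add_cvg0 (R : realType) (a b : \bar R) (u : nat -> \bar R) :
  (forall k, a <= b + u k)%E -> u k @[k --> \oo] --> 0%E -> (a <= b)%E.
Proof.
move=> abu u0; have cv : (b + u k @[k --> \oo] --> b + 0)%E.
  by apply: cvgeD => //; [exact: fin_num_adde_defl|exact: cvg_cst].
by rewrite adde0 in cv; apply: (cvge_ge _ cv); exact: nearW.
Qed.

Lemma cvge0_lin (R : realType) (a b : R) (u v : nat -> \bar R) :
  u k @[k --> \oo] --> 0%E -> v k @[k --> \oo] --> 0%E ->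
  (a%:E * u k + b%:E * v k)%E @[k --> \oo] --> 0%E.
Proof.
move=> u0 v0.
have : (a%:E * u k + b%:E * v k)%E @[k --> \oo] --> (a%:E * 0 + b%:E * 0)%E.
  by apply: cvgeD; [rewrite !mule0|exact: cvgeZl|exact: cvgeZl].
by rewrite !mule0 adde0.
Qed.

Lemma geometric_nneseries_lty (R : realType) (a z : R) : `|z| < 1 ->
  (\sum_(k <oo) (a * z ^+ k)%:E < +oo)%E.
Proof.
move=> z1; have : eseries (fun k => (a * z ^+ k)%:E) @ \oo --> (a / (1 - z))%:E.
  apply: cvg_EFin; first by apply: nearW => k; rewrite /eseries/= sumEFin.
  rewrite [X in X @ _ --> _](_ : _ = series (geometric a z)); first exact: cvg_geometric_series.
  by apply/funext => k; rewrite /eseries/= sumEFin.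
by move=> /cvg_lim; rewrite /eseries/= => ->//; rewrite ltry.
Qed.

Lemma integral_cst_probability d (T : measurableType d) (R : realType)
  (P : probability T R) (c : R) : (\int[P]_w c%:E = c%:E)%E.
Proof.
rewrite integral_cst// -[X in (_ * X)%E]/(P setT).
have : P setT = 1%E by exact: probability_setT.
by move=> E; transitivity (c%:E * 1)%E; [congr (_ * _)%E|rewrite mule1].
Qed.

Section sqnorm_distance.
Context d (T : measurableType d) (R : realType) (mu : {measure set T -> \bar R}).
Implicit Types (D : set T) (f g h : T -> R).

Lemma sqnorm_sub_swap D f g :
  sqnorm mu D (fun x => f x - g x) = sqnorm mu D (fun x => g x - f x).
Proof. by apply: eq_integral => x _; congr EFin; ring. Qed.

Lemma sqnorm_triangle D g f h : measurable D -> measurable_fun D f ->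
  measurable_fun D g -> measurable_fun D h ->
  (sqnorm mu D (fun x => f x - h x)%R <=
   2%:E * sqnorm mu D (fun x => f x - g x)%R + 2%:E * sqnorm mu D (fun x => g x - h x)%R)%E.
Proof.
move=> mD mf mg mh; apply: sqnorm_leD => //; try exact: measurable_funB.
by move=> x _; rewrite (le_trans _ (ler_normD _ _))// addrA subrK.
Qed.

Lemma sqnorm0_ae_eq f g : measurable_fun setT f -> measurable_fun setT g ->
  sqnorm mu setT (fun x => f x - g x) = 0%E -> {ae mu, forall x, f x = g x}.
Proof.
move=> mf mg fg0; have mfg : measurable_fun setT (fun x => f x - g x) by exact: measurable_funB.
have /(ae_eq_integral_abs mu measurableT (measurable_sqr mfg)) :
    (\int[mu]_x `|((f x - g x)%R ^+ 2)%:E| = 0)%E.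
  by rewrite -[RHS]fg0; apply: eq_integral => x _; rewrite gee0_abs// lee_fin sqr_ge0.
apply: filterS => x /(_ I) []/eqP; rewrite sqrf_eq0 subr_eq0 => /eqP ->//.
Qed.

End sqnorm_distance.

Section wiener_integral.
Context (R : realType) d (T : measurableType d) (P : probability T R).
Variables (W : R -> T -> R).
Hypothesis hW : is_brownian P W.
Notation mu := (@lebesgue_measure R).
Notation R0 := (`[0%R, +oo[%classic : set R).
Implicit Types (s : seq (R * R * R)) (h : R -> R) (I : T -> R).

Definition step_times s := all (fun p => 0 <= p.1.1 <= p.1.2) s.

Definition step_scale (c : R) s : seq (R * R * R) := [seq (p.1, c * p.2) | p <- s].

Lemma step_times_cat s1 s2 : step_times s1 -> step_times s2 -> step_times (s1 ++ s2).
Proof. by rewrite /step_times all_cat => -> ->. Qed.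

Lemma step_times_scale c s : step_times s -> step_times (step_scale c s).
Proof. by rewrite /step_times all_map; apply: sub_all. Qed.

Lemma step_fun_cat s1 s2 x : step_fun (s1 ++ s2) x = step_fun s1 x + step_fun s2 x.
Proof. by rewrite /step_fun big_cat. Qed.

Lemma step_integral_cat s1 s2 w :
  step_integral W (s1 ++ s2) w = step_integral W s1 w + step_integral W s2 w.
Proof. by rewrite /step_integral big_cat. Qed.

Lemma step_fun_scale c s x : step_fun (step_scale c s) x = c * step_fun s x.
Proof. by rewrite /step_fun big_map mulr_sumr; apply: eq_bigr => p _; rewrite mulrA. Qed.

Lemma step_integral_scale c s w :
  step_integral W (step_scale c s) w = c * step_integral W s w.
Proof. by rewrite /step_integral big_map mulr_sumr; apply: eq_bigr => p _; rewrite mulrA. Qed.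

Lemma step_isometryB s1 s2 : step_times s1 -> step_times s2 ->
  sqnorm P setT (fun w => step_integral W s1 w - step_integral W s2 w) =
  sqnorm mu R0 (fun x => step_fun s1 x - step_fun s2 x).
Proof.
move=> h1 h2.
have hs : step_times (s1 ++ step_scale (-1) s2).
  by apply: step_times_cat => //; exact: step_times_scale.
have := step_isometry hW hs.
under eq_sqnorm do rewrite step_integral_cat step_integral_scale mulN1r.
by move=> ->; apply: eq_sqnorm => x _; rewrite step_fun_cat step_fun_scale mulN1r.
Qed.

(** Allows any step function close to h, not only those in the definition of the integral. The
    comparison goes through the defining sequence and uses the isometry; two squared triangle
    inequalities give 4 = 2 * 2. *)
Lemma wiener_integral_step_dist h I s : is_wiener_integral P W h I -> step_times s ->
  (sqnorm P setT (fun w => step_integral W s w - I w)%R <=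
   4%:E * sqnorm mu R0 (fun x => step_fun s x - h x)%R)%E.
Proof.
move=> [mh mI [u [uok uh uI]]] hs.
have ms := measurable_step_integral hW hs.
have mu_ k := measurable_step_integral hW (uok k).
pose v k := (4%:E * sqnorm mu R0 (fun x => step_fun (u k) x - h x)%R +
             2%:E * sqnorm P setT (fun w => step_integral W (u k) w - I w)%R)%E.
apply: (@lee_add_cvg0 _ _ _ v) => [k|].
- apply: le_trans; first exact: (sqnorm_triangle P measurableT ms (mu_ k) mI).
  rewrite step_isometryB//.
  have := sqnorm_triangle mu (@measurable_R0 R) (measurable_step_fun s (D := R0)) mh (measurable_step_fun (u k) (D := R0)).
  rewrite (sqnorm_sub_swap mu R0 h) => tri.
  apply: (@le_trans _ _ (2%:E * (2%:E * sqnorm mu R0 (fun x => step_fun s x - h x)%R +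
     2%:E * sqnorm mu R0 (fun x => step_fun (u k) x - h x)%R) +
     2%:E * sqnorm P setT (fun w => step_integral W (u k) w - I w)%R)%E).
    by rewrite leeD2r// lee_wpmul2l.
  rewrite ge0_muleDr ?mule_ge0 ?sqnorm_ge0// !muleA -EFinM /v addeA.
  by rewrite (_ : (2 * 2 = 4 :> R)%R)//; ring.
- exact: cvge0_lin.
Qed.

(** The step integrals converging to I also converge to I', by the previous estimate. *)
Lemma wiener_integral_unique h I I' : is_wiener_integral P W h I ->
  is_wiener_integral P W h I' -> {ae P, forall w, I w = I' w}.
Proof.
move=> hI hI'; have [mh mI [u [uok uh uI]]] := hI; have [_ mI' _] := hI'.
apply: sqnorm0_ae_eq => //; apply/eqP; rewrite eq_le sqnorm_ge0 andbT.
have mu_ k := measurable_step_integral hW (uok k).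
pose v k := (2%:E * sqnorm P setT (fun w => step_integral W (u k) w - I w)%R +
   8%:E * sqnorm mu R0 (fun x => step_fun (u k) x - h x)%R)%E.
apply: (@lee_add_cvg0 _ _ _ v) => [k|].
- rewrite add0e; apply: le_trans; first exact: (sqnorm_triangle P measurableT mI (mu_ k) mI').
  rewrite sqnorm_sub_swap /v leeD2l//.
  rewrite (_ : (8 = 2 * 4 :> R)%R); last by ring.
  by rewrite EFinM -muleA lee_wpmul2l//; exact: wiener_integral_step_dist.
- exact: cvge0_lin.
Qed.

Lemma wiener_integralD h1 h2 I1 I2 : is_wiener_integral P W h1 I1 ->
  is_wiener_integral P W h2 I2 ->
  is_wiener_integral P W (fun x => h1 x + h2 x) (fun w => I1 w + I2 w).
Proof.
move=> [mh1 mI1 [u1 [uok1 uh1 uI1]]] [mh2 mI2 [u2 [uok2 uh2 uI2]]].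
split; [exact: measurable_funD|exact: measurable_funD|].
exists (fun k => u1 k ++ u2 k); split.
- by move=> k; exact: step_times_cat.
- apply: (@squeeze_cvge _ _ _ _ (cst 0%E) _ (fun k =>
    2%:E * sqnorm mu R0 (fun x => step_fun (u1 k) x - h1 x)%R +
    2%:E * sqnorm mu R0 (fun x => step_fun (u2 k) x - h2 x)%R)%E); last 2 first.
  + exact: cvg_cst.
  + exact: cvge0_lin.
  + apply: nearW => k; rewrite sqnorm_ge0/=; apply: sqnorm_leD.
    * exact: measurable_R0.
    * by apply: measurable_funB; [exact: measurable_step_fun|exact: measurable_funD].
    * by apply: measurable_funB; [exact: measurable_step_fun|].
    * by apply: measurable_funB; [exact: measurable_step_fun|].
    * move=> x _; rewrite step_fun_cat (le_trans _ (ler_normD _ _))//.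
      by rewrite [leRHS](_ : _ = `|step_fun (u1 k) x + step_fun (u2 k) x - (h1 x + h2 x)|)//; congr `| _ |; ring.
- apply: (@squeeze_cvge _ _ _ _ (cst 0%E) _ (fun k =>
    2%:E * sqnorm P setT (fun x => step_integral W (u1 k) x - I1 x)%R +
    2%:E * sqnorm P setT (fun x => step_integral W (u2 k) x - I2 x)%R)%E); last 2 first.
  + exact: cvg_cst.
  + exact: cvge0_lin.
  + have mu1 k := measurable_step_integral hW (uok1 k).
    have mu2 k := measurable_step_integral hW (uok2 k).
    have mu12 k := measurable_step_integral hW (step_times_cat (uok1 k) (uok2 k)).
    apply: nearW => k; rewrite sqnorm_ge0/=; apply: sqnorm_leD => //.
    * by apply: measurable_funB => //; exact: measurable_funD.
    * exact: measurable_funB.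
    * exact: measurable_funB.
    * move=> x _; rewrite step_integral_cat (le_trans _ (ler_normD _ _))//.
      by rewrite [leRHS](_ : _ = `|step_integral W (u1 k) x + step_integral W (u2 k) x - (I1 x + I2 x)|)//; congr `| _ |; ring.
Qed.

Lemma wiener_integralZ c h I : is_wiener_integral P W h I ->
  is_wiener_integral P W (fun x => c * h x) (fun w => c * I w).
Proof.
move=> [mh mI [u [uok uh uI]]].
split; [exact: measurable_funM|exact: measurable_funM|].
exists (fun k => step_scale c (u k)); split.
- by move=> k; exact: step_times_scale.
- rewrite [X in X @ _ --> _](_ : _ = fun k =>
    (c ^+ 2)%:E * sqnorm mu R0 (fun x => step_fun (u k) x - h x)%R)%E.
    by rewrite -[X in _ --> X](mule0 (c ^+ 2)%:E)%E; exact: cvgeZl.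
  apply/funext => k; rewrite -sqnormZ//.
  + by apply: eq_integral => x _; rewrite step_fun_scale mulrBr.
  + by apply: measurable_funB => //; exact: measurable_step_fun.
- rewrite [X in X @ _ --> _](_ : _ = fun k =>
    (c ^+ 2)%:E * sqnorm P setT (fun x => step_integral W (u k) x - I x)%R)%E.
    by rewrite -[X in _ --> X](mule0 (c ^+ 2)%:E)%E; exact: cvgeZl.
  apply/funext => k; rewrite -sqnormZ//.
  + by apply: eq_integral => x _; rewrite step_integral_scale mulrBr.
  + by apply: measurable_funB => //; exact: (measurable_step_integral hW).
Qed.

Lemma wiener_integral0 : is_wiener_integral P W (cst 0) (cst 0).
Proof.
split; [exact: measurable_cst|exact: measurable_cst|].
exists (fun=> [::]); split => //.
- rewrite [X in X @ _ --> _](_ : _ = cst 0%E); first exact: cvg_cst.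
  apply/funext => k; under eq_integral do rewrite /step_fun big_nil subrr expr0n/=.
  by rewrite integral0.
- rewrite [X in X @ _ --> _](_ : _ = cst 0%E); first exact: cvg_cst.
  apply/funext => k; under eq_integral do rewrite /step_integral big_nil subrr expr0n/=.
  by rewrite integral0.
Qed.

Lemma wiener_integral_sum n (c : 'I_n -> R) (h : 'I_n -> R -> R) (I : 'I_n -> T -> R) :
  (forall i, is_wiener_integral P W (h i) (I i)) ->
  is_wiener_integral P W (fun x => \sum_(i < n) c i * h i x)
    (fun w => \sum_(i < n) c i * I i w).
Proof.
elim: n c h I => [|n IH] c h I hI.
  under [X in is_wiener_integral _ _ X _]eq_fun do rewrite big_ord0.
  under [X in is_wiener_integral _ _ _ X]eq_fun do rewrite big_ord0.
  exact: wiener_integral0.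
under [X in is_wiener_integral _ _ X _]eq_fun do rewrite big_ord_recr.
under [X in is_wiener_integral _ _ _ X]eq_fun do rewrite big_ord_recr.
apply: wiener_integralD; last exact: wiener_integralZ.
exact: (IH (fun i => c (widen_ord (leqnSn n) i)) (fun i => h (widen_ord (leqnSn n) i))
  (fun i => I (widen_ord (leqnSn n) i))).
Qed.

(* An almost sure limit of the step integrals is automatically an L^2 limit,
   by Fatou's lemma and the isometry. *)
Lemma wiener_integral_ae_lim h I (u : nat -> seq (R * R * R)) :
  measurable_fun R0 h -> measurable_fun setT I ->
  (forall k, step_times (u k)) ->
  sqnorm mu R0 (fun x => step_fun (u k) x - h x) @[k --> \oo] --> 0%E ->
  {ae P, forall w, step_integral W (u k) w @[k --> \oo] --> I w} ->
  is_wiener_integral P W h I.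
Proof.
move=> mh mI uok uh uI; split=> //; exists u; split=> //.
have mu_ k := measurable_step_integral hW (uok k).
apply: (@squeeze_cvge _ _ _ _ (cst 0%E) _ (fun k =>
    2%:E * sqnorm mu R0 (fun x => step_fun (u k) x - h x)%R)%E); last 2 first.
- exact: cvg_cst.
- by rewrite -[X in _ --> X](mule0 2%:E)%E; exact: cvgeZl.
apply: nearW => k; rewrite sqnorm_ge0/=.
pose f l w := (((step_integral W (u k) w - step_integral W (u l) w)%R ^+ 2)%:E)%E.
have mf l : measurable_fun setT (f l) by apply: measurable_sqr; exact: measurable_funB.
have f0 l w : (0 <= f l w)%E by rewrite lee_fin sqr_ge0.
have mlim : measurable_fun setT (fun w => limn_einf (f^~ w)).
  rewrite (_ : (fun w => _) = (fun w => - limn_esup (fun l => - f l w))%E).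
    apply: measurableT_comp => //; apply: measurable_fun_limn_esup => l.
    exact: measurableT_comp.
  by apply/funext => w; rewrite /limn_einf.
have eqlim : sqnorm P setT (fun w => step_integral W (u k) w - I w) =
    (\int[P]_w limn_einf (f^~ w))%E.
  apply: ge0_ae_eq_integral => //.
  - by apply: measurable_sqr; exact: measurable_funB.
  - by move=> w _; rewrite lee_fin sqr_ge0.
  - move=> w _; rewrite limn_einf_lim; apply: lime_ge; first exact: is_cvg_einfs.
    by apply: nearW => l; apply: le_ereal_inf_tmp => _ [j _ <-]; exact: f0.
  apply: filterS uI => w uI _; apply/esym.
  suff : f l w @[l --> \oo] --> ((step_integral W (u k) w - I w) ^+ 2)%:E.
    by move=> /cvg_limn_einf_sup[].
  apply: cvg_EFin; first exact: nearW.
  have E : (step_integral W (u k) w - step_integral W (u l) w) @[l --> \oo] -->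
     step_integral W (u k) w - I w.
    by apply: cvgB => //; exact: cvg_cst.
  exact: (cvg_comp _ _ E (@sqr_continuous _ _)).
rewrite [X in (X <= _)%E]eqlim; apply: le_trans; first exact: fatou.
have bnd l : (\int[P]_w f l w <= 2%:E * sqnorm mu R0 (fun x => step_fun (u k) x - h x)%R
   + 2%:E * sqnorm mu R0 (fun x => step_fun (u l) x - h x)%R)%E.
  rewrite [X in (X <= _)%E]step_isometryB// (sqnorm_sub_swap mu R0 (step_fun (u l))).
  by apply: sqnorm_triangle => //; exact: measurable_step_fun.
rewrite limn_einf_lim.
have cv : (2%:E * sqnorm mu R0 (fun x => step_fun (u k) x - h x)%R
   + 2%:E * sqnorm mu R0 (fun x => step_fun (u l) x - h x)%R)%E @[l --> \oo] -->
   (2%:E * sqnorm mu R0 (fun x => step_fun (u k) x - h x)%R + 2%:E * 0)%E.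
  apply: cvgeD; [by rewrite mule0 fin_num_adde_defl|exact: cvg_cst|exact: cvgeZl].
rewrite mule0 adde0 in cv.
apply: (lee_cvg_to _ cv); first exact: is_cvg_einfs.
apply: nearW => l; apply: le_trans (bnd l).
by apply: ereal_inf_lbound; exists l => /=.
Qed.


(** The sum of the absolute increments has finite expectation, hence is finite almost surely, and
    the telescoping series converges absolutely. *)
Lemma ae_cvg_summable (X : nat -> T -> R) (b : nat -> R) :
  (forall k, measurable_fun setT (X k)) ->
  (forall k, \int[P]_w `|X k.+1 w - X k w|%:E <= (b k)%:E)%E ->
  (\sum_(k <oo) (b k)%:E < +oo)%E ->
  {ae P, forall w, cvgn (fun k => X k w)}.
Proof.
move=> mX Xb bfin.
have mD k : measurable_fun setT (fun w => `|X k.+1 w - X k w|%:E).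
  by apply/measurable_EFinP; apply: measurableT_comp => //; exact: measurable_funB.
pose S w := (\sum_(k <oo) `|X k.+1 w - X k w|%:E)%E.
have mS : measurable_fun setT S.
  by apply: ge0_emeasurable_sum => // k w _ _; rewrite lee_fin.
have S0 w : (0 <= S w)%E by apply: nneseries_ge0 => k _ _; rewrite lee_fin.
have iS : P.-integrable setT S.
  apply/integrableP; split => //.
  under eq_integral do rewrite gee0_abs//.
  rewrite integral_nneseries//.
  apply: le_lt_trans bfin; apply: lee_nneseries => [k _ _|k _]; last exact: Xb.
  by apply: integral_ge0 => w _; rewrite lee_fin.
have := integrable_ae measurableT iS.
apply: filterS => w /(_ I) Sfin.
have : cvgn (series (fun k => `|X k.+1 w - X k w|)).
  apply: nondecreasing_is_cvgn.
    by apply/nondecreasing_seqP => k; rewrite /series/= big_nat_recr//= lerDl.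
  exists (fine (S w)) => _ [k _ <-].
  rewrite -lee_fin fineK// /series/= -sumEFin.
  by apply: nneseries_lim_ge => j _ _; rewrite lee_fin.
move=> /normed_cvg.
have -> : series (fun k => X k.+1 w - X k w) = (fun k => X k w - X 0%N w).
  by apply/funext => k; rewrite /series/= telescope_sumr.
move=> /cvg_ex[l cl]; apply/cvg_ex; exists (l + X 0%N w).
rewrite (_ : (fun k => X k w) = (fun k => (X k w - X 0%N w) + X 0%N w)).
  by apply: cvgD cl _; exact: cvg_cst.
by apply/funext => k; rewrite subrK.
Qed.

(** A Riesz-Fischer argument: step functions with squared errors 8^-k have step integrals that
    converge almost surely. *)
Lemma wiener_integral_exists h : measurable_fun R0 h ->
  (forall e : R, 0 < e -> exists2 s, step_times s &
     (sqnorm mu R0 (fun x => step_fun s x - h x)%R <= e%:E)%E) ->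
  exists I, is_wiener_integral P W h I.
Proof.
move=> mh happrox.
have /choice[u uP] (k : nat) : exists s, step_times s /\
    (sqnorm mu R0 (fun x => step_fun s x - h x)%R <= ((8^-1 : R) ^+ k)%:E)%E.
  by have [|s s1 s2] := happrox ((8^-1 : R) ^+ k); [rewrite exprn_gt0|exists s].
have uok k : step_times (u k) by case: (uP k).
pose X k := step_integral W (u k).
have mX k : measurable_fun setT (X k) by exact: (measurable_step_integral hW).
have Xb k : (\int[P]_w `|X k.+1 w - X k w|%:E <= (5 * (2^-1 : R) ^+ k)%:E)%E.
  have q : (sqnorm P setT (fun w => X k.+1 w - X k w)%R <= (4 * (8^-1 : R) ^+ k)%:E)%E.
    rewrite step_isometryB//; apply: le_trans.
      apply: (sqnorm_triangle mu (@measurable_R0 R) (measurable_step_fun _ (D := R0)) mh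
        (measurable_step_fun _ (D := R0))).
    rewrite (sqnorm_sub_swap mu R0 h).
    apply: (@le_trans _ _ (2%:E * ((8^-1 : R) ^+ k.+1)%:E + 2%:E * ((8^-1 : R) ^+ k)%:E)%E).
      by apply: leeD; apply: lee_wpmul2l => //; case: (uP k.+1); case: (uP k).
    rewrite -!EFinM -EFinD lee_fin exprS.
    have : 0 < (8^-1 : R) ^+ k by rewrite exprn_gt0.
    by move: (_ ^+ k) => y; lra.
  (* The inequality |x| <= 2^k x^2 + 2^-k passes from L^2 to L^1. As 2^k * 4 * 8^-k <= 4 * 2^-k, the
     total is 5 * 2^-k. *)
  apply: (@le_trans _ _ (\int[P]_w ((2 ^+ k)%:E * ((X k.+1 w - X k w) ^+ 2)%:E + ((2^-1 : R) ^+ k)%:E))%E).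
    apply: ge0_le_integral => //.
    - by apply/measurable_EFinP; apply: measurableT_comp => //; exact: measurable_funB.
    - apply: emeasurable_funD => //; apply: measurable_funeM; apply: measurable_sqr.
      exact: measurable_funB.
    - move=> w _; rewrite -EFinM -EFinD lee_fin -[X in _ <= _ * X + _]real_normK ?num_real//.
      move: (normr_ge0 (X k.+1 w - X k w)); move: (`|_|) => x x0.
      have : (2 : R) ^+ k * 2^-1 ^+ k = 1 by rewrite -exprMn divff// expr1n.
      have : 0 < (2 : R) ^+ k by rewrite exprn_gt0.
      move: (2 ^+ k) (2^-1 ^+ k) => a b a0 ab.
      have b0 : 0 < b by nra.
      have : 0 <= b * (x * a - 1) ^+ 2 by rewrite mulr_ge0 ?sqr_ge0 ?ltW.
      have -> : b * (x * a - 1) ^+ 2 = (a * b) * (a * x ^+ 2) - 2 * (a * b) * x + b by ring.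
      by rewrite ab; lra.
  rewrite ge0_integralD//; last 2 first.
  - by move=> w _; rewrite mule_ge0// lee_fin ?sqr_ge0// exprn_ge0.
  - by apply: measurable_funeM; apply: measurable_sqr; exact: measurable_funB.
  rewrite integral_cst_probability ge0_integralZl//; first last.
  - by move=> w _; rewrite lee_fin sqr_ge0.
  - by apply: measurable_sqr; exact: measurable_funB.
  apply: (@le_trans _ _ ((2 ^+ k)%:E * (4 * (8^-1 : R) ^+ k)%:E + ((2^-1 : R) ^+ k)%:E)%E).
    by rewrite leeD2r// lee_wpmul2l// lee_fin exprn_ge0.
  rewrite -EFinM -EFinD lee_fin.
  have -> : (2 : R) ^+ k * (4 * 8^-1 ^+ k) = 4 * 4^-1 ^+ k.
    rewrite mulrCA -exprMn; congr (_ * _ ^+ _); by field.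
  have : (4^-1 : R) ^+ k <= 2^-1 ^+ k by rewrite lerXn2r ?nnegrE//; lra.
  by move: (4^-1 ^+ k) (2^-1 ^+ k) => a b; lra.
have Xcvg : {ae P, forall w, cvgn (fun k => X k w)}.
  by apply: (ae_cvg_summable mX Xb); apply: geometric_nneseries_lty; rewrite ger0_norm//; lra.
(* The limsup makes I total and measurable; it equals the limit wherever the X k converge. *)
pose I w := fine (limn_esup (fun k => (X k w)%:E)).
exists I; apply: (wiener_integral_ae_lim mh (u := u)) => //.
- apply: measurableT_comp => //; apply: measurable_fun_limn_esup => k.
  exact/measurable_EFinP.
- apply: (@squeeze_cvge _ _ _ _ (cst 0%E) _ (fun k => ((8^-1 : R) ^+ k)%:E)).
  + by apply: nearW => k; rewrite sqnorm_ge0/=; case: (uP k).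
  + exact: cvg_cst.
  + apply: cvg_EFin; first exact: nearW.
    by apply: cvg_expr; rewrite ger0_norm//; lra.
- apply: filterS Xcvg => w /cvg_ex[l cl]; rewrite /I.
  have : (X k w)%:E @[k --> \oo] --> l%:E by apply: cvg_EFin; [exact: nearW|].
  by move=> /cvg_limn_einf_sup[_ ->].
Qed.

End wiener_integral.

(** * Step functions on uniform grids *)

(** Heine-Cantor with only x confined to K: [bounded_continuous_quadratic] applies it when just one
    of the two vectors is known to be bounded. *)
Lemma compact_unif_continuous (R : realType) (X : pseudoMetricType R) (K : set X)
    (f : X -> R) : compact K -> (forall x, K x -> {for x, continuous f}) ->
  forall e : R, 0 < e -> exists2 delta : R, 0 < delta &
    forall x y, K x -> ball x delta y -> `|f x - f y| < e.
Proof.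
move=> /compact_near_coveringP cK cf e e0.
have e20 : 0 < e / 2 by rewrite divr_gt0.
have F0 : Filter ((0 : R)^'+) by typeclasses eauto.
have [|delta0 /= d0 dP] :=
    cK R (0^'+) (fun delta x => forall y, ball x delta y -> `|f x - f y| < e) F0.
  move=> x Kx; have /cvgrPdist_lt/(_ _ e20) := cf x Kx.
  move=> /nbhs_ballP[eta /= eta0 etaf].
  have h20 : 0 < eta / 2 by rewrite divr_gt0.
  exists (ball x (eta / 2), [set delta | delta < eta / 2]) => /=.
    split; first exact: nbhsx_ballx.
    exact: nbhs_right_lt.
  move=> [x' delta] /= [xx' deta] y x'y.
  have h1 : `|f x - f x'| < e / 2.
    by apply: etaf; apply: le_ball xx'; rewrite ler_pdivrMr// ler_pMr// ler1n.
  have h2 : `|f x - f y| < e / 2.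
    apply: etaf; rewrite (splitr eta); apply: ball_triangle xx' _.
    exact: le_ball (ltW deta) _ x'y.
  rewrite (_ : f x' - f y = (f x - f y) - (f x - f x')); last by ring.
  by rewrite (le_lt_trans (ler_normB _ _))// (splitr e) ltrD.
exists (delta0 / 2); first by rewrite divr_gt0.
move=> x y Kx; apply: (dP (delta0 / 2)) => //=; last by rewrite divr_gt0.
by rewrite sub0r normrN ger0_norm ?divr_ge0 ?ltW// ltr_pdivrMr// ltr_pMr// ltr1n.
Qed.

Lemma segment_unif_continuous (R : realType) (f : R -> R) (a b : R) : continuous f ->
  forall e : R, 0 < e -> exists2 delta : R, 0 < delta &
    forall x y, a <= x <= b -> `|x - y| < delta -> `|f x - f y| < e.
Proof.
move=> cf e e0.
have [delta d0 dP] := compact_unif_continuous (@segment_compact _ a b) (fun x _ => cf x) e0.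
by exists delta => // x y xab; apply: dP.
Qed.

Section grid_step.
Context {R : realType}.
Notation mu := (@lebesgue_measure R).
Notation R0 := (`[0%R, +oo[%classic : set R).
Implicit Types (delta t x : R) (n k : nat) (c : nat -> R).

(** Clipping both ends of a cell at t empties the cells beyond t, so t need not be a node and the
    step integral becomes a process in t. *)
Definition grid_step delta n c t : seq (R * R * R) :=
  [seq (Num.min t (i%:R * delta), Num.min t (i.+1%:R * delta), c i) | i <- index_iota 0 n].

Lemma step_times_grid delta n c t : 0 <= delta -> 0 <= t ->
  step_times (grid_step delta n c t).
Proof.
move=> d0 t0; apply/allP => _ /mapP[i _ ->]/=.
by rewrite le_min t0 mulr_ge0//= le_min !ge_min lexx/= ler_wpM2r ?ler_nat ?leqnSn ?orbT.
Qed.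

Lemma grid_step_integral (T : Type) (W : R -> T -> R) delta n c t w :
  step_integral W (grid_step delta n c t) w =
  \sum_(i < n) c i * (W (Num.min t (i.+1%:R * delta)) w - W (Num.min t (i%:R * delta)) w).
Proof. by rewrite /step_integral big_map big_mkord. Qed.

Lemma grid_cell delta n x : 0 < x -> x <= n%:R * delta ->
  exists2 k, (k < n)%N & k%:R * delta < x <= k.+1%:R * delta.
Proof.
move=> x0; elim: n => [|n IH]; first by rewrite mul0r leNgt x0.
move=> xn; have [/IH[k kn kx]|nx] := leP x (n%:R * delta).
  by exists k => //; rewrite ltnS ltnW.
by exists n => //; rewrite nx xn.
Qed.

Lemma grid_step_fun_cell delta n c t k x : 0 < delta -> (k < n)%N ->
  k%:R * delta < x <= k.+1%:R * delta -> x <= t ->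
  step_fun (grid_step delta n c t) x = c k.
Proof.
move=> d0 kn /andP[kx xk] xt.
rewrite /step_fun big_map big_mkord (bigD1 (Ordinal kn))//= big1 ?addr0.
  by rewrite indicE mem_setE in_itv/= gt_min kx orbT le_min xt xk mulr1.
move=> i; rewrite -val_eqE/= neq_ltn => /orP[ik|ki].
  rewrite indicE mem_setE in_itv/= [X in _ && X](_ : _ = false) ?andbF ?mulr0//.
  rewrite le_min xt/=; apply/negbTE; rewrite -ltNge (le_lt_trans _ kx)//.
  by rewrite ler_pM2r// ler_nat.
rewrite indicE mem_setE in_itv/= gt_min (ltNge t) xt/=.
rewrite [X in X && _](_ : _ = false) ?mulr0//.
by apply/negbTE; rewrite -leNgt (le_trans xk)// ler_pM2r// ler_nat.
Qed.

Lemma grid_step_fun_out delta n c t x : t < x ->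
  step_fun (grid_step delta n c t) x = 0.
Proof.
move=> tx; rewrite /step_fun big_map big1// => i _.
rewrite indicE mem_setE in_itv/= [X in _ && X](_ : _ = false) ?andbF ?mulr0//.
by rewrite le_min (leNgt x) tx.
Qed.

Lemma grid_step_approx delta n c t (h : R -> R) (e : R) : 0 < delta -> t <= n%:R * delta ->
  (forall k x, (k < n)%N -> k%:R * delta < x <= k.+1%:R * delta -> x <= t ->
    `|c k - h x| <= e) ->
  forall x, 0 < x <= t -> `|step_fun (grid_step delta n c t) x - h x| <= e.
Proof.
move=> d0 tn ch x /andP[x0 xt].
have [k kn kx] := grid_cell x0 (le_trans xt tn).
by rewrite (grid_step_fun_cell _ _ kn kx)//; exact: ch.
Qed.

(** The point 0 is dropped because steps live on cells ]a, b], so grid estimates say nothing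
    there. *)
Lemma sqnorm_halfline_split t (f : R -> R) : 0 <= t -> measurable_fun R0 f ->
  sqnorm mu R0 f = (sqnorm mu `]0%R, t] f + sqnorm mu `]t, +oo[ f)%E.
Proof.
move=> t0 mf.
have mf' : measurable_fun (`]0%R, +oo[%classic : set R) f.
  apply: measurable_funS mf; first exact: measurable_itv.
  by move=> x/=; rewrite !in_itv/= !andbT => /ltW.
have -> : sqnorm mu R0 f = sqnorm mu `]0%R, +oo[ f.
  by rewrite /sqnorm integral_itv_obnd_cbnd//; exact: measurable_sqr.
have U : `]0%R, +oo[%classic = `]0%R, t] `|` `]t, +oo[.
  by rewrite -itv_bndbnd_setU// bnd_simp.
rewrite U in mf' *; rewrite /sqnorm ge0_integral_setU//.
- exact: measurable_sqr.
- by move=> x _; rewrite lee_fin sqr_ge0.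
- apply/disj_setPS => x /= []; rewrite !in_itv/= andbT => /andP[_ xt].
  by rewrite ltNge xt.
Qed.

Lemma sqnorm_segment_le t (f : R -> R) (e : R) : 0 <= t -> measurable_fun R0 f ->
  (forall x, 0 < x <= t -> `|f x| <= e) ->
  (sqnorm mu `]0%R, t] f <= (e ^+ 2 * t)%:E)%E.
Proof.
move=> t0 mf fe; apply: le_trans.
  apply: (@sqnorm_bound _ _ _ mu `]0%R, t] f e) => //=.
  - apply: measurable_funS mf; first exact: measurable_itv.
    by move=> x/=; rewrite !in_itv/= andbT => /andP[/ltW].
rewrite [X in (_ * X)%E]lebesgue_measure_itv/= lte_fin.
case: ifPn => [_|]; first by rewrite oppr0 adde0.
by rewrite -leNgt => t0'; rewrite mule0 lee_fin mulr_ge0 ?sqr_ge0.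
Qed.

Lemma sqnorm_exp_tail t (f : R -> R) (K lam : R) : 0 <= t -> 0 < lam ->
  measurable_fun R0 f -> (forall x, t < x -> `|f x| <= K * expR (- lam * x)) ->
  (sqnorm mu `]t, +oo[ f <= (K ^+ 2 / (2 * lam) * expR (- (2 * lam) * t))%:E)%E.
Proof.
move=> t0 lam0 mf fK.
pose g x := K ^+ 2 * expR (- (2 * lam) * x).
pose G x := - (K ^+ 2 / (2 * lam)) * expR (- (2 * lam) * x).
have l2 : 2 * lam != 0 by rewrite mulf_neq0 ?gt_eqF.
have dG x : is_derive x 1 G (g x).
  rewrite /G /g; apply: is_derive_eq; rewrite /GRing.scale/=; field.
  by rewrite gt_eqF.
have cexp (a : R) : continuous (fun x => expR (a * x)).
  move=> x; apply: continuous_comp; last exact: continuous_expR.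
  by apply: cvgM; [exact: cvg_cst|exact: cvg_id].
have cg : continuous g by move=> x; apply: cvgM; [exact: cvg_cst|exact: cexp].
have cG : continuous G by move=> x; apply: cvgM; [exact: cvg_cst|exact: cexp].
have g0 x : 0 <= g x by rewrite mulr_ge0 ?sqr_ge0 ?expR_ge0.
have Gint : (\int[mu]_(x in `[t, +oo[) (g x)%:E = 0%:E - (G t)%:E)%E.
  apply: ge0_continuous_FTC2y => //.
  - exact: continuous_subspaceT.
  - rewrite -[X in _ --> X](mulr0 (- (K ^+ 2 / (2 * lam)))).
    apply: cvgM; first exact: cvg_cst.
    have l0 : 0 < 2 * lam by rewrite mulr_gt0.
    have lx : (2 * lam * x) @[x --> +oo%R] --> +oo%R by exact/(gt0_cvgMry l0)/cvg_id.
    rewrite [X in X @ _ --> _](_ : _ = (fun x => expR (- (2 * lam * x)))); last first.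
      by apply/funext => x; rewrite mulNr.
    exact: (cvg_comp _ _ lx (@cvgr_expR R)).
  - exact/cvg_at_right_filter/cG.
  - by move=> x _; rewrite derive1E; apply: (@derive_val _ _ _ _ _ _ _ (dG x)).
apply: (@le_trans _ _ (\int[mu]_(x in `]t, +oo[) (g x)%:E)%E).
  apply: ge0_le_integral => //=.
  - by move=> x _; rewrite lee_fin sqr_ge0.
  - apply: measurable_sqr; apply: measurable_funS mf; first exact: measurable_itv.
    by move=> x/=; rewrite !in_itv/= !andbT => /ltW; exact: le_trans.
  - by apply/measurable_EFinP/measurable_funTS; exact: continuous_measurable_fun.
  - move=> x; rewrite /= in_itv/= andbT => /fK fx; rewrite lee_fin.
    rewrite -[leLHS]real_normK ?num_real//.
    apply: (@le_trans _ _ ((K * expR (- lam * x)) ^+ 2)).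
      by rewrite lerXn2r ?nnegrE// (le_trans _ fx).
    rewrite exprMn /g -expRM_natr.
    by rewrite (_ : - lam * x * 2 = - (2 * lam) * x)//; ring.
rewrite integral_itv_obnd_cbnd; last first.
  by apply/measurable_EFinP/measurable_funTS; exact: continuous_measurable_fun.
by rewrite Gint sub0e -EFinN /G mulNr opprK.
Qed.


(** Up to t the error is uniformly at most e; beyond t the step function vanishes and the whole tail
    of h remains. *)
Lemma sqnorm_grid_le delta n c t (h : R -> R) (e : R) : 0 < delta -> 0 <= t ->
  t <= n%:R * delta -> measurable_fun R0 h ->
  (forall k x, (k < n)%N -> k%:R * delta < x <= k.+1%:R * delta -> x <= t ->
    `|c k - h x| <= e) ->
  (sqnorm mu R0 (fun x => step_fun (grid_step delta n c t) x - h x)%R <=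
   (e ^+ 2 * t)%:E + sqnorm mu `]t, +oo[ h)%E.
Proof.
move=> d0 t0 tn mh ch.
have mf : measurable_fun R0 (fun x => step_fun (grid_step delta n c t) x - h x).
  by apply: measurable_funB => //; exact: measurable_step_fun.
rewrite (sqnorm_halfline_split t0 mf) leeD//.
  by apply: sqnorm_segment_le => // x; exact: grid_step_approx.
rewrite le_eqVlt; apply/orP; left; apply/eqP/eq_integral => x.
by rewrite inE/= in_itv/= andbT => tx; rewrite grid_step_fun_out// sub0r sqrrN.
Qed.

Lemma expR_tail_small (a b e : R) : 0 < a -> 0 < e ->
  exists2 t, 0 < t & b * expR (- a * t) <= e.
Proof.
(* With this t, expR (a t) >= 1 + a t exceeds |b| / e. *)
move=> a0 e0; exists ((`|b| / e + 1) / a).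
  by rewrite divr_gt0// ltr_wpDl// divr_ge0// ltW.
set t := _ / a; have -> : - a * t = - (`|b| / e + 1) by rewrite /t; field; rewrite ?gt_eqF.
rewrite expRN; have E := expR_ge1Dx (`|b| / e + 1).
have be : 0 <= `|b| / e by rewrite divr_ge0// ltW.
have p : 0 < expR (`|b| / e + 1) by exact: expR_gt0.
rewrite ler_pdivrMr// (le_trans (ler_norm _))//.
rewrite -ler_pdivrMl// mulrC; lra.
Qed.

Lemma archi_mul (delta t : R) : 0 < delta -> exists n, t <= n%:R * delta.
Proof.
move=> d0; exists (Num.truncn (t / delta)).+1; rewrite -ler_pdivrMr//.
exact/ltW/truncnS_gt.
Qed.

End grid_step.

Lemma wiener_integral_exists_exp (R : realType) d (T : measurableType d)
    (P : probability T R) (W : R -> T -> R) (h : R -> R) (K lam : R) :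
  is_brownian P W -> continuous h -> 0 < lam ->
  (forall x, 0 <= x -> `|h x| <= K * expR (- lam * x)) ->
  exists I, is_wiener_integral P W h I.
Proof.
move=> hW ch lam0 hK.
have mh (D : set R) : measurable D -> measurable_fun D h.
  by move=> mD; apply: measurable_funTS; exact: continuous_measurable_fun.
apply: (wiener_integral_exists hW); first exact: mh.
move=> e e0; have e20 : 0 < e / 2 by rewrite divr_gt0.
have [t t0 te] := @expR_tail_small _ (2 * lam) (K ^+ 2 / (2 * lam)) _ (mulr_gt0 (@ltr0n R 2) lam0) e20.
(* This uniform error, squared and integrated over a length t, costs e / 2; the tail beyond t costs
   the other half. *)
have et0 : 0 < Num.sqrt (e / 2 / t) by rewrite sqrtr_gt0 divr_gt0.
have [delta d0 hd] := segment_unif_continuous 0 t ch et0.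
(* Cells are half the modulus long, since uniform continuity asks for a distance strictly below
   delta. *)
have d20 : 0 < delta / 2 by rewrite divr_gt0.
have [n tn] := archi_mul t d20.
exists (grid_step (delta / 2) n (fun k => h (k%:R * (delta / 2))) t).
  by apply: step_times_grid; exact: ltW.
apply: le_trans.
  apply: (@sqnorm_grid_le _ _ _ _ _ _ (Num.sqrt (e / 2 / t))) => //; first exact: ltW.
    exact: mh.
  move=> k x kn /andP[kx xk] xt; rewrite distrC ltW// hd//.
    by rewrite xt andbT (le_trans _ (ltW kx))// mulr_ge0// ltW.
  move: xk; rewrite -natr1 mulrDl mul1r ger0_norm ?subr_ge0 ?(ltW kx)//; lra.
rewrite sqr_sqrtr; last by rewrite ltW// divr_gt0.
rewrite divfK ?gt_eqF// (_ : e%:E = (e / 2)%:E + (e / 2)%:E)%E; last first.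
  by rewrite -EFinD -splitr.
rewrite leeD//.
apply: le_trans; first apply: (@sqnorm_exp_tail _ _ _ K lam) => //.
- exact: ltW.
- exact: mh.
- by move=> x tx; rewrite hK// ltW// (lt_trans t0).
- by rewrite lee_fin.
Qed.

(** * A continuous version of the Wiener integral process *)

(** With e k = 2 * 2^-k, the sum of all 2^-l for l >= k, the sequence u - e is nondecreasing and u +
    e nonincreasing from K on. They enclose the limit. *)
Lemma geometric_increments_cvg (R : realType) (u : nat -> R) (K : nat) :
  (forall k, (K <= k)%N -> `|u k.+1 - u k| <= 2^-1 ^+ k) ->
  cvgn u /\ forall k, (K <= k)%N -> `|limn u - u k| <= 2 * 2^-1 ^+ k.
Proof.
move=> uK; pose e k : R := 2 * 2^-1 ^+ k.
have eS k : e k - e k.+1 = 2^-1 ^+ k by rewrite /e exprS; lra.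
have e0 : e k @[k --> \oo] --> (0 : R).
  rewrite -[X in _ --> X](mulr0 2); apply: cvgM; first exact: cvg_cst.
  by apply: cvg_expr; rewrite ger0_norm; lra.
have lo k j : (K <= k)%N -> u k - e k <= u (k + j)%N - e (k + j)%N.
  move=> Kk; elim: j => [|j IH]; first by rewrite addn0.
  apply: le_trans IH _; rewrite addnS.
  have := uK (k + j)%N (leq_trans Kk (leq_addr _ _)); rewrite -eS ler_norml => /andP[]; lra.
have hi k j : (K <= k)%N -> u (k + j)%N + e (k + j)%N <= u k + e k.
  move=> Kk; elim: j => [|j IH]; first by rewrite addn0.
  apply: le_trans _ IH; rewrite addnS.
  have := uK (k + j)%N (leq_trans Kk (leq_addr _ _)); rewrite -eS ler_norml => /andP[]; lra.
have epos k : 0 <= e k by rewrite mulr_ge0// exprn_ge0.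
have cv : cvgn (fun j => u (K + j)%N - e (K + j)%N).
  apply: nondecreasing_is_cvgn.
    apply/nondecreasing_seqP => j; rewrite addnS -addn1; apply: lo.
    exact: leq_addr.
  exists (u K + e K) => _ [j _ <-].
  by rewrite (le_trans _ (hi K j _))//; have := epos (K + j)%N; lra.
have cu : cvgn u.
  have : cvgn (fun j => u (j + K)%N - e (j + K)%N) by under eq_fun do rewrite addnC.
  move=> /cvg_ex[l cl]; apply/cvg_ex; exists (l + 0).
  have {}cl : (fun j => u j - e j) j @[j --> \oo] --> l by rewrite -(cvg_shiftn K).
  rewrite (_ : u = (fun j => (u j - e j) + e j)); first exact: cvgD cl e0.
  by apply/funext => j; rewrite subrK.
split=> // k Kk; rewrite ler_distl.
have ul := cu.
rewrite -/(e k); apply/andP; split.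
- apply: limr_ge => //; exists k => //= l kl.
  rewrite -(subnKC kl); have := lo k (l - k)%N Kk; have := epos (k + (l - k))%N; lra.
- apply: limr_le => //; exists k => //= l kl.
  rewrite -(subnKC kl); have := hi k (l - k)%N Kk; have := epos (k + (l - k))%N; lra.
Qed.

Section grid_process.
Context {R : realType} {T : Type} (W : R -> T -> R).

Definition grid_process (delta : R) n c t w := step_integral W (grid_step delta n c t) w.

Lemma grid_process_incr delta n c i (s s' : R) w : 0 < delta -> (i < n)%N ->
  i%:R * delta <= s -> s <= s' -> s' <= i.+1%:R * delta ->
  grid_process delta n c s' w - grid_process delta n c s w = c i * (W s' w - W s w).
Proof.
move=> d0 ni is' ss si; rewrite /grid_process !grid_step_integral -sumrB.
have le_grid j k : (j <= k)%N -> j%:R * delta <= k%:R * delta by move=> jk; rewrite ler_pM2r// ler_nat.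
rewrite (bigD1 (Ordinal ni))//= big1 ?addr0; last first.
  move=> j; rewrite -val_eqE/= neq_ltn => /orP[ji|ij].
  - have h1 : j.+1%:R * delta <= s by apply: le_trans is'; exact: le_grid.
    have h2 : j%:R * delta <= s by apply: le_trans h1; exact: le_grid.
    by rewrite !min_r ?subrr//; apply: le_trans ss.
  - have h1 : s' <= j%:R * delta by apply: le_trans si _; exact: le_grid.
    have h2 : s' <= j.+1%:R * delta by apply: le_trans h1 _; exact: le_grid.
    by rewrite !min_l ?subrr ?mulr0 ?subrr//; apply: le_trans ss _.
rewrite -mulrBr (min_l si) (min_r (le_trans is' ss)) (min_l (le_trans ss si)) (min_r is').
by congr (_ * _); ring.
Qed.

Lemma grid_process0 (delta : R) n c w : 0 <= delta -> grid_process delta n c 0 w = 0.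
Proof.
move=> d0; rewrite /grid_process grid_step_integral big1// => i _.
by rewrite !min_l ?mulr_ge0// subrr mulr0.
Qed.

Definition dyadic M (q : nat) : R := q%:R / 2 ^+ M.

Lemma dyadic_cell m M r : (m <= M)%N ->
  let i := (r %/ 2 ^ (M - m))%N in
  i%:R * (2^-1 : R) ^+ m <= dyadic M r /\ dyadic M r.+1 <= i.+1%:R * (2^-1) ^+ m.
Proof.
move=> mM i; have p0 : (0 < 2 ^ (M - m))%N by rewrite expn_gt0.
have E : (2^-1 : R) ^+ m = (2 ^ (M - m))%:R / 2 ^+ M.
  rewrite natrX -{2}(subnKC mM) exprD exprVn; field.
  by rewrite !expf_neq0.
rewrite /dyadic E !mulrA -!natrM; split;
  rewrite ler_pM2r ?invr_gt0 ?exprn_gt0// ler_nat.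
- exact: leq_divM.
- by rewrite ltn_ceil.
Qed.

Lemma le_dyadic M q : dyadic M q <= dyadic M q.+1.
Proof. by rewrite /dyadic ler_pM2r ?invr_gt0 ?exprn_gt0// ler_nat. Qed.

(** Brings integrals over grids of different levels to a common finer grid: fine cell r lies in the
    coarse cell r %/ 2 ^ (M - m), whose coefficient it inherits. *)
Lemma grid_process_dyadic m M n c q w : (m <= M)%N -> (q <= n * 2 ^ (M - m))%N ->
  grid_process (2^-1 ^+ m) n c (dyadic M q) w =
  \sum_(r < q) c (r %/ 2 ^ (M - m))%N * (W (dyadic M r.+1) w - W (dyadic M r) w).
Proof.
move=> mM; elim: q => [|q IH] qn.
  by rewrite big_ord0 /dyadic mul0r grid_process0// exprn_ge0.
rewrite big_ord_recr/= -IH; last exact: ltnW.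
have [h1 h2] := dyadic_cell q mM.
have qk : (q %/ 2 ^ (M - m) < n)%N by rewrite ltn_divLR// expn_gt0.
have d0 : 0 < (2^-1 : R) ^+ m by rewrite exprn_gt0.
rewrite -(@grid_process_incr (2^-1 ^+ m) n c _ _ _ w d0 qk h1 (le_dyadic _ _) h2).
by rewrite addrC subrK.
Qed.

End grid_process.

Lemma measurable_max_event d (T : measurableType d) (R : realType) (a : R) n (S : nat -> T -> R) :
  (forall k, (k <= n)%N -> measurable_fun setT (S k)) ->
  measurable [set w | exists2 k, (k <= n)%N & a <= `|S k w| ].
Proof.
move=> mS.
rewrite (_ : mkset _ = \bigcup_(k in [set k | (k <= n)%N]) [set w | a <= `|S k w|]).
  apply: bigcup_measurable => k kn.
  rewrite -[X in measurable X]setTI.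
  by apply: measurable_fun_le => //; apply: measurableT_comp => //; exact: mS.
by apply/seteqP; split=> [w [k kn ka]|w [k kn ka]]; exists k.
Qed.

Section dyadic_approximation.
Context (R : realType) d (T : measurableType d) (P : probability T R).
Variables (W : R -> T -> R).
Hypothesis hW : is_brownian P W.
Variable h : R -> R.
Variable m : nat -> nat.
(** The rate 8^-k is small enough that, against the threshold 2^-k of [gap_event] and the horizon k,
    Kolmogorov's inequality leaves summable probabilities. *)
Hypothesis hm : forall (k : nat) (x y : R), 0 <= x <= k%:R ->
  `|x - y| <= 2^-1 ^+ m k -> `|h x - h y| <= 8^-1 ^+ k.

Definition mesh k : R := 2^-1 ^+ m k.
Definition ncells k := (k * 2 ^ m k)%N.
Definition dyadic_approx k t w := grid_process W (mesh k) (ncells k) (fun i => h (i%:R * mesh k)) t w.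
Definition dyadic_gap k t w := dyadic_approx k.+1 t w - dyadic_approx k t w.

Lemma mesh_gt0 k : 0 < mesh k. Proof. by rewrite exprn_gt0. Qed.

Lemma ncells_mesh k : (ncells k)%:R * mesh k = k%:R.
Proof. by rewrite /ncells /mesh natrM natrX -mulrA -exprMn divff// expr1n mulr1. Qed.

Lemma measurable_approx k t : 0 <= t -> measurable_fun setT (dyadic_approx k t).
Proof.
move=> t0; apply: (measurable_step_integral hW); apply: step_times_grid => //.
exact/ltW/mesh_gt0.
Qed.

(** The coefficient of the r-th increment of level M in the difference of approximations k.+1 and
    k. *)
Definition gap_coef M k r := h ((r %/ 2 ^ (M - m k.+1))%:R * mesh k.+1) -
  h ((r %/ 2 ^ (M - m k))%:R * mesh k).

Lemma dyadic_ge0 M q : 0 <= dyadic M q :> R.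
Proof. by rewrite /dyadic divr_ge0// exprn_ge0. Qed.

Lemma dyadic_le (k M q : nat) : (q <= k * 2 ^ M)%N -> dyadic M q <= k%:R :> R.
Proof. by move=> qk; rewrite /dyadic ler_pdivrMr ?exprn_gt0// -natrX -natrM ler_nat. Qed.

(** Each of the two coarse nodes is within its own mesh of the fine node r, which gives 8^-k +
    8^-(k+1). *)
Lemma gap_coef_le M k r : (m k <= M)%N -> (m k.+1 <= M)%N -> (r < k * 2 ^ M)%N ->
  `|gap_coef M k r| <= 2 * 8^-1 ^+ k.
Proof.
move=> mM mM' rk.
have near l : (m l <= M)%N -> (k <= l)%N ->
    `|h (dyadic M r) - h ((r %/ 2 ^ (M - m l))%:R * mesh l)| <= 8^-1 ^+ l.
  move=> lM kl; apply: hm.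
    by rewrite dyadic_ge0/= dyadic_le// (leq_trans (ltnW rk))// leq_mul2r kl orbT.
  have [h1 h2] := @dyadic_cell R _ _ r lM; have h3 := @le_dyadic R M r.
  rewrite ger0_norm ?subr_ge0//; move: (le_trans h3 h2).
  rewrite -natr1 mulrDl mul1r /mesh; lra.
have := near k mM (leqnn _); have := near k.+1 mM' (leqnSn _).
rewrite /gap_coef exprS; move: (h (dyadic M r)) => y n1 n0.
rewrite (_ : _ - _ = (y - h ((r %/ 2 ^ (M - m k))%:R * mesh k)) -
    (y - h ((r %/ 2 ^ (M - m k.+1))%:R * mesh k.+1))); last by ring.
rewrite (le_trans (ler_normB _ _))//.
have : 0 <= (8^-1 : R) ^+ k by rewrite exprn_ge0.
by lra.
Qed.

Lemma gap_dyadic M k q w : (m k <= M)%N -> (m k.+1 <= M)%N -> (q <= k * 2 ^ M)%N ->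
  dyadic_gap k (dyadic M q) w = \sum_(r < q) gap_coef M k r * incr W (dyadic M) r w.
Proof.
move=> mM mM' qk; rewrite /dyadic_gap /dyadic_approx /mesh !grid_process_dyadic//; last 2 first.
- by rewrite /ncells -mulnA -expnD subnKC.
- by rewrite /ncells -mulnA -expnD subnKC// (leq_trans qk)// leq_mul2r leqnSn orbT.
rewrite -sumrB; apply: eq_bigr => r _; rewrite /gap_coef /incr /mesh; ring.
Qed.

Definition gap_event k M : set T :=
  [set w | exists2 q, (q <= k * 2 ^ M)%N & 2^-1 ^+ k <= `|dyadic_gap k (dyadic M q) w| ].

Lemma measurable_gap_event k M : measurable (gap_event k M).
Proof.
apply: measurable_max_event => q _.
by apply: measurable_funB; apply: measurable_approx; exact: dyadic_ge0.
Qed.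

Lemma gap_event_nondec k : {homo gap_event k : M M' / (M <= M')%N >-> M `<=` M'}.
Proof.
move=> M M' /subnKC <- w [q qk qw]; exists (q * 2 ^ (M' - M))%N.
  by rewrite expnD mulnA leq_mul2r qk orbT.
rewrite (_ : dyadic _ _ = dyadic M q)// /dyadic natrM natrX exprD; field.
by rewrite !expf_neq0.
Qed.

(** There are k 2^M terms of second moment at most (2 * 8^-k)^2 / 2^M. Against the threshold 2^-k
    they give 4 k 16^-k, and k <= 2^k concludes. The bound is independent of M. *)
Lemma gap_event_le k M : (m k <= M)%N -> (m k.+1 <= M)%N ->
  (P (gap_event k M) <= (4 * 8^-1 ^+ k)%:E)%E.
Proof.
move=> mM mM'.
have -> : gap_event k M = [set w | exists2 q, (q <= k * 2 ^ M)%N &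
    2^-1 ^+ k <= `|\sum_(r < q) gap_coef M k r * incr W (dyadic M) r w|].
  by apply/seteqP; split=> w [q qk]; [rewrite gap_dyadic//|rewrite -gap_dyadic//]; exists q.
have t0 : 0 <= dyadic M 0 :> R by exact: dyadic_ge0.
have a0 : 0 < (2^-1 : R) ^+ k by rewrite exprn_gt0.
apply: le_trans.
  apply: (@maximal_inequality _ _ _ P (incr W (dyadic M)) _ _ (gap_coef M k) _ (k * 2 ^ M)%N a0).
  - by move=> j; apply: (measurable_incr hW t0 (@le_dyadic R M)).
  - by move=> n f; exact: (incr_flip_last hW t0 (@le_dyadic R M)).
apply: (@le_trans _ _ (((2^-1 ^+ k) ^- 2)%:E * \sum_(i < k * 2 ^ M) ((2 * 8^-1 ^+ k) ^+ 2 / 2 ^+ M)%:E)%E).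
  apply: lee_wpmul2l; first by rewrite lee_fin invr_ge0 sqr_ge0.
  apply: lee_sum => i _; rewrite sqnormZ//; last first.
    exact: (measurable_incr hW t0 (@le_dyadic R M)).
  rewrite sqnorm_bm_incr ?dyadic_ge0// -EFinM lee_fin.
  have -> : `|dyadic M i.+1 - dyadic M i| = 1 / 2 ^+ M :> R.
    by rewrite ger0_norm ?subr_ge0 ?le_dyadic// /dyadic -mulrBl -natr1 [_ + 1]addrC addrK.
  rewrite mul1r ler_pM2r ?invr_gt0 ?exprn_gt0//.
  rewrite -[leLHS]real_normK ?num_real// lerXn2r ?nnegrE ?mulr_ge0 ?exprn_ge0//.
  exact: gap_coef_le.
rewrite sumEFin sumr_const card_ord -EFinM lee_fin -[_ *+ (k * _)]mulr_natr natrM natrX.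
have -> : (2^-1 ^+ k) ^- 2 * ((2 * 8^-1 ^+ k) ^+ 2 / 2 ^+ M * (k%:R * 2 ^+ M)) =
    4 * (k%:R * 16^-1 ^+ k) :> R.
  have -> : (8^-1 : R) ^+ k = (2^-1 ^+ k) ^+ 3 by rewrite -exprM mulnC exprM; congr (_ ^+ _); field.
  have -> : (16^-1 : R) ^+ k = (2^-1 ^+ k) ^+ 4 by rewrite -exprM mulnC exprM; congr (_ ^+ _); field.
  by field; rewrite !expf_neq0.
rewrite ler_pM2l//.
have -> : (8^-1 : R) ^+ k = 2 ^+ k * 16^-1 ^+ k by rewrite -exprMn; congr (_ ^+ _); field.
by rewrite ler_pM2r ?exprn_gt0// -natrX ler_nat ltnW// ltn_expl.
Qed.

(** An increasing union over all dyadic levels; it starts at the first level that refines both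
    grids, where [gap_event_le] applies. *)
Definition gap_bad k : set T := \bigcup_M gap_event k (maxn (m k) (m k.+1) + M)%N.

Lemma measurable_gap_bad k : measurable (gap_bad k).
Proof. by apply: bigcup_measurable => M _; exact: measurable_gap_event. Qed.

Lemma gap_bad_le k : (P (gap_bad k) <= (4 * 8^-1 ^+ k)%:E)%E.
Proof.
have : (P (gap_event k (maxn (m k) (m k.+1) + M)%N) @[M --> \oo] --> P (gap_bad k))%E.
  apply: nondecreasing_cvg_mu.
  - by move=> M; exact: measurable_gap_event.
  - exact: measurable_gap_bad.
  - by move=> M M' MM'; apply/subsetPset; apply: gap_event_nondec; rewrite leq_add2l.
move=> gcv; apply: (cvge_le _ gcv); apply: nearW => M; apply: gap_event_le.
- by rewrite (leq_trans (leq_maxl _ (m k.+1)))// leq_addr.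
- by rewrite (leq_trans (leq_maxr (m k) _))// leq_addr.
Qed.

Lemma lim_sup_gap_bad : P (lim_sup_set gap_bad) = 0%E.
Proof.
apply: lim_sup_set_cvg0; first exact: measurable_gap_bad.
apply: (@le_lt_trans _ _ (\sum_(k <oo) (4 * (8^-1 : R) ^+ k)%:E)%E).
  by apply: lee_nneseries => k _ //; exact: gap_bad_le.
apply: geometric_nneseries_lty; rewrite ger0_norm; lra.
Qed.

End dyadic_approximation.

Lemma continuous_sum (R : realType) (X : topologicalType) (I : Type) (r : seq I)
    (f : I -> X -> R) :
  (forall i, continuous (f i)) -> continuous (fun x => \sum_(i <- r) f i x).
Proof.
move=> cf; elim: r => [|i r IH].
  by under [X in continuous X]eq_fun do rewrite big_nil; exact: cst_continuous.
under [X in continuous X]eq_fun do rewrite big_cons.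
by move=> x; apply: cvgD; [exact: cf|exact: IH].
Qed.

Section continuous_version.
Context (R : realType) d (T : measurableType d) (P : probability T R).
Variables (W : R -> T -> R).
Hypothesis hW : is_brownian P W.
Variable h : R -> R.
Hypothesis ch : continuous h.
Notation mu := (@lebesgue_measure R).
Notation R0 := (`[0%R, +oo[%classic : set R).
Variable m : nat -> nat.
Hypothesis hm : forall (k : nat) (x y : R), 0 <= x <= k%:R ->
  `|x - y| <= 2^-1 ^+ m k -> `|h x - h y| <= 8^-1 ^+ k.
Variable N : set T.
Hypothesis mN : measurable N.
Hypothesis N0 : P N = 0%E.
Hypothesis Ngap : lim_sup_set (gap_bad W h m) `<=` N.
Hypothesis NW : forall w, ~ N w -> {within R0, continuous (fun t => W t w)}.

Local Notation approx := (dyadic_approx W h m).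
Local Notation gap := (dyadic_gap W h m).

Lemma continuous_max0 : continuous (fun t : R => Num.max 0 t).
Proof. by move=> t; apply: (@continuous_max _ _ (cst 0) id); [exact: cvg_cst|exact: cvg_id]. Qed.

(** Extending a path by its value at 0 to negative times trades continuity within the half line for
    continuity on the line. *)
Lemma continuous_halfline (f : R -> R) : {within R0, continuous f} ->
  continuous (fun t : R => f (Num.max 0 t)).
Proof.
move=> cf t; apply/cvgrPdist_lt => e e0.
have m0 : R0 (Num.max 0 t) by rewrite /= in_itv/= le_max lexx.
have := (subspace_continuousP R0 f).1 cf _ m0.
move=> /cvgrPdist_lt/(_ _ e0) H.
have H' := @continuous_max0 t _ H.
have {}H' : \forall s \near t, R0 (Num.max 0 s) -> `|f (Num.max 0 t) - f (Num.max 0 s)| < e by exact: H'.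
by apply: filterS H' => s; apply; rewrite /= in_itv/= le_max lexx.
Qed.

Lemma continuous_approx k w : ~ N w -> continuous (fun t : R => approx k (Num.max 0 t) w).
Proof.
move=> Nw; have cW := continuous_halfline (NW Nw).
have cmin (a : R) : 0 <= a -> continuous (fun t : R => W (Num.min (Num.max 0 t) a) w).
  move=> a0.
  rewrite (_ : (fun t : R => _) = (fun t : R => W (Num.max 0 t) w) \o (fun t : R => Num.min (Num.max 0 t) a)).
    move=> t; apply: continuous_comp; last exact: cW.
    apply: (@continuous_min _ _ (fun t : R => Num.max 0 t) (cst a)); last exact: cvg_cst.
    exact: continuous_max0.
  by apply/funext => t /=; rewrite (max_r (y := Num.min _ _))// le_min le_max lexx.
rewrite /dyadic_approx /grid_process; under eq_fun do rewrite grid_step_integral.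
apply: continuous_sum => i t; apply: cvgM; first exact: cvg_cst.
by apply: cvgB; apply: cmin; rewrite mulr_ge0// ltW// mesh_gt0.
Qed.

Lemma dyadic_dense (t : R) (k : nat) (delta : R) (M0 : nat) : 0 <= t <= k%:R -> 0 < delta ->
  exists M q, [/\ (M0 <= M)%N, (q <= k * 2 ^ M)%N & `|t - dyadic M q| < delta].
Proof.
move=> /andP[t0 tk] d0.
have [M1 M1d] : exists M1, (2^-1 : R) ^+ M1 < delta.
  have : (2^-1 : R) ^+ M @[M --> \oo] --> (0 : R) by apply: cvg_expr; rewrite ger0_norm; lra.
  move=> /cvgrPdist_lt/(_ _ d0)[M1 _ M1P]; exists M1.
  by have := M1P M1 (leqnn _); rewrite /= sub0r normrN ger0_norm// exprn_ge0.
exists (maxn M0 M1), (Num.truncn (t * 2 ^+ maxn M0 M1)).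
set M := maxn _ _; have M2 : 0 < (2 : R) ^+ M by rewrite exprn_gt0.
have tM : 0 <= t * 2 ^+ M by rewrite mulr_ge0// ltW.
have /andP[q1 q2] := truncn_itv tM.
split; first exact: leq_maxl.
- rewrite -(@ler_nat R) (le_trans q1)// natrM natrX ler_pM2r//.
- rewrite /dyadic ger0_norm; last by rewrite subr_ge0 ler_pdivrMr.
  apply: le_lt_trans M1d.
  apply: (@le_trans _ _ ((2^-1 : R) ^+ M)); last first.
    by rewrite ler_wiXn2l ?leq_maxr//; lra.
  rewrite lerBlDr exprVn -[X in X + _]mul1r -mulrDl ler_pdivlMr//.
  by rewrite addrC natr1 ltW.
Qed.

(** If the bound failed at a real time, it would fail at a nearby dyadic node by continuity, and w
    would lie in [gap_bad]. *)
Lemma gap_le_eventually w : ~ N w -> exists K, forall k t, (K <= k)%N -> 0 <= t <= k%:R ->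
  `|gap k t w| <= 2^-1 ^+ k.
Proof.
move=> Nw; have : ~ lim_sup_set (gap_bad W h m) w by move=> /Ngap.
rewrite /lim_sup_set => /existsNP[K /not_implyP[_ Kw]].
exists K => k t Kk tk.
have nb : ~ gap_bad W h m k w by move=> b; apply: Kw; exists k.
rewrite leNgt; apply/negP => gt.
have t0 : Num.max 0 t = t by rewrite max_r//; case/andP: tk.
have cg : continuous (fun s : R => gap k (Num.max 0 s) w).
  by move=> s; apply: cvgB; exact: continuous_approx.
have g0 : 0 < `|gap k t w| - 2^-1 ^+ k by rewrite subr_gt0.
have := cg t; move=> /cvgrPdist_lt/(_ _ g0); rewrite t0 => /nbhs_ballP[eta /= eta0 etaP].
have [M [q [M0 qk qt]]] := @dyadic_dense t k eta (maxn (m k) (m k.+1)) tk eta0.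
apply: nb; exists (M - maxn (m k) (m k.+1))%N => //; rewrite subnKC//.
exists q => //; have := etaP (dyadic M q) qt.
rewrite max_r ?dyadic_ge0//.
have := ler_normD (gap k t w - gap k (dyadic M q) w) (gap k (dyadic M q) w); rewrite subrK; lra.
Qed.

Lemma approx_cvg w : ~ N w -> exists K, forall k t, (K <= k)%N -> 0 <= t <= k%:R ->
  cvgn (fun l => approx l t w) /\
  `|limn (fun l => approx l t w) - approx k t w| <= 2 * 2^-1 ^+ k.
Proof.
move=> /gap_le_eventually[K KP]; exists K => k t Kk /andP[t0 tk].
have [|c b] := @geometric_increments_cvg R (fun l => approx l t w) k.
  move=> l kl; apply: KP; first exact: leq_trans kl.
  by rewrite t0 (le_trans tk)// ler_nat.
by split=> //; exact: b.
Qed.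

(** The value 0 on the null set [N] makes every path continuous. It keeps the process adapted,
    because the filtration contains the null events. *)
Definition wiener_process (t : R) (w : T) : R :=
  if w \in N then 0 else limn (fun k => approx k (Num.max 0 t) w).

Lemma wiener_process_cvg w t : ~ N w -> 0 <= t ->
  approx k t w @[k --> \oo] --> wiener_process t w.
Proof.
move=> Nw t0; have [K KP] := approx_cvg Nw.
rewrite /wiener_process memNset// max_r//.
have tk : 0 <= t <= (maxn K (Num.truncn t).+1)%:R.
  by rewrite t0/= ltW// (lt_le_trans (truncnS_gt _))// ler_nat leq_maxr.
by have [] := KP _ t (leq_maxl _ _) tk.
Qed.

Lemma wiener_process_le0 t w : t <= 0 -> wiener_process t w = 0.
Proof.
move=> t0; rewrite /wiener_process max_l//; case: ifP => // _.
rewrite (_ : (fun k => _) = cst 0); first exact: lim_cst.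
by apply/funext => k; rewrite /dyadic_approx grid_process0// ltW// mesh_gt0.
Qed.

Lemma continuous_wiener_process w : continuous (fun t => wiener_process t w).
Proof.
have [Nw|Nw] := pselect (N w).
  by rewrite /wiener_process mem_set//; exact: cst_continuous.
have [K KP] := approx_cvg Nw.
move=> t; apply/cvgrPdist_lt => e e0.
have e40 : 0 < e / 8 by rewrite divr_gt0.
have [M1 M1d] : exists M1, (2^-1 : R) ^+ M1 < e / 8.
  have : (2^-1 : R) ^+ M @[M --> \oo] --> (0 : R) by apply: cvg_expr; rewrite ger0_norm; lra.
  move=> /cvgrPdist_lt/(_ _ e40)[M1 _ M1P]; exists M1.
  by have := M1P M1 (leqnn _); rewrite /= sub0r normrN ger0_norm// exprn_ge0.
(* Beyond K the uniform estimate holds, M1 makes 2 * 2^-k smaller than e / 4, and the last bound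
   puts all times within 1 of t below k. *)
pose k := maxn (maxn K M1) (Num.truncn (Num.max 0 t + 1)).+1.
have kd : (2^-1 : R) ^+ k < e / 8.
  apply: le_lt_trans M1d; rewrite ler_wiXn2l; [by []|lra|lra|].
  by rewrite /k leq_max leq_maxr.
have tk : Num.max 0 t + 1 < k%:R.
  by rewrite (lt_le_trans (truncnS_gt _))// ler_nat leq_maxr.
have near s : Num.max 0 s <= k%:R -> `|wiener_process s w - approx k (Num.max 0 s) w| <= e / 4.
  move=> sk; rewrite /wiener_process memNset//.
  have s0k : 0 <= Num.max 0 s <= k%:R by rewrite sk le_max lexx.
  have [_ H] := KP k (Num.max 0 s) (leq_trans (leq_maxl _ _) (leq_maxl _ _)) s0k.
  by apply: le_trans H _; lra.
have e20 : 0 < e / 2 by rewrite divr_gt0.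
have := @continuous_approx k w Nw t; move=> /cvgrPdist_lt/(_ _ e20) H1.
have := @continuous_max0 t; move=> /cvgrPdist_lt/(_ _ ltr01) H2.
near=> s.
have h1 : `|approx k (Num.max 0 t) w - approx k (Num.max 0 s) w| < e / 2 by near: s.
have h2 : `|Num.max 0 t - Num.max 0 s| < 1 by near: s.
have h3 : `|wiener_process t w - approx k (Num.max 0 t) w| <= e / 4 by apply: near; lra.
have h4 : `|wiener_process s w - approx k (Num.max 0 s) w| <= e / 4.
  by apply: near; move: h2; rewrite ltr_norml => /andP[]; lra.
move: h1 h3 h4; move: (approx k _ w) (approx k _ w) => x y.
by rewrite ltr_norml !ler_norml ltr_norml => /andP[? ?] /andP[? ?] /andP[? ?]; apply/andP; split; lra.
Unshelve. all: by end_near. Qed.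

(** The generators of [bm_filtration], named so that the filtration becomes a measurable type and
    measurability of functions can be expressed with [measurable_fun]. *)
Definition bm_generators (t : R) : set (set T) :=
  [set E | exists s (B : set R), [/\ 0 <= s <= t, measurable B & E = W s @^-1` B]]
  `|` [set E | measurable E /\ P E = 0%E].

Lemma bm_filtration_sub t : bm_filtration P W t `<=` measurable.
Proof.
apply: smallest_sub; first exact: sigma_algebra_measurable.
move=> E [[s [B [/andP[s0 _] mB ->]]]|[]//].
by rewrite -[X in measurable X]setTI; exact: (bm_measurable hW).
Qed.

Definition Fmeasurable t (f : T -> R) :=
  @measurable_fun _ _ (g_sigma_algebraType (bm_generators t)) R setT f.

Lemma Fmeasurable_preimage t f (B : set R) : Fmeasurable t f -> measurable B ->
  bm_filtration P W t (f @^-1` B).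
Proof. by move=> mf mB; rewrite -[X in bm_filtration _ _ _ X]setTI; exact: mf. Qed.

Lemma Fmeasurable_measurable t f : Fmeasurable t f -> measurable_fun setT f.
Proof.
by move=> mf _ B mB; rewrite setTI; apply: bm_filtration_sub; exact: (Fmeasurable_preimage mf).
Qed.

Lemma Fmeasurable_bm s t : 0 <= s <= t -> Fmeasurable t (W s).
Proof.
move=> st _ B mB; rewrite setTI; apply: sub_sigma_algebra; left.
by exists s, B.
Qed.

(** The process is an everywhere limit of step integrals at times up to s, set to 0 on [N]; the case
    distinction is allowed since [N] is itself a generator. *)
Lemma Fmeasurable_wiener_process s t : s <= t -> 0 <= t -> Fmeasurable t (wiener_process s).
Proof.
move=> st t0; have [s0|s0] := ltP s 0.
  rewrite (_ : wiener_process s = cst 0); first exact: measurable_cst.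
  by apply/funext => w; rewrite wiener_process_le0// ltW.
apply: (@measurable_fun_cvg _ (g_sigma_algebraType (bm_generators t)) _ setT
  (fun k w => if w \in N then 0 else approx k s w)).
  move=> k; apply: measurable_fun_ifT => //.
  - apply: (measurable_fun_bool true) => //; rewrite setTI.
    rewrite (_ : _ @^-1` _ = N); last first.
      by apply/seteqP; split=> [w /= /set_mem//|w Nw]; rewrite /= mem_set.
    by apply: sub_sigma_algebra; right.
  - rewrite (_ : approx k s = fun w => \sum_(i < ncells m k) h (i%:R * mesh R m k) *
       (W (Num.min s (i.+1%:R * mesh R m k)) w - W (Num.min s (i%:R * mesh R m k)) w)); last first.
      by apply/funext => w; rewrite /dyadic_approx /grid_process grid_step_integral.
    apply: measurable_sum => i; apply: measurable_funM; first exact: measurable_cst.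
    by apply: measurable_funB; apply: Fmeasurable_bm;
      rewrite le_min s0/= ge_min st/= andbT mulr_ge0// ltW// mesh_gt0.
move=> w _; have [Nw|Nw] := pselect (N w).
  by rewrite /wiener_process mem_set//; exact: cvg_cst.
by rewrite memNset//; exact: wiener_process_cvg.
Qed.

Lemma wiener_process_integral t : 0 <= t ->
  is_wiener_integral P W (h \_ `[0, t]) (wiener_process t).
Proof.
move=> t0.
have mh : measurable_fun R0 (h \_ `[0, t]).
  apply: measurable_funTS; apply/(measurable_restrictT _ _).1 => //.
  by apply: measurable_funTS; exact: continuous_measurable_fun.
apply: (@wiener_integral_ae_lim _ _ _ _ _ hW _ _
  (fun k => grid_step (mesh R m k) (ncells m k) (fun i => h (i%:R * mesh R m k)) t)) => //.
- exact: (Fmeasurable_measurable (Fmeasurable_wiener_process (lexx t) t0)).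
- by move=> k; apply: step_times_grid => //; exact/ltW/mesh_gt0.
(* Once t <= k, an error of at most 8^-k is squared and integrated over [0, t]; beyond t both
   functions vanish. *)
- apply: (@squeeze_cvge _ _ _ _ (cst 0%E) _ (fun k => (t * (64^-1 : R) ^+ k)%:E)).
  + near=> k.
    have tk : t <= k%:R by near: k; exact: nbhs_infty_ger.
    rewrite sqnorm_ge0/=; apply: le_trans.
      apply: (@sqnorm_grid_le _ _ _ _ _ _ (8^-1 ^+ k)) => //.
      * exact: mesh_gt0.
      * by rewrite ncells_mesh.
      * move=> i x ik /andP[ix xi] xt.
        have x0 : 0 <= x by rewrite (le_trans _ (ltW ix))// mulr_ge0// ltW// mesh_gt0.
        rewrite patchE mem_set/=; last by rewrite in_itv/= x0 xt.
        rewrite distrC; apply: hm; first by rewrite x0 (le_trans xt).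
        move: xi; rewrite -natr1 mulrDl mul1r ger0_norm ?subr_ge0 ?(ltW ix)// -/(mesh R m k); lra.
    rewrite (_ : sqnorm _ _ _ = 0%E).
      rewrite adde0 lee_fin mulrC -exprM mulnC exprM.
      by rewrite (_ : (8^-1 : R) ^+ 2 = 64^-1)//; field.
    rewrite /sqnorm; apply: integral0_eq => x /=; rewrite in_itv/= andbT => tx.
    by rewrite patchE memNset ?expr0n//= in_itv/= => /andP[_]; rewrite leNgt tx.
  + exact: cvg_cst.
  + apply: cvg_EFin; first exact: nearW.
    rewrite -[X in _ --> X](mulr0 t); apply: cvgM; first exact: cvg_cst.
    by apply: cvg_expr; rewrite ger0_norm; lra.
- exists N; split=> // w /=; apply: contra_notP => Nw.
  exact: wiener_process_cvg.
Unshelve. all: by end_near. Qed.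

End continuous_version.

Lemma wiener_process_exists (R : realType) d (T : measurableType d) (P : probability T R)
    (W : R -> T -> R) (h : R -> R) : is_brownian P W -> continuous h ->
  exists j : R -> T -> R,
    [/\ forall w, continuous (fun t => j t w),
        forall t w, t <= 0 -> j t w = 0,
        forall s t, s <= t -> 0 <= t -> Fmeasurable P W t (j s) &
        forall t, 0 <= t -> is_wiener_integral P W (h \_ `[0, t]) (j t)].
Proof.
move=> hW ch.
have /choice[m hm] (k : nat) : exists m, forall x y : R, 0 <= x <= k%:R ->
    `|x - y| <= 2^-1 ^+ m -> `|h x - h y| <= 8^-1 ^+ k.
  have e0 : 0 < (8^-1 : R) ^+ k by rewrite exprn_gt0.
  have [delta d0 hd] := segment_unif_continuous 0 k%:R ch e0.
  have : (2^-1 : R) ^+ M @[M --> \oo] --> (0 : R) by apply: cvg_expr; rewrite ger0_norm; lra.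
  move=> /cvgrPdist_lt/(_ _ d0)[M1 _ M1P]; exists M1 => x y xk xy.
  apply/ltW/hd => //; apply: le_lt_trans xy _.
  by have := M1P M1 (leqnn _); rewrite /= sub0r normrN ger0_norm// exprn_ge0.
have gap0 : P.-negligible (lim_sup_set (gap_bad W h m)).
  apply/negligibleP; last exact: (lim_sup_gap_bad hW hm).
  apply: bigcap_measurable => // k _; apply: bigcup_measurable => l _.
  exact: (measurable_gap_bad hW).
have [N [mN N0 NP]] := negligibleU (bm_continuous hW) gap0.
have Ngap : lim_sup_set (gap_bad W h m) `<=` N by move=> w wl; apply: NP; right.
have NW w : ~ N w -> {within `[0, +oo[, continuous (fun t => W t w)}.
  by move=> Nw; apply: contrapT => nc; apply: Nw; apply: NP; left.
exists (wiener_process W h m N); split.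
- by apply: continuous_wiener_process => //; exact: NW.
- by move=> t w; exact: wiener_process_le0.
- by move=> s t; apply: Fmeasurable_wiener_process => //; exact: NW.
- by move=> t; apply: wiener_process_integral => //; exact: NW.
Qed.

(** * The matrix exponential *)

Lemma is_derive_bigsum (R : realType) (I : Type) (r : seq I) (f : I -> R -> R)
    (df : I -> R) (t : R) : (forall i, is_derive t 1 (f i) (df i)) ->
  is_derive t 1 (fun x => \sum_(i <- r) f i x) (\sum_(i <- r) df i).
Proof.
move=> fd; elim: r => [|i r IH].
  under [X in is_derive _ _ X _]eq_fun do rewrite big_nil.
  rewrite big_nil; exact: is_derive_cst.
under [X in is_derive _ _ X _]eq_fun do rewrite big_cons.
rewrite big_cons; exact: is_deriveD.
Qed.

Lemma is_derive_continuous (R : realType) (f : R -> R) (t df : R) :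
  is_derive t 1 f df -> {for t, continuous f}.
Proof.
by move=> [fd _]; exact/differentiable_continuous/derivable1_diffP.
Qed.

Lemma cvg_mx_entries (T : Type) (F : set_system T) {FF : Filter F} (R : realType) (m n : nat)
    (u : T -> 'M[R]_(m, n)) (L : 'M[R]_(m, n)) :
  (forall i j, u x i j @[x --> F] --> L i j) -> u x @[x --> F] --> L.
Proof.
move=> uL; apply/cvg_ballP => e e0.
have : \forall k \near F, forall i j, ball (L i j) e (u k i j).
  apply: filter_forall => i; apply: filter_forall => j.
  by move/cvg_ballP : (uL i j) => /(_ _ e0).
by apply: filterS.
Qed.

Section matrix_exponential.
Context {R : realType} {N : nat}.
Implicit Types (A B : 'M[R]_N) (t : R).

Lemma mx_exprZn (x : R) A l : (x *: A) ^+ l = x ^+ l *: A ^+ l.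
Proof.
elim: l => [|l IH]; first by rewrite !expr0 scale1r.
by rewrite !exprS IH -[LHS]/(x *: A *m (x ^+ l *: A ^+ l)) -scalemxAl -scalemxAr scalerA.
Qed.

(* Coefficients of the power series of [B *m expmx (t *: A)], entrywise. *)
Definition expmx_coef B A i j l : R := (B *m A ^+ l) i j / l`!%:R.

Definition absum A : R := \sum_i \sum_j `|A i j|.

Lemma absum_ge0 A : 0 <= absum A.
Proof. by apply: sumr_ge0 => i _; apply: sumr_ge0. Qed.

Lemma le_absum A i j : `|A i j| <= absum A.
Proof.
rewrite /absum (bigD1 i)//= (bigD1 j)//= -addrA lerDl addr_ge0//.
  by apply: sumr_ge0.
by apply: sumr_ge0 => k _; apply: sumr_ge0.
Qed.

Lemma absumM A B : absum (A *m B) <= absum A * absum B.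
Proof.
rewrite /absum mulr_suml; apply: ler_sum => i _.
apply: (@le_trans _ _ (\sum_j \sum_k `|A i k| * `|B k j|)).
  apply: ler_sum => j _; rewrite mxE; apply: le_trans (ler_norm_sum _ _ _) _.
  by apply: ler_sum => k _; rewrite normrM.
rewrite exchange_big/= mulr_suml; apply: ler_sum => k _.
rewrite -mulr_sumr ler_wpM2l//.
by rewrite [leRHS](bigD1 k)//= lerDl; apply: sumr_ge0 => l _; apply: sumr_ge0.
Qed.

Lemma expmx_coef_le B A i j l :
  `|expmx_coef B A i j l| <= absum B * (absum A ^+ l / l`!%:R).
Proof.
rewrite /expmx_coef normrM mulrA normfV normr_nat ler_pM2r ?invr_gt0 ?ltr0n ?fact_gt0//.
apply: (le_trans (le_absum _ i j)).
elim: l => [|l IH]; first by rewrite !expr0 mulmx1 mulr1.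
rewrite !exprSr mulrA -[A ^+ l * A]/(A ^+ l *m A) mulmxA.
by apply: le_trans (absumM _ _) _; rewrite ler_wpM2r// absum_ge0.
Qed.

(** Domination by the scalar exponential series at absum A * |x|. *)
Lemma is_cvg_expmx_coef B A i j (x : R) : cvgn (pseries (expmx_coef B A i j) x).
Proof.
apply: normed_cvg.
apply: (@series_le_cvg _ _ (fun l => absum B * exp_coeff (absum A * `|x|) l)) => //.
- by move=> l /=; rewrite normr_ge0.
- by move=> l; rewrite mulr_ge0 ?absum_ge0// exp_coeff_ge0// mulr_ge0// absum_ge0.
- move=> l; rewrite /exp_coeff /= normrM normrX exprMn.
  have := expmx_coef_le B A i j l; move=> /ler_wpM2r => /(_ (`|x| ^+ l)).
  by rewrite exprn_ge0// => /(_ isT) /le_trans; apply; rewrite -!mulrA [_^-1 * _]mulrC.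
- have := is_cvg_series_exp_coeff (absum A * `|x|).
  move=> /cvg_ex[l cl]; apply/cvg_ex; exists (absum B * l).
  rewrite (_ : series _ = (fun k => absum B * series (exp_coeff (absum A * `|x|)) k)).
    by apply: cvgM => //; exact: cvg_cst.
  by apply/funext => k; rewrite /series/= mulr_sumr.
Qed.

(** Termwise differentiation replaces B by B *m A. The factor B keeps the family closed under it, so
    the second derivative series comes for free. *)
Lemma expmx_coef_diffs B A i j :
  pseries_diffs (expmx_coef B A i j) = expmx_coef (B *m A) A i j.
Proof.
apply/funext => l; rewrite /pseries_diffs /expmx_coef exprS mulmxA factS natrM.
by rewrite invfM mulrCA (mulrA l.+1%:R) divff ?mul1r// pnatr_eq0.
Qed.

Definition expmx_series B A i j (x : R) := limn (pseries (expmx_coef B A i j) x).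

Lemma is_derive_expmx_series B A i j (x : R) :
  is_derive x 1 (expmx_series B A i j) (expmx_series (B *m A) A i j x).
Proof.
rewrite /expmx_series -expmx_coef_diffs.
apply: (@pseries_snd_diffs _ _ (`|x| + 1)).
- exact: is_cvg_expmx_coef.
- by rewrite expmx_coef_diffs; exact: is_cvg_expmx_coef.
- by rewrite !expmx_coef_diffs; exact: is_cvg_expmx_coef.
- by rewrite [ltRHS]ger0_norm ?addr_ge0// ltrDl.
Qed.

Lemma expmx_entry A t i j : expmx (t *: A) i j = expmx_series 1%:M A i j t.
Proof.
suff -> : expmx (t *: A) = \matrix_(i, j) expmx_series 1%:M A i j t by rewrite mxE.
rewrite /expmx; apply/cvg_lim => //; apply: cvg_mx_entries => {}i {}j.
rewrite mxE.
rewrite (_ : (fun k => _) = pseries (expmx_coef 1%:M A i j) t); first exact: is_cvg_expmx_coef.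
apply/funext => k; rewrite /pseries /series/= big_mkord summxE; apply: eq_bigr => l _.
by rewrite mxE mx_exprZn mxE /expmx_coef mul1mx; ring.
Qed.

Lemma expmx_series_mulmx B A i j t :
  expmx_series B A i j t = (B *m expmx (t *: A)) i j.
Proof.
rewrite mxE /expmx_series; apply/cvg_lim => //.
rewrite (_ : pseries (expmx_coef B A i j) t =
   (fun k => \sum_l B i l * pseries (expmx_coef 1%:M A l j) t k)); last first.
  apply/funext => k; rewrite /pseries /series/=.
  under [RHS]eq_bigr do rewrite mulr_sumr.
  rewrite exchange_big/=; apply: eq_bigr => l _.
  rewrite /expmx_coef mxE !mulr_suml; apply: eq_bigr => p _.
  by rewrite mul1mx; ring.
apply: cvg_big; first exact: add_continuous.
move=> l _; apply: cvgM; first exact: cvg_cst.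
by rewrite expmx_entry; exact: is_cvg_expmx_coef.
Qed.

Lemma is_derive_expmx A t i j :
  is_derive t 1 (fun s => expmx (s *: A) i j) ((A *m expmx (t *: A)) i j).
Proof.
under [X in is_derive _ _ X _]eq_fun do rewrite expmx_entry.
by rewrite -expmx_series_mulmx; have := is_derive_expmx_series 1%:M A i j t; rewrite mul1mx.
Qed.

Lemma expmx0 A : expmx (0 *: A) = 1%:M.
Proof.
apply/matrixP => i j; rewrite expmx_entry; apply/cvg_lim => //.
rewrite -(cvg_shiftS (pseries _ 0)).
rewrite (_ : (fun k => _) = cst ((1%:M : 'M[R]_N) i j)); first exact: cvg_cst.
apply/funext => k; rewrite /pseries /series/= big_nat_recl//= big1 ?addr0.
  by rewrite expr0 mulr1 /expmx_coef expr0 mulmx1 fact0 divr1.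
by move=> l _; rewrite exprS mul0r mulr0.
Qed.

End matrix_exponential.

(** * Linear systems with a coercive matrix *)

Section coercive.
Context {R : realType} {N : nat}.
Implicit Types (A B : 'M[R]_N) (u v : 'cV[R]_N).

Definition normsq v : R := \sum_i v i 0 ^+ 2.

Lemma normsq_ge0 v : 0 <= normsq v.
Proof. by apply: sumr_ge0 => i _; rewrite sqr_ge0. Qed.

Lemma normsq_eq0 v : normsq v = 0 -> v = 0.
Proof.
move=> /eqP; rewrite psumr_eq0; last by move=> i _; rewrite sqr_ge0.
move=> /allP v0; apply/matrixP => i j; rewrite ord1 mxE.
by have := v0 i (mem_index_enum _); rewrite sqrf_eq0 => /eqP.
Qed.

Definition bform A u v : R := (u^T *m A *m v) 0 0.

Lemma bformE A u v : bform A u v = \sum_i u i 0 * (A *m v) i 0.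
Proof. by rewrite /bform -mulmxA mxE; apply: eq_bigr => i _; rewrite mxE. Qed.

Lemma bform_sym A u v : A^T = A -> bform A u v = bform A v u.
Proof.
move=> As; rewrite /bform; transitivity ((u^T *m A *m v)^T 0 0); first by rewrite [RHS]mxE.
by rewrite !trmx_mul trmxK As mulmxA.
Qed.

Lemma bform_lin A (a b : R) u v w :
  bform A (a *: u + b *: v) w = a * bform A u w + b * bform A v w.
Proof. by rewrite /bform linearD/= !linearZ/= !mulmxDl -!scalemxAl !mxE. Qed.

(** With b = bform A u v and c = bform A v v, the form at c u - b v is nonnegative and equals c
    times the difference of the two sides. *)
Lemma bform_CS A u v : spd_mx A -> (bform A u v) ^+ 2 <= bform A u u * bform A v v.
Proof.
move=> [As Apos]; have [->|v0] := eqVneq v 0.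
  by rewrite /bform !mulmx0 mxE expr0n mulr0.
have c0 : 0 < bform A v v by exact: Apos.
set c := bform A v v in c0 *; set b := bform A u v.
have q0 w : 0 <= bform A w w.
  have [->|/Apos/ltW//] := eqVneq w 0; by rewrite /bform mulmx0 mxE.
have := q0 (c *: u + (- b) *: v).
rewrite bform_lin (bform_sym u)// (bform_sym v)// !bform_lin -/c (bform_sym v u)// -/b.
move=> H; have : 0 <= c * (bform A u u * c - b ^+ 2).
  by apply: le_trans H _; rewrite le_eqVlt; apply/orP; left; apply/eqP; ring.
by rewrite pmulr_rge0// subr_ge0.
Qed.

Lemma spd_unitmx A : spd_mx A -> A \in unitmx.
Proof.
move=> [As Apos]; rewrite -row_free_unit -kermx_eq0; apply/negPn/negP.
move=> /rowV0Pn[r /sub_kermxP rA r0].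
have /Apos : r^T != 0 by rewrite -(inj_eq (@trmx_inj _ _ _)) trmxK trmx0.
by rewrite trmxK rA mul0mx mxE ltxx.
Qed.

Lemma bform_le A v : bform A v v <= absum A * normsq v.
Proof.
rewrite bformE mulr_suml; apply: ler_sum => i _.
rewrite mxE mulr_sumr mulr_suml; apply: ler_sum => j _.
apply: le_trans (ler_norm _) _; rewrite mulrCA normrM ler_wpM2l//.
have h i' : v i' 0 ^+ 2 <= normsq v.
  by rewrite /normsq (bigD1 i')//= lerDl; apply: sumr_ge0 => k _; rewrite sqr_ge0.
have := h i; have := h j; rewrite normrM.
rewrite -(real_normK (num_real (v i 0))) -(real_normK (num_real (v j 0))).
by have := sqr_ge0 (`|v i 0| - `|v j 0|); nra.
Qed.

(** Cauchy-Schwarz with w = A^-1 v: |v|^4 = B(v, w)^2 <= B(v, v) B(w, w), and B(w, w) = v^T A^-1 v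
    <= absum (A^-1) |v|^2. This gives an explicit rate without eigenvalues; the + 1 in c ensures
    positivity. *)
Lemma spd_coercive A : spd_mx A ->
  exists2 lam : R, 0 < lam & forall v, lam * normsq v <= bform A v v.
Proof.
move=> hA; have [As Apos] := hA; have Au := spd_unitmx hA.
pose c := absum (invmx A) + 1.
have c0 : 0 < c by rewrite ltr_wpDl// absum_ge0.
exists c^-1; first by rewrite invr_gt0.
move=> v; have [->|v0] := eqVneq v 0.
  by rewrite /normsq big1 ?mulr0 /bform ?mulmx0 ?mxE// => i _; rewrite mxE expr0n.
have s0 : 0 < normsq v.
  rewrite lt_neqAle normsq_ge0 andbT eq_sym; apply: contra v0 => /eqP/normsq_eq0 ->//.
pose w := invmx A *m v.
have bvw : bform A v w = normsq v.
  by rewrite bformE /w mulmxA mulmxV// mul1mx; apply: eq_bigr => i _; rewrite expr2.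
have bww : bform A w w = bform (invmx A) v v.
  rewrite /bform /w trmx_mul trmx_inv As -!mulmxA (mulmxA A) mulmxV// mul1mx.
  by rewrite mulmxA.
have CS := @bform_CS A v w hA.
rewrite bvw bww in CS.
have q0 : 0 < bform A v v by exact: Apos.
have : normsq v ^+ 2 <= bform A v v * (c * normsq v).
  apply: le_trans CS _; rewrite ler_wpM2l ?(ltW q0)//.
  apply: le_trans (bform_le _ _) _; rewrite ler_wpM2r ?normsq_ge0//.
  by rewrite /c lerDl.
rewrite expr2 mulrA ler_pM2r// => H.
by rewrite mulrC ler_pdivrMr.
Qed.

End coercive.

Lemma within_continuousM (R : realType) (D : set R) (f g : R -> R) :
  {within D, continuous f} -> {within D, continuous g} ->
  {within D, continuous (fun x => f x * g x)}.
Proof.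
move=> /subspace_continuousP cf /subspace_continuousP cg; apply/subspace_continuousP => x Dx.
by apply: cvgM; [exact: cf|exact: cg].
Qed.

Lemma within_continuous_sum (R : realType) (D : set R) (I : Type) (r : seq I) (f : I -> R -> R) :
  (forall i, {within D, continuous (f i)}) ->
  {within D, continuous (fun x => \sum_(i <- r) f i x)}.
Proof.
move=> cf; apply/subspace_continuousP => x Dx.
apply: cvg_big; first exact: add_continuous.
by move=> i _; have /subspace_continuousP := cf i; exact.
Qed.

Section linear_ode.
Context {R : realType} {N : nat}.
Variables (A : 'M[R]_N) (lam : R).
Hypothesis Alam : forall v, lam * normsq v <= bform A v v.

(** Coercivity makes expR (2 lam s) |x s|^2 nonincreasing. *)
Lemma linear_ode_decay (x : R -> 'cV[R]_N) :
  (forall i, {within `[0, +oo[, continuous (fun t => x t i 0)}) ->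
  (forall (t : R) i, 0 < t -> is_derive t 1 (fun t => x t i 0) (- (A *m x t) i 0)) ->
  forall t, 0 <= t -> normsq (x t) <= normsq (x 0) * expR (- (2 * lam) * t).
Proof.
move=> cx dx t t0.
pose y s := expR (2 * lam * s) * normsq (x s).
have dy (s : R) : 0 < s -> is_derive s 1 y (2 * expR (2 * lam * s) *
    (lam * normsq (x s) - bform A (x s) (x s))).
  move=> s0.
  have dn : is_derive s 1 (fun s => normsq (x s)) (\sum_i 2 * (x s i 0 * - (A *m x s) i 0)).
    apply: is_derive_bigsum => i; have := dx s i s0 => dxi.
    apply: is_derive_eq; rewrite /GRing.scale/=; ring.
  apply: is_derive_eq; rewrite /GRing.scale/= bformE -mulr_sumr.
  under eq_bigr do rewrite mulrN.
  rewrite sumrN; ring.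
have cy : {within `[0, +oo[, continuous y}.
  apply: within_continuousM.
    apply: continuous_subspaceT => s; apply: continuous_comp; last exact: continuous_expR.
    by apply: cvgM; [exact: cvg_cst|exact: cvg_id].
  by apply: within_continuous_sum => i; exact: (within_continuousM (cx i) (cx i)).
have : y t <= y 0.
  apply: (@ler0_derive1_nincry _ y 0) => //.
  - by move=> s; rewrite in_itv/= andbT => s0; case: (dy s s0).
  - move=> s; rewrite in_itv/= andbT => s0; rewrite derive1E.
    have -> := @derive_val _ _ _ _ _ _ _ (dy s s0).
    by rewrite mulr_ge0_le0// ?subr_le0// mulr_ge0// expR_ge0.
rewrite /y mulr0 expR0 mul1r => H.
by rewrite mulNr expRN ler_pdivlMr ?expR_gt0// mulrC.
Qed.

Lemma linear_ode_unique (x : R -> 'cV[R]_N) :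
  (forall i, {within `[0, +oo[, continuous (fun t => x t i 0)}) ->
  (forall (t : R) i, 0 < t -> is_derive t 1 (fun t => x t i 0) (- (A *m x t) i 0)) ->
  x 0 = 0 -> forall t, 0 <= t -> x t = 0.
Proof.
move=> cx dx x0 t t0; apply: normsq_eq0; apply/eqP; rewrite eq_le normsq_ge0 andbT.
have := linear_ode_decay cx dx t0; rewrite x0.
by rewrite /normsq [X in X * _]big1 ?mul0r// => i _; rewrite mxE expr0n.
Qed.

Definition propagator t : 'M[R]_N := expmx (- (t *: A)).

Lemma propagatorE t : propagator t = expmx (t *: - A).
Proof. by rewrite /propagator scalerN. Qed.

Lemma propagator0 : propagator 0 = 1%:M.
Proof. by rewrite propagatorE expmx0. Qed.

Lemma is_derive_propagator (t : R) i j :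
  is_derive t 1 (fun s => propagator s i j) (- (A *m propagator t) i j).
Proof.
under [X in is_derive _ _ X _]eq_fun do rewrite propagatorE.
by have := is_derive_expmx (- A) t i j; rewrite mulNmx mxE propagatorE.
Qed.

Lemma is_derive_propagatorM (v : 'cV[R]_N) (t : R) i :
  is_derive t 1 (fun s => (propagator s *m v) i 0) (- (A *m (propagator t *m v)) i 0).
Proof.
under [X in is_derive _ _ X _]eq_fun do rewrite mxE.
rewrite mulmxA mxE -sumrN; apply: is_derive_bigsum => j.
have := is_derive_propagator t i j => dj.
by apply: is_derive_eq; rewrite /GRing.scale/=; ring.
Qed.

Lemma continuous_propagatorM (v : 'cV[R]_N) i : continuous (fun s => (propagator s *m v) i 0).
Proof. by move=> t; exact: is_derive_continuous (is_derive_propagatorM v t i). Qed.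

Lemma continuous_propagator i j : continuous (fun s => propagator s i j).
Proof. by move=> t; exact: is_derive_continuous (is_derive_propagator t i j). Qed.

(** As functions of t both sides solve x' = -A x with the same value at 0. Uniqueness runs forward,
    hence t >= 0, but s is arbitrary: variation of constants takes it negative. *)
Lemma propagatorD (v : 'cV[R]_N) (s t : R) : 0 <= t ->
  propagator t *m (propagator s *m v) = propagator (t + s) *m v.
Proof.
move=> t0; apply/eqP; rewrite -subr_eq0; apply/eqP.
have subE (a b : 'cV[R]_N) i : (a - b) i 0 = a i 0 - b i 0 by rewrite !mxE.
apply: (@linear_ode_unique (fun t => propagator t *m (propagator s *m v) - propagator (t + s) *m v)) => //.
- move=> i; apply: continuous_subspaceT => r.
  under eq_fun do rewrite subE.
  apply: cvgB; first exact: continuous_propagatorM.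
  apply: (@continuous_comp _ _ _ (fun r : R => r + s) (fun r => (propagator r *m v) i 0)).
    by apply: cvgD; [exact: cvg_id|exact: cvg_cst].
  exact: continuous_propagatorM.
- move=> r i r0.
  have d1 := is_derive_propagatorM (propagator s *m v) r i.
  have d2 : is_derive r 1 (fun r => (propagator (r + s) *m v) i 0)
      (- (A *m (propagator (r + s) *m v)) i 0).
    have := is_derive_propagatorM v (r + s) i => dd.
    have ds : is_derive r 1 (fun r => r + s) 1.
      by apply: is_derive_eq; rewrite addr0.
    have := @is_derive1_comp _ (fun r => (propagator r *m v) i 0) (fun r => r + s) r _ _ dd ds.
    by rewrite mulr1.
  under [X in is_derive _ _ X _]eq_fun do rewrite subE.
  by apply: is_derive_eq; rewrite mulmxBr subE; ring.
- by rewrite propagator0 mul1mx add0r subrr.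
Qed.

Lemma propagator_decay (v : 'cV[R]_N) t i : 0 <= t ->
  `|(propagator t *m v) i 0| <= Num.sqrt (normsq v) * expR (- lam * t).
Proof.
move=> t0.
have := @linear_ode_decay (fun t => propagator t *m v) _ _ t t0.
rewrite propagator0 mul1mx => H.
have {H} : normsq (propagator t *m v) <= normsq v * expR (- (2 * lam) * t).
  apply: H.
  - by move=> j; apply: continuous_subspaceT; exact: continuous_propagatorM.
  - by move=> r j _; exact: is_derive_propagatorM.
move=> H; rewrite -ler_sqr ?nnegrE ?mulr_ge0 ?expR_ge0 ?sqrtr_ge0// real_normK ?num_real//.
rewrite exprMn sqr_sqrtr ?normsq_ge0// -expRM_natr.
have -> : - lam * t * 2 = - (2 * lam) * t by ring.
apply: le_trans H.
by rewrite /normsq (bigD1 i)//= lerDl; apply: sumr_ge0 => k _; rewrite sqr_ge0.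
Qed.

End linear_ode.

(** * Integration by parts along a grid *)

Section integral_of_continuous.
Context {R : realType}.
Notation mu := (@lebesgue_measure R).
Implicit Types (f g : R -> R) (t : R).

Definition primitive f t : R := \int[mu]_(x in `[0, t]) f x.

Lemma continuous_integrable_segment f (a b : R) : continuous f ->
  mu.-integrable `[a, b] (EFin \o f).
Proof.
move=> cf; apply: continuous_compact_integrable; first exact: segment_compact.
exact: continuous_subspaceT.
Qed.

Lemma eq_primitive f g t : (forall x, 0 <= x <= t -> f x = g x) -> primitive f t = primitive g t.
Proof. by move=> fg; apply: eq_Rintegral => x; rewrite inE/= in_itv/=; exact: fg. Qed.

Lemma primitive0 f : primitive f 0 = 0.
Proof. by rewrite /primitive set_itv1 Rintegral_set1. Qed.

Lemma primitiveB f g t : continuous f -> continuous g ->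
  primitive (fun x => f x - g x) t = primitive f t - primitive g t.
Proof. by move=> cf cg; rewrite /primitive RintegralB//; exact: continuous_integrable_segment. Qed.

Lemma primitiveZ f (c : R) t : continuous f ->
  primitive (fun x => c * f x) t = c * primitive f t.
Proof. by move=> cf; rewrite /primitive RintegralZl//; exact: continuous_integrable_segment. Qed.

Lemma primitive_sum n (f : 'I_n -> R -> R) t : (forall i, continuous (f i)) ->
  primitive (fun x => \sum_i f i x) t = \sum_i primitive (f i) t.
Proof.
elim: n f => [|n IH] f cf.
  rewrite big_ord0 (@eq_primitive _ (fun x => 0 * 0)).
    by rewrite primitiveZ ?mul0r//; exact: cst_continuous.
  by move=> x _; rewrite big_ord0 mul0r.
rewrite (@eq_primitive _ (fun x => \sum_(i < n) f (widen_ord (leqnSn n) i) x - (- f ord_max x))).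
  rewrite primitiveB; last 2 first.
  - by apply: continuous_sum.
  - by move=> x; apply: cvgN; exact: cf.
  rewrite IH// big_ord_recr/=; congr (_ + _).
  rewrite (@eq_primitive _ (fun x => -1 * f ord_max x)); last by move=> x _; rewrite mulN1r.
  by rewrite primitiveZ// mulN1r opprK.
by move=> x _; rewrite big_ord_recr/= opprK.
Qed.

Lemma is_derive_primitive f t : continuous f -> 0 < t -> is_derive t 1 (primitive f) (f t).
Proof.
move=> cf t0; have tt1 : t < t + 1 by rewrite ltrDl.
have fi := @continuous_integrable_segment f 0 (t + 1) cf.
have := @continuous_FTC1_closed R f 0 t (t + 1) tt1 fi t0 (cf t).
rewrite -/(primitive f) => -[d1 d2].
by apply: DeriveDef; [exact: d1|rewrite -derive1E; exact: d2].
Qed.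

Lemma within_continuous_primitive f : continuous f -> {within `[0, +oo[, continuous (primitive f)}.
Proof.
move=> cf; apply/continuous_within_itvcyP; split.
  move=> t; rewrite in_itv/= andbT => t0.
  exact: (is_derive_continuous (is_derive_primitive cf t0)).
have := @parameterized_integral_continuous _ 0 1 f ler01 (continuous_integrable_segment 0 1 cf).
by move=> /(continuous_within_itvP _ (@ltr01 R))[_ + _].
Qed.

Lemma primitive_FTC2 f (F : R -> R) t : 0 <= t -> continuous f ->
  {within `[0, +oo[, continuous F} -> (forall x : R, 0 < x -> is_derive x 1 F (f x)) ->
  primitive f t = F t - F 0.
Proof.
move=> t0 cf /continuous_within_itvcyP[cF F0] dF.
move: t0; rewrite le_eqVlt => /predU1P[<-|t0]; first by rewrite primitive0 subrr.
rewrite /primitive /Rintegral (@continuous_FTC2 _ _ F)//.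
- exact: continuous_subspaceT.
- split=> //.
  + by move=> x; rewrite in_itv/= => /andP[x0 _]; case: (dF x x0).
  + by apply: cvg_at_left_filter; apply: cF; rewrite in_itv/= t0.
- move=> x; rewrite in_itv/= => /andP[x0 _]; rewrite derive1E.
  by apply: (@derive_val _ _ _ _ _ _ _ (dF x x0)).
Qed.

End integral_of_continuous.

Section uniform_grid.
Context {R : realType}.
Variable t : R.
Hypothesis t0 : 0 < t.

Definition node n r : R := r%:R * (t / n%:R).

Lemma cell_gt0 n : 0 < t / n.+1%:R.
Proof. by rewrite divr_gt0 ?ltr0n. Qed.

Lemma nodeS n r : node n.+1 r.+1 = node n.+1 r + t / n.+1%:R.
Proof. by rewrite /node -natr1 mulrDl mul1r. Qed.

Lemma node0 n : node n.+1 0 = 0.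
Proof. by rewrite /node mul0r. Qed.

Lemma node_last n : node n.+1 n.+1 = t.
Proof. by rewrite /node mulrCA divff ?mulr1// pnatr_eq0. Qed.

Lemma node_ge0 n r : 0 <= node n.+1 r.
Proof. by rewrite mulr_ge0// ltW// cell_gt0. Qed.

Lemma node_le n r : (r <= n.+1)%N -> node n.+1 r <= t.
Proof. by move=> rn; rewrite -[leRHS](node_last n) ler_pM2r ?cell_gt0// ler_nat. Qed.

(** Reversing time exchanges left and right ends of cells, hence the shift from r to r.+1. *)
Lemma node_rev n r : (r <= n)%N -> t - node n.+1 (n - r) = node n.+1 r.+1.
Proof.
move=> rn; apply/eqP; rewrite subr_eq addrC /node -mulrDl -natrD addnS subnK//.
by rewrite -/(node n.+1 n.+1) node_last.
Qed.

Lemma node_dist n r x : node n.+1 r < x -> x <= node n.+1 r.+1 ->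
  `|node n.+1 r.+1 - x| <= t / n.+1%:R /\ `|node n.+1 r - x| <= t / n.+1%:R.
Proof.
rewrite nodeS; move: (node _ _) (t / _) => a s ax xas; split; rewrite ler_norml; lra.
Qed.

Lemma telescope_node n (g : R -> R) :
  g t - g 0 = \sum_(r < n.+1) (g (node n.+1 r.+1) - g (node n.+1 r)).
Proof.
rewrite -(big_mkord xpredT (fun r => g (node n.+1 r.+1) - g (node n.+1 r))).
by rewrite telescope_sumr// node_last node0.
Qed.

Lemma mesh_lt_near (delta : R) : 0 < delta ->
  \forall n \near \oo, t / n.+1%:R < delta.
Proof.
move=> d0; have [n0 n0P] := archi_mul t d0.
near=> n; rewrite ltr_pdivrMr ?ltr0n// mulrC; apply: le_lt_trans n0P _.
by rewrite ltr_pM2r// ltr_nat ltnS; near: n; exact: nbhs_infty_ge.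
Unshelve. all: by end_near. Qed.

End uniform_grid.

Section riemann_stieltjes.
Context {R : realType}.
Variables (f f' j G : R -> R) (t : R).
Hypothesis t0 : 0 < t.
Hypothesis df : forall s : R, is_derive s 1 f (f' s).
Hypothesis cf' : continuous f'.
Hypothesis cj : continuous j.
Hypothesis cG : {within `[0, t], continuous G}.
Hypothesis dG : forall s : R, 0 < s < t -> is_derive s 1 G (j s * f' s).

(** G is a primitive of j f', so the limit is the integral of f against j by parts. As j is merely
    continuous, derivatives fall on f only. *)
Lemma riemann_stieltjes_parts :
  \sum_(r < n.+1) f (node t n.+1 r) * (j (node t n.+1 r.+1) - j (node t n.+1 r)) @[n --> \oo] -->
  f t * j t - f 0 * j 0 - (G t - G 0).
Proof.
have cf : continuous f by move=> s; exact: is_derive_continuous (df s).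
have [M M0 f'M] : exists2 M, 0 < M & forall s, 0 <= s <= t -> `|f' s| <= M.
  have c0t := @continuous_compact _ _ f' _ (continuous_subspaceT cf') (@segment_compact R 0 t).
  have [M [_ MP]] := compact_bounded c0t.
  exists (`|M| + 1); first by rewrite ltr_wpDl.
  move=> s st; apply: (MP (`|M| + 1)); first by rewrite (le_lt_trans (ler_norm _))// ltrDl.
  by exists s.
apply/cvgrPdist_le => e e0.
(* A cell of length h then contributes at most (e / (M t)) M h = e h / t, and the cells add up to
   e. *)
have e1 : 0 < e / (M * t) by rewrite divr_gt0// mulr_gt0.
have [delta d0 jd] := segment_unif_continuous 0 t cj e1.
near=> n.
have nd : t / n.+1%:R < delta by near: n; exact: mesh_lt_near.
set h := t / n.+1%:R in nd *.
have h0 : 0 < h by exact: cell_gt0.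
have node_itv r : (r <= n.+1)%N -> 0 <= node t n.+1 r <= t by move=> rn; rewrite node_ge0 ?node_le.
rewrite (telescope_node t n (fun s => f s * j s)) (telescope_node t n G) -!sumrB.
apply: le_trans (ler_norm_sum _ _ _) _.
apply: (@le_trans _ _ (\sum_(r < n.+1) (e / t * h))); last first.
  rewrite sumr_const card_ord -mulr_natr /h -mulrA divfK ?pnatr_eq0// divfK// gt_eqF//.
apply: ler_sum => r _.
set a := node t n.+1 r; set b := node t n.+1 r.+1.
have ab : a < b by rewrite /a /b nodeS ltrDl.
have /andP[a0 at_] : 0 <= a <= t by apply: node_itv; rewrite ltnW// ltnS ltn_ord.
have /andP[b0 bt] : 0 <= b <= t by apply: node_itv; exact: ltn_ord.
(* The error on [a, b] is H b - H a, and H' = (j b - j s) f' s is small because j is uniformly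
   continuous. *)
pose H s := j b * f s - G s.
have dH s : s \in `]a, b[ -> is_derive s 1 H ((j b - j s) * f' s).
  rewrite in_itv/= => /andP[as_ sb].
  have dg := dG; have := dg s _; rewrite (le_lt_trans a0 as_) (lt_le_trans sb bt) => /(_ isT) dGs.
  have dfs := df s.
  by apply: is_derive_eq; rewrite /GRing.scale/=; ring.
have cH : {within `[a, b], continuous H}.
  have cGab : {within `[a, b], continuous G}.
    apply: continuous_subspaceW cG => s /=; rewrite !in_itv/= => /andP[as_ sb].
    by rewrite (le_trans a0 as_) (le_trans sb bt).
  apply/subspace_continuousP => s sab; apply: cvgB.
    apply: cvgM; first exact: cvg_cst.
    by apply: (cvg_trans _ (cf s)); apply: cvg_app; apply: cvg_within.
  by move/subspace_continuousP : cGab; apply.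
have [c cab Hc] := MVT ab dH cH.
have -> : f b * j b - f a * j a - (G b - G a) - f a * (j b - j a) = H b - H a.
  by rewrite /H; ring.
have bah : b - a = h by rewrite /a /b nodeS addrC addKr.
rewrite Hc bah 2!normrM (gtr0_norm h0) ler_pM2r//.
move: cab; rewrite in_itv/= => /andP[ac cb].
have c0t : 0 <= c <= t by rewrite (le_trans a0 (ltW ac)) (le_trans (ltW cb) bt).
have -> : e / t = e / (M * t) * M by field; rewrite !gt_eqF.
apply: ler_pM => //; last exact: f'M.
rewrite distrC ltW// jd// distrC ger0_norm ?subr_ge0 ?(ltW cb)//.
by apply: le_lt_trans nd; rewrite -bah; lra.
Unshelve. all: by end_near. Qed.

End riemann_stieltjes.

(** * The reservoir equation along a path *)

Lemma within_continuousD (R : realType) (D : set R) (f g : R -> R) :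
  {within D, continuous f} -> {within D, continuous g} -> {within D, continuous (fun x => f x + g x)}.
Proof.
move=> /subspace_continuousP cf /subspace_continuousP cg.
by apply/subspace_continuousP => x Dx; apply: cvgD; [exact: cf|exact: cg].
Qed.

Lemma within_continuousB (R : realType) (D : set R) (f g : R -> R) :
  {within D, continuous f} -> {within D, continuous g} -> {within D, continuous (fun x => f x - g x)}.
Proof.
move=> /subspace_continuousP cf /subspace_continuousP cg.
by apply/subspace_continuousP => x Dx; apply: cvgB; [exact: cf|exact: cg].
Qed.

Lemma continuous_mulr_cst (R : realType) (f : R -> R) (c : R) : continuous f -> continuous (fun x => f x * c).
Proof. by move=> cf x; apply: cvgM; [exact: cf|exact: cvg_cst]. Qed.

Lemma continuous_subr (R : realType) (f g : R -> R) :
  continuous f -> continuous g -> continuous (fun x => f x - g x).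
Proof. by move=> cf cg x; apply: cvgB; [exact: cf|exact: cg]. Qed.

Lemma continuous_mulr (R : realType) (f g : R -> R) :
  continuous f -> continuous g -> continuous (fun x => f x * g x).
Proof. by move=> cf cg x; apply: cvgM; [exact: cf|exact: cg]. Qed.

Lemma is_derive_comp_subl (R : realType) (f : R -> R) (t s df : R) :
  is_derive (t - s) 1 f df -> is_derive s 1 (fun s => f (t - s)) (- df).
Proof.
move=> dd; have ds : is_derive s 1 (fun s : R => t - s) (0 - 1).
  exact: (@is_deriveB _ _ _ (cst t) id).
by have := @is_derive1_comp _ f (fun r : R => t - r) s _ _ dd ds; rewrite sub0r mulrN1.
Qed.

Lemma within_continuous_entries (R : realType) (N : nat) (D : set R) (x : R -> 'cV[R]_N) :
  {within D, continuous x} <-> forall i, {within D, continuous (fun t => x t i 0)}.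
Proof.
split=> [cx i|cx].
  apply/subspace_continuousP => t Dt.
  have /subspace_continuousP/(_ t Dt) := cx => ct.
  exact: (cvg_comp _ _ ct (@coord_continuous R N 1 i 0 (x t))).
apply/subspace_continuousP => t Dt; apply: cvg_mx_entries => i j; rewrite (ord1 j).
by have /subspace_continuousP := cx i; exact.
Qed.

Section pathwise.
Context {R : realType} {N : nat}.
Notation R0 := (`[0%R, +oo[%classic : set R).
Variables (A : 'M[R]_N) (lam : R).
Hypothesis Alam : forall v, lam * normsq v <= bform A v v.
Variables (C : 'cV[R]_N) (u : R -> R).
Hypothesis cu : continuous u.
Notation E := (propagator A).

Let subE (a b : 'cV[R]_N) i : (a - b) i 0 = a i 0 - b i 0. Proof. by rewrite !mxE. Qed.
Let addE (a b : 'cV[R]_N) i : (a + b) i 0 = a i 0 + b i 0. Proof. by rewrite !mxE. Qed.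
Let scaleE c (a : 'cV[R]_N) i : (c *: a) i 0 = c * a i 0. Proof. by rewrite !mxE. Qed.
Let oppE (a : 'cV[R]_N) i : (- a) i 0 = - a i 0. Proof. by rewrite !mxE. Qed.

Lemma continuous_mulmx (B : 'M[R]_N) (D : set R) (x : R -> 'cV[R]_N) i :
  (forall k, {within D, continuous (fun t => x t k 0)}) ->
  {within D, continuous (fun t => (B *m x t) i 0)}.
Proof.
move=> cx; under eq_fun do rewrite mxE.
apply: within_continuous_sum => k; apply: within_continuousM => //.
by apply: continuous_subspaceT => ?; exact: cvg_cst.
Qed.

Lemma propagator_comm (v : 'cV[R]_N) (t : R) : 0 <= t -> A *m (E t *m v) = E t *m (A *m v).
Proof.
move=> t0; apply/eqP; rewrite -subr_eq0; apply/eqP.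
apply: (@linear_ode_unique _ _ A lam Alam (fun t => A *m (E t *m v) - E t *m (A *m v))) => //.
- move=> i; rewrite (_ : (fun t => _) = (fun t => (A *m (E t *m v)) i 0 - (E t *m (A *m v)) i 0)); last first.
    by apply/funext => r; rewrite subE.
  apply: within_continuousB; last by apply: continuous_subspaceT; exact: continuous_propagatorM.
  by apply: continuous_mulmx => k; apply: continuous_subspaceT; exact: continuous_propagatorM.
- move=> r i r0; under [X in is_derive _ _ X _]eq_fun do rewrite subE.
  have d2 := is_derive_propagatorM A (A *m v) r i.
  have d1 : is_derive r 1 (fun r => (A *m (E r *m v)) i 0) (- (A *m (A *m (E r *m v))) i 0).
    under [X in is_derive _ _ X _]eq_fun do rewrite mxE.
    rewrite mxE -sumrN; apply: is_derive_bigsum => k.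
    have dk := is_derive_propagatorM A v r k.
    by apply: is_derive_eq; rewrite /GRing.scale/=; ring.
  by apply: is_derive_eq; rewrite mulmxBr subE; ring.
- by rewrite propagator0 !mul1mx subrr.
Qed.

(** The noise cancels in X - X', which is therefore a primitive D of a continuous function and
    satisfies D' = -A D with D 0 = 0. *)
Lemma integral_equation_unique (J X X' : R -> 'cV[R]_N) (x0 : 'cV[R]_N) :
  {within R0, continuous X} -> {within R0, continuous X'} ->
  (forall t, 0 <= t -> X t = x0 + vintegral `[0, t] (fun s => reservoir A C (X s) (u s)) + J t) ->
  (forall t, 0 <= t -> X' t = x0 + vintegral `[0, t] (fun s => reservoir A C (X' s) (u s)) + J t) ->
  forall t, 0 <= t -> X t = X' t.
Proof.
move=> /within_continuous_entries cX /within_continuous_entries cX' eX eX'.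
pose res (Z : R -> 'cV[R]_N) i (s : R) := (reservoir A C (Z (Num.max 0 s)) (u (Num.max 0 s))) i 0.
have cres (Z : R -> 'cV[R]_N) (i : 'I_N) :
    (forall i, {within R0, continuous (fun t => Z t i 0)}) -> continuous (res Z i).
  move=> cZ; apply: (@continuous_halfline _ (fun s => (reservoir A C (Z s) (u s)) i 0)).
  have -> : (fun s => (reservoir A C (Z s) (u s)) i 0) = (fun s => u s * C i 0 - (A *m Z s) i 0).
    by apply/funext => s; rewrite /reservoir addE oppE scaleE addrC.
  apply: within_continuousB; last exact: continuous_mulmx.
  by apply: continuous_subspaceT; exact: continuous_mulr_cst.
pose D t : 'cV[R]_N := \col_i (primitive (fun s => res X i s - res X' i s) t).
have DE (t : R) : 0 <= t -> X t - X' t = D t.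
  move=> t0; apply/colP => i.
  have -> : D t i 0 = primitive (res X i) t - primitive (res X' i) t.
    by rewrite /D mxE primitiveB//; exact: cres.
  have resE Z : primitive (res Z i) t = (vintegral `[0, t] (fun s => reservoir A C (Z s) (u s))) i 0.
    rewrite mxE -/(primitive _ _); apply: eq_primitive => s /andP[s0 _].
    by rewrite /res (max_r s0).
  rewrite !resE (eX _ t0) (eX' _ t0).
  move: (vintegral _ _) (vintegral _ _) => a b.
  by rewrite subE !addE; ring.
have dD (t : R) i : 0 < t -> is_derive t 1 (fun t => D t i 0) (- (A *m D t) i 0).
  move=> t0; under [X in is_derive _ _ X _]eq_fun do rewrite mxE.
  have -> : - (A *m D t) i 0 = res X i t - res X' i t.
    rewrite -(DE _ (ltW t0)) mulmxBr subE /res !(max_r (ltW t0)) /reservoir !addE !oppE; ring.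
  by apply: (is_derive_primitive _ t0); apply: continuous_subr; exact: cres.
move=> t t0; apply/eqP; rewrite -subr_eq0 (DE _ t0); apply/eqP.
apply: (linear_ode_unique Alam) t t0 => //.
- move=> i; rewrite (_ : (fun t => _) = primitive (fun s => res X i s - res X' i s)); last first.
    by apply/funext => s; rewrite /D mxE.
  by apply: within_continuous_primitive; apply: continuous_subr; exact: cres.
- by apply/colP => i; rewrite !mxE primitive0.
Qed.

Variables (x0 : 'cV[R]_N) (j : R -> R).
Hypothesis cj : continuous j.
Hypothesis j0 : j 0 = 0.

Let q s : 'cV[R]_N := u s *: C - j s *: (A *m C).

Let Q t : 'cV[R]_N := \col_i (primitive (fun s => (E (- s) *m q s) i 0) t).

Let cEq i : continuous (fun s => (E (- s) *m q s) i 0).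
Proof.
under eq_fun do rewrite mxE.
apply: continuous_sum => k s; apply: cvgM.
  apply: (@continuous_comp _ _ _ (fun s : R => - s) (fun s => E s i k)); first exact: opp_continuous.
  exact: continuous_propagator.
rewrite (_ : (fun s => q s k 0) = (fun s => u s * C k 0 - j s * (A *m C) k 0)); last first.
  by apply/funext => r; rewrite /q subE !scaleE.
rewrite (_ : q s k 0 = u s * C k 0 - j s * (A *m C) k 0); last by rewrite /q subE !scaleE.
by apply: (@continuous_subr _ (fun s => u s * C k 0)); exact: continuous_mulr_cst.
Qed.

(* Subtracting the noise [j t *: C] leaves a linear ODE with continuous forcing
   [q], solved here by variation of constants; [Q] uses [E (- s)], which
   [propagatorD] absorbs into [E (t - s)]. *)
Definition reservoir_path t : 'cV[R]_N := E t *m (x0 + Q t) + j t *: C.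

Lemma reservoir_path_continuous : {within R0, continuous reservoir_path}.
Proof.
apply/within_continuous_entries => i.
have -> : (fun t => reservoir_path t i 0) =
    (fun t => \sum_k E t i k * (x0 k 0 + primitive (fun s => (E (- s) *m q s) k 0) t) + j t * C i 0).
  apply/funext => t; rewrite /reservoir_path addE scaleE [X in X + _]mxE; congr (_ + _).
  by apply: eq_bigr => k _; rewrite addE [X in _ + X]mxE.
apply: within_continuousD; last first.
  by apply: continuous_subspaceT; exact: continuous_mulr_cst.
apply: within_continuous_sum => k; apply: within_continuousM.
  by apply: continuous_subspaceT; exact: continuous_propagator.
apply: within_continuousD; last exact: (within_continuous_primitive (@cEq k)).
by apply: continuous_subspaceT => s; exact: cvg_cst.
Qed.

(** Z, the path minus j C, satisfies Z' = -A Z + q by the product rule and E s E(-s) = 1. The part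
    -j A C of q completes -A Z to -A times the path. *)
Lemma reservoir_pathP t : 0 <= t -> reservoir_path t =
  x0 + vintegral `[0, t] (fun s => reservoir A C (reservoir_path s) (u s)) + j t *: C.
Proof.
move=> t0; apply/colP => i; rewrite /reservoir_path !addE; congr (_ + _).
pose Z t := E t *m (x0 + Q t).
have cZ k : {within R0, continuous (fun t => Z t k 0)}.
  have /within_continuous_entries/(_ k) := reservoir_path_continuous => c1.
  have -> : (fun t => Z t k 0) = (fun t => reservoir_path t k 0 - j t * C k 0).
    by apply/funext => s; rewrite /reservoir_path addE scaleE addrK.
  apply: within_continuousB => //.
  by apply: continuous_subspaceT; exact: continuous_mulr_cst.
pose f s := (- (A *m Z s) + q s) i 0.
have cf : continuous (fun s : R => f (Num.max 0 s)).
  apply: continuous_halfline.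
  have -> : f = (fun s => u s * C i 0 - j s * (A *m C) i 0 - (A *m Z s) i 0).
    by apply/funext => s; rewrite /f addE oppE subE !scaleE addrC.
  apply: within_continuousB; last exact: continuous_mulmx.
  by apply: continuous_subspaceT; apply: continuous_subr; exact: continuous_mulr_cst.
have dZ (s : R) : 0 < s -> is_derive s 1 (fun s => Z s i 0) (f (Num.max 0 s)).
  move=> s0; under [X in is_derive _ _ X _]eq_fun do rewrite mxE.
  rewrite (max_r (ltW s0)).
  have -> : f s = \sum_k (- (A *m E s) i k * (x0 + Q s) k 0 + E s i k * (E (- s) *m q s) k 0).
    rewrite big_split/=; under eq_bigr do rewrite mulNr.
    rewrite sumrN /f addE oppE /Z mulmxA; congr (- _ + _); first by rewrite mxE.
    have := propagatorD Alam (q s) (- s) (ltW s0); rewrite subrr propagator0 mul1mx => {1}<-.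
    by rewrite mxE.
  apply: is_derive_bigsum => k.
  have d1 := is_derive_propagator A s i k.
  have d2 : is_derive s 1 (fun s => (x0 + Q s) k 0) ((E (- s) *m q s) k 0).
    under [X in is_derive _ _ X _]eq_fun do rewrite addE [X in _ + X]mxE.
    have d3 := is_derive_primitive (@cEq k) s0.
    by rewrite -[X in is_derive _ _ _ X]add0r; exact: (is_deriveD (is_derive_cst (x0 k 0) s 1) d3).
  by apply: is_derive_eq; rewrite /GRing.scale/=; ring.
have := primitive_FTC2 t0 cf (cZ i) dZ.
have -> : Z 0 i 0 = x0 i 0 by rewrite /Z propagator0 mul1mx addE [X in _ + X]mxE primitive0 addr0.
move=> H; have -> : (E t *m (x0 + Q t)) i 0 = x0 i 0 + primitive (fun s => f (Num.max 0 s)) t.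
  by rewrite H addrCA subrr addr0.
congr (_ + _); rewrite mxE -/(primitive _ _).
apply: eq_primitive => s /andP[s0 _]; rewrite (max_r s0) /f /reservoir -/(Z s) mulmxDr -scalemxAr /q.
by congr (fun_of_matrix _ i 0); rewrite opprD addrA addrAC.
Qed.

(** Duhamel's formula for the noiseless system started at x0. *)
Definition drift t : 'cV[R]_N :=
  E t *m x0 + \col_i (primitive (fun s => u s * (E (t - s) *m C) i 0) t).

Let cEt (t : R) (v : 'cV[R]_N) i : continuous (fun s : R => (E (t - s) *m v) i 0).
Proof.
move=> s; apply: (@continuous_comp _ _ _ (fun s : R => t - s) (fun s => (E s *m v) i 0)).
  by apply: cvgB; [exact: cvg_cst|exact: cvg_id].
exact: continuous_propagatorM.
Qed.

Lemma reservoir_path_drift t i : 0 <= t -> reservoir_path t i 0 =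
  drift t i 0 + (j t * C i 0 - primitive (fun s => j s * (E (t - s) *m (A *m C)) i 0) t).
Proof.
move=> t0; rewrite /reservoir_path /drift mulmxDr !addE scaleE -!addrA; congr (_ + _).
rewrite addrCA addrC; congr (_ + _); rewrite [X in _ = X - _]mxE -primitiveB; last 2 first.
- by apply: continuous_mulr => //; exact: cEt.
- by apply: continuous_mulr => //; exact: cEt.
have -> : (E t *m Q t) i 0 = \sum_k primitive (fun s => E t i k * (E (- s) *m q s) k 0) t.
  by rewrite mxE; apply: eq_bigr => k _; rewrite (primitiveZ _ _ (@cEq k)) [X in _ * X]mxE.
rewrite -primitive_sum; last first.
  by move=> k; apply: continuous_mulr; [exact: cst_continuous|exact: cEq].
apply: eq_primitive => s _.
transitivity ((E t *m (E (- s) *m q s)) i 0); first by rewrite [RHS]mxE.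
by rewrite (propagatorD Alam _ _ t0) mulmxBr -!scalemxAr subE !scaleE.
Qed.

(** Expresses the path through finitely many values of j up to time t at a time; both adaptedness
    and the comparison of laws rely on this. *)
Lemma reservoir_path_cvg (t : R) i : 0 < t ->
  drift t i 0 + \sum_(r < n.+1) (E (t - node t n.+1 r) *m C) i 0 *
    (j (node t n.+1 r.+1) - j (node t n.+1 r)) @[n --> \oo] --> reservoir_path t i 0.
Proof.
move=> t0; rewrite (reservoir_path_drift _ (ltW t0)).
apply: cvgD; first exact: cvg_cst.
pose f' s := (A *m (E (t - s) *m C)) i 0.
pose f s := (E (t - s) *m C) i 0.
have df (s : R) : is_derive s 1 f (f' s).
  by have := is_derive_comp_subl (is_derive_propagatorM A C (t - s) i); rewrite opprK.
have cf' : continuous f'.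
  rewrite /f'; under eq_fun do rewrite mxE.
  apply: continuous_sum => k; apply: continuous_mulr; [exact: cst_continuous|exact: cEt].
have cjf : continuous (fun s => j s * f' s) by exact: continuous_mulr.
have cG : {within `[0, t], continuous (primitive (fun s => j s * f' s))}.
  by apply: continuous_subspaceW (within_continuous_primitive cjf) => s; apply: subset_itvl.
have dG (s : R) : 0 < s < t -> is_derive s 1 (primitive (fun s => j s * f' s)) (j s * f' s).
  by move=> /andP[s0 _]; exact: is_derive_primitive.
have RS := @riemann_stieltjes_parts _ f f' j _ t t0 df cf' cj cG dG.
have ft : f t = C i 0 by rewrite /f subrr propagator0 mul1mx.
have Gt : primitive (fun s => j s * f' s) t = primitive (fun s => j s * (E (t - s) *m (A *m C)) i 0) t.
  by apply: eq_primitive => s /andP[_ st]; rewrite /f' propagator_comm// subr_ge0.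
have G0 := primitive0 (fun s => j s * f' s).
have L : f t * j t - f 0 * j 0 - (primitive (fun s => j s * f' s) t - primitive (fun s => j s * f' s) 0) =
    j t * C i 0 - primitive (fun s => j s * (E (t - s) *m (A *m C)) i 0) t.
  rewrite Gt G0 ft; move: (f 0) (primitive _ t) => a b.
  by rewrite j0; ring.
by rewrite L in RS.
Qed.

End pathwise.

(** * Continuous functions of random vectors *)

Section continuous_of_vector.
Context {R : realType} {N : nat}.
Variable g : 'cV[R]_N -> R.
Hypothesis cg : continuous g.

Lemma continuous_col_near (v : 'cV[R]_N) (e : R) : 0 < e ->
  exists2 delta : R, 0 < delta &
    forall y : 'cV[R]_N, (forall i, `|v i 0 - y i 0| < delta) -> `|g v - g y| < e.
Proof.
move=> e0; have /cvgrPdist_lt/(_ _ e0) := @cg v.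
move=> /nbhs_ballP[delta /= d0 H]; exists delta => // y vy.
by apply: (H y); split => // i j; rewrite (ord1 j); exact: vy.
Qed.

(** Entrywise measurability suffices: the set where g > a is a countable union of boxes with
    rational centres and radii 1 / k.+1. *)
Lemma measurable_continuous_col d (T : measurableType d) (x : T -> 'cV[R]_N) :
  (forall i, measurable_fun setT (fun w => x w i 0)) -> measurable_fun setT (g \o x).
Proof.
move=> mx mD; apply: (measurability _ (RGenOInfty.measurableE R)) => //.
move=> /= _ [_ [a ->] <-]; rewrite preimage_itvoy setTI.
pose box (q : {ffun 'I_N -> rat}) (k : nat) (y : 'cV[R]_N) := forall i, `|y i 0 - ratr (q i)| < k.+1%:R^-1.
pose above (p : {ffun 'I_N -> rat} * nat) := forall y, box p.1 p.2 y -> a < g y.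
rewrite [X in measurable X](_ : _ = \bigcup_(p : {ffun 'I_N -> rat} * nat)
    [set w | above p /\ box p.1 p.2 (x w)]).
  apply: countable_bigcupT_measurable; first exact: countableP.
  move=> p; have [pa|npa] := pselect (above p); last first.
    by rewrite (_ : [set _ | _] = set0)//; apply/seteqP; split => // w [].
  rewrite (_ : [set _ | _] = \bigcap_(i in [set: 'I_N])
      (fun w => x w i 0) @^-1` (ball (ratr (p.1 i) : R) p.2.+1%:R^-1)); last first.
    apply/seteqP; split => w.
      by move=> [_ bw] i _ /=; rewrite /ball/= distrC; exact: bw.
    by move=> H; split=> // i; have := H i I; rewrite /ball/= distrC.
  apply: fin_bigcap_measurable => // i _; rewrite -[X in measurable X]setTI.
  by apply: mx => //; exact: measurable_ball.
apply/seteqP; split => [w /= aw|w [p _ [pa pw]]]; last exact: pa.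
have e0 : 0 < g (x w) - a by rewrite subr_gt0.
have [delta d0 H] := continuous_col_near (x w) e0.
(* The factor 2 pays for passing from x to y through the rational centre. *)
have [k kd] := archi_mul 2 d0.
have k1 : 0 < k.+1%:R^-1 :> R by rewrite invr_gt0 ltr0n.
have kd' : 2 * k.+1%:R^-1 < delta.
  rewrite ltr_pdivrMr ?ltr0n// mulrC; apply: le_lt_trans kd _.
  by rewrite ltr_pM2r// ltr_nat.
have qx i : exists q : rat, `|x w i 0 - ratr q| < k.+1%:R^-1.
  have xk : x w i 0 - k.+1%:R^-1 < x w i 0 by rewrite ltrBlDr ltrDl.
  have [q] := rat_in_itvoo xk; rewrite inE/= => /itvP qI.
  have q1 : x w i 0 - k.+1%:R^-1 < ratr q by rewrite qI.
  have q2 : ratr q < x w i 0 by rewrite qI.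
  exists q; rewrite ger0_norm ?subr_ge0 ?(ltW q2)//.
  by rewrite ltrBlDr addrC -ltrBlDr.
have [q qP] := choice qx.
exists ([ffun i => q i], k) => //; split; last by move=> i; rewrite ffunE.
move=> y yq; have : `|g (x w) - g y| < g (x w) - a.
  apply: H => i; apply: le_lt_trans kd'.
  rewrite -[_ - _](subrKA (ratr (q i))) mulr_natl mulr2n.
  apply: (le_trans (ler_normD _ _)); apply: lerD; first exact/ltW/qP.
  by have := yq i; rewrite ffunE distrC => /ltW.
rewrite ltr_norml; lra.
Qed.

Lemma ball_compact (r : R) : compact [set v : 'cV[R]_N | forall i, `|v i 0| <= r].
Proof.
have c := @rV_compact R N (fun=> `[-r, r]%classic) (fun=> @segment_compact R (- r) r).
rewrite (_ : [set v | _] = trmx @` [set v : 'rV[R]_N | forall i, `[-r, r]%classic (v ord0 i)]).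
  apply: continuous_compact => //; apply: continuous_subspaceT => v.
  apply: (@cvg_mx_entries _ (nbhs v) (nbhs_filter v)) => i j.
  rewrite [X in _ --> X]mxE; under eq_fun do rewrite mxE.
  exact: coord_continuous.
apply/seteqP; split => [v vr|_ [v vr <-]].
  exists v^T; last by rewrite trmxK.
  by move=> i; rewrite mxE/= in_itv/= -ler_norml; exact: vr.
by move=> i; rewrite mxE ler_norml; have := vr i; rewrite /= in_itv.
Qed.

Lemma normsq_ge_entry (v : 'cV[R]_N) i : v i 0 ^+ 2 <= normsq v.
Proof. by rewrite /normsq (bigD1 i)//= lerDl; apply: sumr_ge0 => k _; exact: sqr_ge0. Qed.

(** If y lies in the cube of radius r and x is delta-close to it, uniform continuity gives e;
    otherwise one of the quadratic terms already exceeds 2 b. Integrated, this becomes a bound by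
    second moments. *)
Lemma bounded_continuous_quadratic (b r e : R) : (forall v, `|g v| <= b) -> 0 < r -> 0 < e ->
  exists2 delta : R, 0 < delta & forall x y,
    `|g x - g y| <= e + 2 * b / r ^+ 2 * normsq y + 2 * b / delta ^+ 2 * normsq (x - y).
Proof.
move=> gb r0 e0.
have [delta d0 H] := compact_unif_continuous (@ball_compact r) (fun v _ => @cg v) e0.
exists delta => // x y.
have b0 : 0 <= b by apply: le_trans (gb 0); exact: normr_ge0.
have g2 : `|g x - g y| <= 2 * b.
  by rewrite (le_trans (ler_normB _ _))// mulr_natl mulr2n lerD.
have p1 : 0 <= 2 * b / r ^+ 2 * normsq y.
  by rewrite mulr_ge0 ?normsq_ge0// divr_ge0 ?sqr_ge0// mulr_ge0.
have p2 : 0 <= 2 * b / delta ^+ 2 * normsq (x - y).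
  by rewrite mulr_ge0 ?normsq_ge0// divr_ge0 ?sqr_ge0// mulr_ge0.
have scale s z : 0 < s -> s ^+ 2 <= z -> 2 * b <= 2 * b / s ^+ 2 * z.
  move=> s0 sz; rewrite mulrAC ler_pdivlMr ?exprn_gt0//.
  by rewrite ler_wpM2l// mulr_ge0.
have [yr|] := pselect (forall i, `|y i 0| <= r); last first.
  move=> /existsNP[i /negP]; rewrite -ltNge => ri.
  have : r ^+ 2 <= normsq y.
    apply: le_trans (normsq_ge_entry y i); rewrite -[leRHS]real_normK ?num_real//.
    by rewrite lerXn2r ?nnegrE ?normr_ge0 ?(ltW r0) ?(ltW ri).
  move=> /(scale _ _ r0); lra.
have [yd|] := pselect (forall i, `|x i 0 - y i 0| < delta); last first.
  move=> /existsNP[i /negP]; rewrite -leNgt => ri.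
  have : delta ^+ 2 <= normsq (x - y).
    apply: le_trans (normsq_ge_entry _ i); rewrite -[leRHS]real_normK ?num_real// !mxE.
    by rewrite lerXn2r ?nnegrE ?normr_ge0 ?(ltW d0).
  move=> /(scale _ _ d0); lra.
have : `|g y - g x| < e.
  by apply: H => //; split=> // i j; rewrite (ord1 j) /ball/= distrC; exact: yd.
rewrite distrC; lra.
Qed.

End continuous_of_vector.

Section expectation_of_vector.
Context {R : realType} {N : nat} d (T : measurableType d) (P : probability T R).
Variables (g : 'cV[R]_N -> R) (b : R).
Hypothesis cg : continuous g.
Hypothesis gb : forall v, `|g v| <= b.
Implicit Types x y : T -> 'cV[R]_N.

Definition measurable_col x := forall i, measurable_fun setT (fun w => x w i 0).

Lemma integrable_bounded_col x : measurable_col x -> P.-integrable setT (EFin \o (g \o x)).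
Proof.
move=> mx; apply: measurable_bounded_integrable => //.
- by apply: fin_num_fun_lty; exact: fin_num_measure.
- exact: measurable_continuous_col.
- exists b; split; first exact: num_real.
  by move=> z bz w _ /=; exact: le_trans (gb _) (ltW bz).
Qed.

Lemma expectation_bounded_fin x : measurable_col x -> ('E_P[g \o x] \is a fin_num)%E.
Proof. by move=> mx; rewrite unlock; apply: integrable_fin_num => //; exact: integrable_bounded_col. Qed.

Lemma sqnorm_sum_col x : measurable_col x ->
  (\sum_i sqnorm P setT (fun w => x w i 0)%R = \int[P]_w (normsq (x w))%:E)%E.
Proof.
move=> mx; rewrite /sqnorm -ge0_integral_sum//; last 2 first.
- by move=> i; exact: measurable_sqr.
- by move=> i w _; rewrite lee_fin sqr_ge0.
by apply: eq_integral => w _; rewrite sumEFin.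
Qed.

Lemma measurable_normsq x : measurable_col x -> measurable_fun setT (fun w => (normsq (x w))%:E).
Proof.
move=> mx; apply/measurable_EFinP.
rewrite /normsq; apply: measurable_sum => i.
exact: (measurable_funX 2 (mx i)).
Qed.

Lemma measurable_colB x y : measurable_col x -> measurable_col y -> measurable_col (fun w => x w - y w).
Proof.
move=> mx my i; rewrite (_ : (fun w => _) = (fun w => x w i 0 - y w i 0)); last first.
  by apply/funext => w; rewrite !mxE.
exact: measurable_funB.
Qed.

(** [kappa] depends on the vectors only through the bound M on second moments of y, hence serves all
    times at once. *)
Lemma expectation_l2_continuous (M e : R) : 0 <= M -> 0 < e ->
  exists2 kappa : R, 0 < kappa & forall x y, measurable_col x -> measurable_col y ->
    (\sum_i sqnorm P setT (fun w => y w i 0)%R <= M%:E)%E ->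
    (\sum_i sqnorm P setT (fun w => x w i 0 - y w i 0)%R <= kappa%:E)%E ->
    (`| 'E_P[g \o x] - 'E_P[g \o y] | <= e%:E)%E.
Proof.
move=> M0 e0.
have b0 : 0 <= b by apply: le_trans (gb 0); exact: normr_ge0.
have e3 : 0 < e / 3 by lra.
(* Chosen so that 2 b M / r^2 <= e / 3; the + 1 keeps r positive when b M = 0. *)
pose r := Num.sqrt (6 * b * M / e + 1).
have r2 : r ^+ 2 = 6 * b * M / e + 1.
  by rewrite sqr_sqrtr// addr_ge0// divr_ge0 ?(ltW e0)// !mulr_ge0.
have r2_gt0 : 0 < r ^+ 2 by rewrite r2 ltr_wpDl// divr_ge0 ?(ltW e0)// !mulr_ge0.
have r0 : 0 < r by rewrite sqrtr_gt0 -r2.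
have [delta d0 H] := bounded_continuous_quadratic cg gb r0 e3.
have d2 : 0 < delta ^+ 2 by rewrite exprn_gt0.
have k1 : 0 < 6 * b + 1 by rewrite ltr_wpDl// mulr_ge0.
(* Makes 2 b kappa / delta^2 at most e / 3, with + 1 guarding against b = 0. *)
exists (e * delta ^+ 2 / (6 * b + 1)); first by rewrite divr_gt0// mulr_gt0.
move=> x y mx my yM xyk.
have mxy := measurable_colB mx my.
have -> : ('E_P[g \o x] - 'E_P[g \o y] = \int[P]_w (g (x w) - g (y w))%:E)%E.
  by rewrite unlock -integralB_EFin//; exact: integrable_bounded_col.
have mg : measurable_fun setT (fun w => g (x w) - g (y w)).
  by apply: measurable_funB; exact: measurable_continuous_col.
apply: (le_trans (le_abse_integral _ _ _)) => //; first exact/measurable_EFinP.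
pose c1 := 2 * b / r ^+ 2; pose c2 := 2 * b / delta ^+ 2.
have c10 : 0 <= c1 by rewrite divr_ge0 ?sqr_ge0// mulr_ge0.
have c20 : 0 <= c2 by rewrite divr_ge0 ?sqr_ge0// mulr_ge0.
have m1 := measurable_normsq my.
have m2 := measurable_normsq mxy.
apply: (@le_trans _ _ (\int[P]_w ((e / 3)%:E + c1%:E * (normsq (y w))%:E + c2%:E * (normsq (x w - y w))%:E))%E).
  apply: ge0_le_integral => //.
  - exact/measurable_EFinP/measurableT_comp.
  - apply: emeasurable_funD; last exact: measurable_funeM.
    by apply: emeasurable_funD; [exact: measurable_cst|exact: measurable_funeM].
  - by move=> w _; rewrite -!EFinM -!EFinD lee_fin; exact: H.
rewrite ge0_integralD//; last 4 first.
- by move=> w _; rewrite -!EFinM -!EFinD lee_fin !addr_ge0 ?(ltW e3)// mulr_ge0// normsq_ge0.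
- by apply: emeasurable_funD; [exact: measurable_cst|exact: measurable_funeM].
- by move=> w _; rewrite -!EFinM lee_fin mulr_ge0// normsq_ge0.
- exact: measurable_funeM.
rewrite ge0_integralD//; last 3 first.
- by move=> w _; rewrite lee_fin ltW.
- by move=> w _; rewrite -!EFinM lee_fin mulr_ge0// normsq_ge0.
- exact: measurable_funeM.
have zl z (c : R) : 0 <= c -> measurable_col z ->
    (\int[P]_w (c%:E * (normsq (z w))%:E) = c%:E * \int[P]_w (normsq (z w))%:E)%E.
  move=> c0 mz; rewrite ge0_integralZl//; first exact: measurable_normsq.
  by move=> w _; rewrite lee_fin normsq_ge0.
rewrite integral_cst_probability (zl y)// (zl (fun w => x w - y w))//.
rewrite -(sqnorm_sum_col my) -(sqnorm_sum_col mxy).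
have -> : (\sum_i sqnorm P setT (fun w => (x w - y w) i 0)%R =
    \sum_i sqnorm P setT (fun w => x w i 0 - y w i 0)%R)%E.
  by apply: eq_bigr => i _; apply: eq_sqnorm => w _; rewrite !mxE.
apply: (@le_trans _ _ ((e / 3)%:E + c1%:E * M%:E + c2%:E * (e * delta ^+ 2 / (6 * b + 1))%:E)%E).
  apply: leeD; first by apply: leeD => //; exact: lee_wpmul2l.
  exact: lee_wpmul2l.
rewrite -!EFinM -!EFinD lee_fin.
have h1 : c1 * M <= e / 3.
  rewrite /c1 mulrAC ler_pdivrMr// r2.
  have -> : e / 3 * (6 * b * M / e + 1) = 2 * b * M + e / 3 by field; rewrite gt_eqF.
  by rewrite lerDl ltW.
have h2 : c2 * (e * delta ^+ 2 / (6 * b + 1)) <= e / 3.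
  have -> : c2 * (e * delta ^+ 2 / (6 * b + 1)) = 2 * b * e / (6 * b + 1).
    by rewrite /c2; field; rewrite !gt_eqF.
  rewrite ler_pdivrMr//; nra.
lra.
Qed.

Lemma expectation_bounded_cvg (x : nat -> T -> 'cV[R]_N) y :
  (forall n, measurable_col (x n)) -> measurable_col y ->
  (forall w i, x n w i 0 @[n --> \oo] --> y w i 0) ->
  'E_P[g \o x n]%E @[n --> \oo] --> ('E_P[g \o y])%E.
Proof.
move=> mx my xy; rewrite unlock.
have [] := @dominated_convergence _ T R P setT measurableT
  (fun n w => (g (x n w))%:E) (fun w => (g (y w))%:E) (cst b%:E) => //.
- by move=> n; apply/measurable_EFinP; exact: (measurable_continuous_col cg (mx n)).
- by apply/measurable_EFinP; exact: (measurable_continuous_col cg my).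
- apply: aeW => w _; apply: cvg_EFin; first exact: nearW.
  apply: (@cvg_comp _ _ _ (x ^~ w) g _ (nbhs (y w))); last exact: cg.
  by apply: cvg_mx_entries => i j; rewrite (ord1 j); exact: xy.
- exact: finite_measure_integrable_cst.
- by apply: aeW => w n _; rewrite lee_fin.
Qed.

End expectation_of_vector.

(** * The drift and its synchronisation *)

Section exponential_tail.
Context {R : realType}.
Notation mu := (@lebesgue_measure R).
Notation R0 := (`[0%R, +oo[%classic : set R).

Lemma primitive_reverse (p : R -> R) (t : R) : 0 <= t -> continuous p ->
  primitive p t = primitive (fun s => p (t - s)) t.
Proof.
move=> t0 cp.
have dF (x : R) : is_derive x 1 (fun s : R => t - s) (- 1).
  by apply: (@is_derive_comp_subl _ id); exact: is_derive_id.
have F' : derive1 (fun s : R => t - s) = cst (- 1).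
  by apply/funext => x; rewrite derive1E; have [_ ->] := dF x.
have cF : continuous (fun s : R => t - s) by move=> x; exact: is_derive_continuous (dF x).
have := @integration_by_substitution_decreasing R (fun s => t - s) p 0 t t0.
rewrite F' subr0 subrr => H.
rewrite /primitive /Rintegral H; last 6 first.
- by move=> x y _ _ xy; rewrite ltrD2l ltrN2.
- by move=> x _; exact: cvg_cst.
- exact: is_cvg_cst.
- exact: is_cvg_cst.
- split; first by move=> x _; case: (dF x).
  + by apply: cvg_at_right_filter; exact: cF.
  + by apply: cvg_at_left_filter; exact: cF.
- exact: continuous_subspaceT.
congr fine; apply: eq_integral => x _ /=.
by rewrite /GRing.mul/= opprK mulr1.
Qed.

Lemma exp_tail_integral (t : R) (f : R -> R) (K lam : R) : 0 <= t -> 0 < lam -> 0 <= K ->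
  measurable_fun R0 f -> (forall x, 0 <= x -> `|f x| <= K * expR (- lam * x)) ->
  (\int[mu]_(x in `]t, +oo[) `|f x|%:E <= (K / lam * expR (- lam * t))%:E)%E.
Proof.
move=> t0 lam0 K0 mf fK.
have tR0 : `]t, +oo[ `<=` R0 by apply: subset_itvr; rewrite bnd_simp.
(* Writing the majorant as a square reduces this L^1 tail to [sqnorm_exp_tail] at rate lam / 2. *)
pose r (x : R) := Num.sqrt K * expR (- (lam / 2) * x).
have rE x : r x ^+ 2 = K * expR (- lam * x).
  by rewrite /r exprMn sqr_sqrtr// -expRM_natr; congr (_ * expR _); field.
have mr : measurable_fun R0 r.
  apply: measurable_funTS; apply: continuous_measurable_fun.
  apply: (@continuous_mulr _ (cst (Num.sqrt K))) => x; first exact: cvg_cst.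
  apply: continuous_comp; last exact: continuous_expR.
  by apply: cvgM; [exact: cvg_cst|exact: cvg_id].
have l2 : 0 < lam / 2 by lra.
have := @sqnorm_exp_tail R t r (Num.sqrt K) (lam / 2) t0 l2 mr.
have -> : Num.sqrt K ^+ 2 / (2 * (lam / 2)) * expR (- (2 * (lam / 2)) * t) = K / lam * expR (- lam * t).
  by rewrite sqr_sqrtr// mulrCA divff ?mulr1.
move=> H; apply: (le_trans _ (H _)); last first.
  by move=> x _; rewrite ger0_norm// mulr_ge0 ?sqrtr_ge0 ?expR_ge0.
apply: ge0_le_integral => //.
- by apply/measurable_EFinP/measurableT_comp => //; exact: measurable_funS mf.
- by apply: measurable_sqr; exact: measurable_funS mr.
- move=> x; rewrite /= in_itv/= andbT => tx; rewrite lee_fin rE.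
  by apply: fK; rewrite (le_trans t0) ?ltW.
Qed.

Lemma exp_tail_Rintegral (t : R) (f : R -> R) (K lam : R) : 0 <= t -> 0 < lam -> 0 <= K ->
  continuous f -> (forall x, 0 <= x -> `|f x| <= K * expR (- lam * x)) ->
  `| \int[mu]_(x in R0) f x - primitive f t| <= K / lam * expR (- lam * t).
Proof.
move=> t0 lam0 K0 cf fK.
have mfT : measurable_fun setT f by exact: continuous_measurable_fun.
have mf D : measurable_fun D f by exact: measurable_funTS.
have int_tail (s : R) : 0 <= s -> mu.-integrable `]s, +oo[ (EFin \o f).
  move=> s0; apply/integrableP; split; first by apply/measurable_EFinP; exact: mf.
  apply: le_lt_trans (ltry (K / lam * expR (- lam * s))).
  exact: exp_tail_integral.
have R0E : R0 = `[0, t] `|` `]t, +oo[.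
  apply/seteqP; split => x; rewrite /= !in_itv/= !andbT.
    by move=> x0; case: (leP x t) => xt; [left; rewrite x0|right].
  by move=> [/andP[]//|tx]; rewrite (le_trans t0) ?ltW.
have dsj : [disjoint `[0, t] & `]t, +oo[].
  apply/disj_setPS => x [/=]; rewrite !in_itv/= andbT => /andP[_ xt].
  by rewrite ltNge xt.
rewrite R0E Rintegral_setU//; last first.
  apply/integrableP; split; first by apply/measurable_EFinP; exact: mf.
  rewrite ge0_integral_setU//; last first.
    by apply: measurableT_comp => //; apply/measurable_EFinP; exact: mf.
  apply: lte_add_pinfty.
    by have /integrableP[] := continuous_integrable_segment 0 t cf.
  by have /integrableP[] := int_tail t t0.
rewrite addrAC subrr add0r -lee_fin EFin_normr_Rintegral//; last exact: int_tail.
apply: le_trans (exp_tail_integral t0 lam0 K0 (mf R0) fK).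
by apply: le_abse_integral => //; apply/measurable_EFinP; exact: mf.
Qed.

End exponential_tail.

Section synchronisation.
Context {R : realType} {N : nat}.
Variables (A : 'M[R]_N) (lam : R).
Hypothesis Alam : forall v, lam * normsq v <= bform A v v.
Hypothesis lam0 : 0 < lam.
Variables (C : 'cV[R]_N) (u : R -> R) (b : R).
Hypothesis cu : continuous u.
Hypothesis ub : forall x, `|u x| <= b.
Notation E := (propagator A).

(** Serves twice: with the input omega it is the integrand of the synchronisation, with sigma the
    Wiener integrand of Y_t. *)
Definition kernel t i (s : R) : R := u (t - s) * (E s *m C) i 0.

Lemma kernel_continuous t i : continuous (kernel t i).
Proof.
apply: continuous_mulr; last exact: continuous_propagatorM.
move=> s; apply: (@continuous_comp _ _ _ (fun s : R => t - s) u); last exact: cu.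
by apply: cvgB; [exact: cvg_cst|exact: cvg_id].
Qed.

Lemma kernel_decay t i s : 0 <= s ->
  `|kernel t i s| <= b * Num.sqrt (normsq C) * expR (- lam * s).
Proof.
move=> s0; rewrite normrM -mulrA; apply: ler_pM => //.
exact: (propagator_decay Alam).
Qed.

Definition sync t : 'cV[R]_N := vintegral `[0, +oo[ (fun s => u (t - s) *: (E s *m C)).

Lemma syncE t i : sync t i 0 = \int[@lebesgue_measure R]_(s in `[0, +oo[) kernel t i s.
Proof. by rewrite mxE; apply: eq_Rintegral => s _; rewrite mxE. Qed.

Let b0 : 0 <= b * Num.sqrt (normsq C).
Proof. by rewrite mulr_ge0 ?sqrtr_ge0// (le_trans _ (ub 0)). Qed.

Lemma sync_le t i : `|sync t i 0| <= b * Num.sqrt (normsq C) / lam.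
Proof.
have := exp_tail_Rintegral (lexx 0) lam0 b0 (@kernel_continuous t i) (@kernel_decay t i).
by rewrite primitive0 subr0 mulr0 expR0 mulr1 syncE.
Qed.

(** After reversing time, the integral in [drift] is that of [kernel] over [0, t], so only its tail
    and the forgotten initial state remain. *)
Lemma drift_sync x0 t i : 0 <= t -> `|drift A C u x0 t i 0 - sync t i 0| <=
  (Num.sqrt (normsq x0) + b * Num.sqrt (normsq C) / lam) * expR (- lam * t).
Proof.
move=> t0.
have -> : drift A C u x0 t i 0 = (E t *m x0) i 0 + primitive (kernel t i) t.
  have addE (a c : 'cV[R]_N) : (a + c) i 0 = a i 0 + c i 0 by rewrite mxE.
  rewrite /drift addE; congr (_ + _); rewrite mxE.
  have cp : continuous (fun s : R => u s * (E (t - s) *m C) i 0).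
    apply: continuous_mulr; first exact: cu.
    move=> s; apply: (@continuous_comp _ _ _ (fun s : R => t - s) (fun s => (E s *m C) i 0)).
      by apply: cvgB; [exact: cvg_cst|exact: cvg_id].
    exact: continuous_propagatorM.
  apply: (etrans (primitive_reverse t0 cp)).
  apply: eq_primitive => s _; rewrite /kernel.
  by have -> : t - (t - s) = s by ring.
have h1 := propagator_decay Alam x0 i t0.
have h2 := exp_tail_Rintegral t0 lam0 b0 (@kernel_continuous t i) (@kernel_decay t i).
rewrite syncE -addrA mulrDl; apply: (le_trans (ler_normD _ _)); apply: lerD => //.
by rewrite distrC.
Qed.

End synchronisation.

(** * Discretised noise and its reversal *)

Section discretised_noise.
Context {R : realType} {N : nat} d (T : measurableType d) (P : probability T R).
Variables (W : R -> T -> R) (h : R -> R) (j : R -> T -> R).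
Hypothesis hW : is_brownian P W.
Hypothesis ch : continuous h.
Hypothesis j_ito : forall t, 0 <= t -> is_wiener_integral P W (h \_ `[0, t]) (j t).
Variables (A : 'M[R]_N) (lam : R) (C : 'cV[R]_N).
Hypothesis Alam : forall v, lam * normsq v <= bform A v v.
Hypothesis lam0 : 0 < lam.
Variable b : R.
Hypothesis hb : forall x, `|h x| <= b.
Variable t : R.
Hypothesis t0 : 0 < t.
Notation E := (propagator A).
Notation mu := (@lebesgue_measure R).
Notation R0 := (`[0%R, +oo[%classic : set R).

Definition weight i s := (E (t - s) *m C) i 0.

(** Obtained from [ito_sum] below by freezing h at the left end of each cell, so that increments of
    W replace those of j. *)
Definition noise_sum n w : 'cV[R]_N :=
  \col_i \sum_(r < n.+1) weight i (node t n.+1 r) * h (node t n.+1 r) * incr W (node t n.+1) r w.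

Definition ito_sum n w : 'cV[R]_N :=
  \col_i \sum_(r < n.+1) weight i (node t n.+1 r) * (j (node t n.+1 r.+1) w - j (node t n.+1 r) w).

(* [noise_sum] with the increments of W taken in reverse order (see
   [node_rev]); the weights become the integrand of the limit process. *)
Definition reversed_sum n w : 'cV[R]_N :=
  \col_i \sum_(r < n.+1) kernel A C h t i (node t n.+1 r.+1) * incr W (node t n.+1) r w.

(** Continuity alone is asked of g because the lemma is applied to test functions and also to
    squared entries. *)
Lemma noise_sum_rev n (g : 'cV[R]_N -> R) : continuous g ->
  (\int[P]_w (g (noise_sum n w))%:E = \int[P]_w (g (reversed_sum n w))%:E)%E.
Proof.
move=> cg.
pose x (c : 'I_n.+1 -> 'cV[R]_N) (z : n.+1.-tuple R) : 'cV[R]_N := \sum_r tnth z r *: c r.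
pose c (r : 'I_n.+1) : 'cV[R]_N := \col_i (weight i (node t n.+1 r) * h (node t n.+1 r)).
have mx : measurable_col (x c).
  move=> i; rewrite (_ : (fun z => _) = (fun z => \sum_r tnth z r * c r i 0)); last first.
    by apply/funext => z; rewrite summxE; apply: eq_bigr => r _; rewrite !mxE.
  apply: measurable_sum => r; apply: measurable_funM => //.
  exact: measurable_tnth.
have mf : measurable_fun setT (EFin \o (g \o x c)).
  by apply/measurable_EFinP; exact: measurable_continuous_col.
have nS k : node t n.+1 k.+1 - node t n.+1 k = t / n.+1%:R by rewrite nodeS addrC addKr.
have nI k : node t n.+1 k <= node t n.+1 k.+1 by rewrite nodeS lerDl ltW// cell_gt0.
have := @incr_rev R d T P W hW (node t n.+1) (node_ge0 t0 n 0) nI n.+1 _ _ (cell_gt0 t0 n) nS mf.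
move=> H; transitivity (\int[P]_w (g (x c [tuple incr W (node t n.+1) i w | i < n.+1]))%:E)%E.
  apply: eq_integral => w _; congr (g _)%:E; apply/colP => i; rewrite mxE summxE.
  by apply: eq_bigr => r _; rewrite !mxE tnth_mktuple mulrC.
rewrite H; apply: eq_integral => w _; congr (g _)%:E; apply/colP => i; rewrite mxE summxE.
rewrite (reindex_inj rev_ord_inj); apply: eq_bigr => r _.
rewrite !mxE tnth_mktuple rev_ordK mulrC; congr (_ * _).
(* The weight at a left end becomes the propagator at a right end, and h is read at t minus that
   end: this is [kernel]. *)
have e1 : t - node t n.+1 (rev_ord r) = node t n.+1 r.+1 by rewrite /= subSS node_rev// -ltnS.
have e2 : node t n.+1 (rev_ord r) = t - node t n.+1 r.+1 by rewrite -e1 subKr.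
by rewrite mulrC /weight e1 e2.
Qed.

Lemma grid_sum n c w : step_integral W (grid_step (t / n.+1%:R) n.+1 c t) w =
  \sum_(r < n.+1) c r * incr W (node t n.+1) r w.
Proof.
rewrite grid_step_integral; apply: eq_bigr => r _; rewrite /incr.
by rewrite !min_r//; apply: (node_le t0); rewrite ?ltn_ord// ltnW// ltnS ltn_ord.
Qed.

Lemma grid_times n c : step_times (grid_step (t / n.+1%:R) n.+1 c t).
Proof. by apply: step_times_grid; rewrite ltW// cell_gt0. Qed.

Lemma grid_covers n : t <= n.+1%:R * (t / n.+1%:R).
Proof. by rewrite -/(node t n.+1 n.+1) node_last. Qed.

Lemma reversed_sum_dist n (e : R) i I : is_wiener_integral P W (kernel A C h t i) I ->
  (forall x y, 0 <= x <= t -> `|x - y| <= t / n.+1%:R -> `|kernel A C h t i x - kernel A C h t i y| <= e) ->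
  (sqnorm P setT (fun w => reversed_sum n w i 0 - I w)%R <=
    (4 * (e ^+ 2 * t + (b * Num.sqrt (normsq C)) ^+ 2 / (2 * lam) * expR (- (2 * lam) * t)))%:E)%E.
Proof.
move=> wI he; have mk : measurable_fun R0 (kernel A C h t i) by case: wI.
pose c r := kernel A C h t i (node t n.+1 r.+1).
rewrite (@eq_sqnorm _ _ _ _ _ _ 
    (fun w => step_integral W (grid_step (t / n.+1%:R) n.+1 c t) w - I w)); last first.
  by move=> w _; rewrite grid_sum mxE.
apply: (le_trans (wiener_integral_step_dist hW wI (grid_times n c))).
rewrite EFinM; apply: lee_wpmul2l => //.
apply: (le_trans (@sqnorm_grid_le R _ _ c t _ e (cell_gt0 t0 n) (ltW t0) (grid_covers n) mk _)).
  move=> k x kn; rewrite -/(node t n.+1 k) -/(node t n.+1 k.+1) => /andP[kx xk] xt.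
  apply: he; first by rewrite (node_ge0 t0) (node_le t0).
  by have [] := node_dist kx xk.
rewrite EFinD; apply: leeD => //.
apply: sqnorm_exp_tail => //; first exact: ltW.
by move=> x tx; apply: kernel_decay => //; rewrite ltW// (lt_trans t0).
Qed.

(** Each increment of j integrates h over one cell, so [ito_sum] integrates h times a piecewise
    constant weight and can be compared with step integrals. *)
Lemma ito_sum_wiener n i : is_wiener_integral P W
  (fun x => \sum_(r < n.+1) weight i (node t n.+1 r) *
    ((h \_ `[0, node t n.+1 r.+1]) x + -1 * (h \_ `[0, node t n.+1 r]) x))
  (fun w => ito_sum n w i 0).
Proof.
rewrite (_ : (fun w => ito_sum n w i 0) = (fun w => \sum_(r < n.+1) weight i (node t n.+1 r) *
    (j (node t n.+1 r.+1) w + -1 * j (node t n.+1 r) w))); last first.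
  by apply/funext => w; rewrite mxE; apply: eq_bigr => r _; rewrite mulN1r.
apply: wiener_integral_sum => // r; apply: wiener_integralD => //.
  by apply: j_ito; exact: node_ge0.
by apply: wiener_integralZ => //; apply: j_ito; exact: node_ge0.
Qed.

Lemma weight_le i s : s <= t -> `|weight i s| <= Num.sqrt (normsq C).
Proof.
move=> st; rewrite /weight; have ts : 0 <= t - s by rewrite subr_ge0.
apply: (le_trans (propagator_decay Alam C i ts)).
by rewrite ler_piMr ?sqrtr_ge0// -expR0 ler_expR mulNr oppr_le0 mulr_ge0// ltW.
Qed.

Lemma noise_ito_dist n (e : R) i : 0 <= e ->
  (forall x y, 0 <= x <= t -> `|x - y| <= t / n.+1%:R -> `|h x - h y| <= e) ->
  (sqnorm P setT (fun w => noise_sum n w i 0 - ito_sum n w i 0)%R <=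
    (4 * ((Num.sqrt (normsq C) * e) ^+ 2 * t))%:E)%E.
Proof.
move=> e0 he; have wI := ito_sum_wiener n i.
set k := (fun x => \sum_(r < _) _) in wI.
have mk : measurable_fun R0 k by case: wI.
pose c r := weight i (node t n.+1 r) * h (node t n.+1 r).
rewrite (@eq_sqnorm _ _ _ _ _ _ 
    (fun w => step_integral W (grid_step (t / n.+1%:R) n.+1 c t) w - ito_sum n w i 0)); last first.
  by move=> w _; rewrite grid_sum [X in X - _]mxE.
apply: (le_trans (wiener_integral_step_dist hW wI (grid_times n c))).
rewrite EFinM; apply: lee_wpmul2l => //.
have patchE s x : 0 < x -> (h \_ `[0, s]) x = if x <= s then h x else 0.
  by move=> x0; rewrite patchE mem_setE in_itv/= (ltW x0).
apply: (le_trans (@sqnorm_grid_le R _ _ c t _ (Num.sqrt (normsq C) * e)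
    (cell_gt0 t0 n) (ltW t0) (grid_covers n) mk _)).
  move=> q x qn; rewrite -/(node t n.+1 q) -/(node t n.+1 q.+1) => /andP[qx xq] xt.
  have x0 : 0 < x by rewrite (le_lt_trans (node_ge0 t0 n q)).
  have nodeI r s : (r <= s)%N -> node t n.+1 r <= node t n.+1 s.
    by move=> rs; rewrite ler_pM2r ?cell_gt0// ler_nat.
  (* At x in cell q, earlier terms vanish since x is beyond both cut-offs, and later ones cancel
     since x is below both. *)
  have -> : k x = weight i (node t n.+1 q) * h x.
    rewrite /k (bigD1 (Ordinal qn))//= !patchE// xq (lt_geF qx) mulr0 addr0.
    rewrite big1 ?addr0// => r rq; rewrite !patchE//.
    have [rq'|qr] := ltnP r q.
      rewrite (lt_geF (le_lt_trans (nodeI _ _ rq') qx)) (lt_geF (le_lt_trans (nodeI _ _ (ltnW rq')) qx)).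
      by rewrite mulr0 addr0 mulr0.
    have {}qr : (q < r)%N.
      rewrite ltn_neqAle qr andbT eq_sym; move: rq; apply: contra => /eqP ?.
      exact/eqP/val_inj.
    rewrite (le_trans xq (nodeI _ _ qr)) (le_trans xq (nodeI _ _ (leqW qr))).
    by rewrite mulN1r subrr mulr0.
  rewrite /c -mulrBr normrM; apply: ler_pM => //.
    by apply: weight_le; apply: (node_le t0); exact: ltnW.
  apply: he; first by rewrite (node_ge0 t0) (node_le t0)// ltnW.
  by have [] := node_dist qx xq.
rewrite -[leRHS]adde0; apply: leeD => //.
rewrite (@eq_sqnorm _ _ _ _ _ _ (cst 0)).
  by rewrite /sqnorm; under eq_integral do rewrite expr0n/=; rewrite integral0.
move=> x; rewrite inE/= in_itv/= andbT => tx; rewrite /k big1//= => r _.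
rewrite !patchE ?(lt_trans t0)// !lt_geF ?mulr0 ?addr0 ?mulr0//.
  by apply: le_lt_trans tx; apply: (node_le t0); exact: ltnW.
by apply: le_lt_trans tx; apply: (node_le t0); exact: ltn_ord.
Qed.

End discretised_noise.

(** * Convergence in distribution *)

Lemma continuous_rat_eq0 (R : realType) (f : R -> R) : continuous f ->
  (forall q : rat, f (ratr q) = 0) -> forall x, f x = 0.
Proof.
move=> cf fq x; apply: contrapT => /eqP fx.
have fx0 : 0 < `|f x| by rewrite normr_gt0.
have /cvgrPdist_lt/(_ _ fx0) := @cf x.
move=> /nbhs_ballP[e /= e0 H].
have xe : x < x + e by rewrite ltrDl.
have [q] := rat_in_itvoo xe; rewrite inE/= => /itvP qI.
have q1 : x < ratr q by rewrite qI.
have q2 : ratr q < x + e by rewrite qI.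
have : ball x e (ratr q : R).
  by rewrite /ball/= distrC gtr0_norm ?subr_gt0// ltrBlDl.
by move=> /H /=; rewrite fq subr0 ltxx.
Qed.

Lemma small_square (R : realType) (a k : R) : 0 <= a -> 0 < k ->
  exists2 e : R, 0 < e & a * e ^+ 2 <= k.
Proof.
move=> a0 k0; have a1 : 0 < a + 1 by lra.
(* The bound by 1 gives e^2 <= e, so that a e^2 <= a e <= k. *)
exists (Num.min 1 (k / (a + 1))); first by rewrite lt_min ltr01 divr_gt0.
set e := Num.min _ _.
have e0 : 0 <= e by rewrite le_min ler01 divr_ge0// ltW.
have e1 : e <= 1 by rewrite ge_min lexx.
have ek : e <= k / (a + 1) by rewrite ge_min lexx orbT.
apply: (@le_trans _ _ (a * e)).
  by rewrite ler_wpM2l// expr2 ler_piMr.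
apply: (@le_trans _ _ ((a + 1) * e)); first by rewrite ler_wpM2r// lerDl.
by rewrite mulrC -ler_pdivlMr.
Qed.

(** Division by N.+1 also covers dimension 0. *)
Lemma sum_ord_le (R : realType) N (f : 'I_N -> \bar R) (k : R) : 0 <= k ->
  (forall i, f i <= (k / N.+1%:R)%:E)%E -> (\sum_i f i <= k%:E)%E.
Proof.
move=> k0 fk; apply: (@le_trans _ _ (\sum_(i < N) (k / N.+1%:R)%:E)%E); first exact: lee_sum.
rewrite sumEFin lee_fin sumr_const card_ord -[_ *+ N]mulr_natr -mulrA ler_piMr//.
by rewrite mulrC ler_pdivrMr ?ltr0n// mul1r ler_nat.
Qed.

Section convergence_in_distribution.
Context {R : realType} {N : nat} d (T : measurableType d) (P : probability T R).
Variables (W : R -> T -> R) (u h : R -> R) (j : R -> T -> R).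
Hypothesis hW : is_brownian P W.
Hypothesis cu : continuous u.
Hypothesis ch : continuous h.
Hypothesis j_cont : forall w, continuous (fun t => j t w).
Hypothesis j0 : forall w, j 0 w = 0.
Hypothesis j_ito : forall t, 0 <= t -> is_wiener_integral P W (h \_ `[0, t]) (j t).
Variables (A : 'M[R]_N) (lam : R) (C x0 : 'cV[R]_N).
Hypothesis Alam : forall v, lam * normsq v <= bform A v v.
Hypothesis lam0 : 0 < lam.
Variables b c : R.
Hypothesis ub : forall x, `|u x| <= b.
Hypothesis hc : forall x, `|h x| <= c.
Variable Y : R -> T -> 'cV[R]_N.
Hypothesis Y_lim : forall t, 0 <= t -> exists I : T -> 'cV[R]_N,
  (forall i, is_wiener_integral P W (kernel A C h t i) (fun w => I w i 0)) /\
  forall w, Y t w = sync A C u t + I w.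
Notation E := (propagator A).
Notation mu := (@lebesgue_measure R).
Notation R0 := (`[0%R, +oo[%classic : set R).

Let tail t := (c * Num.sqrt (normsq C)) ^+ 2 / (2 * lam) * expR (- (2 * lam) * t).

Let addE (v v' : 'cV[R]_N) i : (v + v') i 0 = v i 0 + v' i 0. Proof. by rewrite mxE. Qed.

Lemma measurable_limit t : 0 <= t -> measurable_col (Y t).
Proof.
move=> t0 i; have [I [wI YE]] := Y_lim t0.
rewrite (_ : (fun w => _) = (fun w => sync A C u t i 0 + I w i 0)); last first.
  by apply/funext => w; rewrite YE addE.
by apply: measurable_funD => //; case: (wI i).
Qed.

Lemma sqnorm_limit_le t i : 0 <= t -> (sqnorm P setT (fun w => Y t w i 0)%R <=
  (2 * (b * Num.sqrt (normsq C) / lam) ^+ 2 + 8 * tail 0)%:E)%E.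
Proof.
move=> t0; have [I [/(_ i) wI YE]] := Y_lim t0.
have mI : measurable_fun setT (fun w => I w i 0) by case: wI.
have mk : measurable_fun R0 (kernel A C h t i) by case: wI.
pose s := sync A C u t i 0.
have h1 : (sqnorm P setT (fun w => I w i 0)%R <= (4 * tail 0)%:E)%E.
  (* Compared with the empty step function, the distance estimate bounds the second moment of the
     integral itself. *)
  have := wiener_integral_step_dist hW wI (isT : step_times [::]).
  have -> : sqnorm P setT (fun w => step_integral W [::] w - I w i 0) = sqnorm P setT (fun w => I w i 0).
    by apply: eq_integral => w _; rewrite /step_integral big_nil sub0r sqrrN.
  have -> : sqnorm mu R0 (fun x => step_fun [::] x - kernel A C h t i x) = sqnorm mu R0 (kernel A C h t i).
    by apply: eq_integral => x _; rewrite /step_fun big_nil sub0r sqrrN.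
  move=> H; apply: (le_trans H); rewrite EFinM; apply: lee_wpmul2l => //.
  rewrite (sqnorm_halfline_split (lexx 0) mk).
  have e1 : (sqnorm mu `]0%R, 0%R] (kernel A C h t i) <= 0)%E.
    have := @sqnorm_segment_le R 0 _ 0 (lexx 0) mk; rewrite mulr0; apply => x.
    by rewrite lt_leAnge => /andP[/andP[? /negP]].
  rewrite -[leRHS]add0e; apply: leeD => //.
  apply: sqnorm_exp_tail => // x x_gt0; apply: kernel_decay => //; exact: ltW.
have sm : measurable_fun setT (fun _ : T => s) by exact: measurable_cst.
apply: (le_trans (@sqnorm_leD _ _ _ P setT _ (fun=> s) (fun w => I w i 0) measurableT _ sm mI _)).
- exact: measurable_limit.
- by move=> w _; rewrite YE addE; exact: ler_normD.
rewrite [leRHS]EFinD; apply: leeD.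
  rewrite EFinM; apply: lee_wpmul2l => //.
  rewrite /sqnorm integral_cst_probability lee_fin -[leLHS]real_normK ?num_real//.
  rewrite lerXn2r ?nnegrE ?normr_ge0//; last exact: sync_le.
  exact: le_trans (sync_le Alam lam0 C cu ub t i).
by rewrite (_ : 8 * tail 0 = 2 * (4 * tail 0)); [rewrite EFinM lee_wpmul2l|ring].
Qed.

Lemma noise_ito_near t i (k : R) : 0 < t -> 0 < k -> \forall n \near \oo,
  (sqnorm P setT (fun w => noise_sum W h A C t n w i 0 - ito_sum j A C t n w i 0)%R <= k%:E)%E.
Proof.
move=> t0 k0.
have a0 : 0 <= 4 * (normsq C * t) by rewrite !mulr_ge0 ?normsq_ge0// ltW.
have [e e0 ek] := small_square a0 k0.
have [delta d0 hd] := segment_unif_continuous 0 t ch e0.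
near=> n.
apply: (le_trans (noise_ito_dist hW j_ito C Alam lam0 t0 i (ltW e0) _)).
  move=> x y xt xy; apply/ltW/hd => //; apply: le_lt_trans xy _.
  by near: n; exact: mesh_lt_near.
rewrite lee_fin; apply: le_trans ek.
by rewrite exprMn sqr_sqrtr ?normsq_ge0// le_eqVlt; apply/orP; left; apply/eqP; ring.
Unshelve. all: by end_near. Qed.

Lemma reversed_near t i (k : R) I : 0 < t -> 0 < k ->
  is_wiener_integral P W (kernel A C h t i) I -> \forall n \near \oo,
  (sqnorm P setT (fun w => reversed_sum W h A C t n w i 0 - I w)%R <= (k + 4 * tail t)%:E)%E.
Proof.
move=> t0 k0 wI.
have a0 : 0 <= 4 * t by rewrite mulr_ge0// ltW.
have [e e0 ek] := small_square a0 k0.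
have ck : continuous (kernel A C h t i) by exact: kernel_continuous.
have [delta d0 hd] := segment_unif_continuous 0 t ck e0.
near=> n.
apply: (le_trans (@reversed_sum_dist _ _ _ _ _ _ _ hW _ _ _ Alam lam0 _ hc _ t0 n e i I wI _)).
  move=> x y xt xy; apply/ltW/hd => //; apply: le_lt_trans xy _.
  by near: n; exact: mesh_lt_near.
rewrite lee_fin mulrDr -/(tail t) lerD2r; apply: le_trans ek.
by rewrite mulrCA mulrC.
Unshelve. all: by end_near. Qed.

Lemma measurable_j t : 0 <= t -> measurable_fun setT (j t).
Proof. by move=> t0; case: (j_ito t0). Qed.

Lemma measurable_drift_sum t (a : 'I_N -> nat -> R) (z : nat -> T -> R) (n : nat) :
  (forall r, measurable_fun setT (z r)) ->
  measurable_col (fun w => drift A C u x0 t + \col_i \sum_(r < n.+1) a i r * z r w).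
Proof.
move=> mz i; rewrite (_ : (fun w => _) =
    (fun w => drift A C u x0 t i 0 + \sum_(r < n.+1) a i r * z r w)); last first.
  by apply/funext => w; rewrite addE [X in _ + X]mxE.
apply: measurable_funD => //; apply: measurable_sum => r.
by apply: measurable_funM.
Qed.

Lemma measurable_node_incr t n r : 0 < t -> measurable_fun setT (incr W (node t n.+1) r).
Proof.
move=> t0; apply: (measurable_incr hW); first exact: node_ge0.
by move=> k; rewrite nodeS lerDl ltW// cell_gt0.
Qed.

Let X t w := reservoir_path A C u x0 (fun s => j s w) t.

(** The chain is X, K, L, S, Y: X is close to K by pathwise convergence in n, K to L and S to Y in
    L^2, each at cost e, while L and S have the same law. *)
Lemma expectation_dist t (g : 'cV[R]_N -> R) (bg M kappa e : R) : continuous g ->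
  (forall v, `|g v| <= bg) -> 0 < t -> 0 < kappa -> 0 < e -> measurable_col (X t) ->
  (forall x y, measurable_col x -> measurable_col y ->
    (\sum_i sqnorm P setT (fun w => y w i 0)%R <= M%:E)%E ->
    (\sum_i sqnorm P setT (fun w => x w i 0 - y w i 0)%R <= kappa%:E)%E ->
    (`| 'E_P[g \o x] - 'E_P[g \o y] | <= e%:E)%E) ->
  (\sum_i sqnorm P setT (fun w => Y t w i 0)%R <= (M / 2 - kappa)%:E)%E ->
  2 * ((Num.sqrt (normsq x0) + b * Num.sqrt (normsq C) / lam) * expR (- lam * t)) ^+ 2 +
    8 * tail t <= kappa / (2 * N.+1%:R) ->
  (`| 'E_P[g \o X t] - 'E_P[g \o Y t] | <= (3 * e)%:E)%E.
Proof.
move=> cg gb t0 k0 e0 mX gl2 YM tk.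
have mY := measurable_limit (ltW t0).
have [I [wI YE]] := Y_lim (ltW t0).
pose D := drift A C u x0 t.
pose K n w := D + ito_sum j A C t n w.
pose L n w := D + noise_sum W h A C t n w.
pose S n w := D + reversed_sum W h A C t n w.
have mK n : measurable_col (K n).
  apply: (@measurable_drift_sum t (fun i r => weight A C t i (node t n.+1 r))
    (fun r w => j (node t n.+1 r.+1) w - j (node t n.+1 r) w)) => r.
  by apply: measurable_funB; apply: measurable_j; exact: node_ge0.
have mL n : measurable_col (L n).
  apply: (@measurable_drift_sum t (fun i r => weight A C t i (node t n.+1 r) * h (node t n.+1 r))) => r.
  exact: measurable_node_incr.
have mS n : measurable_col (S n).
  apply: (@measurable_drift_sum t (fun i r => kernel A C h t i (node t n.+1 r.+1))) => r.
  exact: measurable_node_incr.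
have N0 : 0 < N.+1%:R :> R by rewrite ltr0n.
have LK : \forall n \near \oo, (\sum_i sqnorm P setT (fun w => K n w i 0 - L n w i 0)%R <= kappa%:E)%E.
  have kN : 0 < kappa / N.+1%:R by rewrite divr_gt0.
  have : \forall n \near \oo, forall i, (sqnorm P setT
      (fun w => noise_sum W h A C t n w i 0 - ito_sum j A C t n w i 0)%R <= (kappa / N.+1%:R)%:E)%E.
    by apply: filter_forall => i; exact: noise_ito_near.
  apply: filterS => n Hn; apply: sum_ord_le; first exact: ltW.
  move=> i; apply: le_trans (Hn i); rewrite sqnorm_sub_swap le_eqVlt; apply/orP; left; apply/eqP.
  by apply: eq_sqnorm => w _; rewrite !addE; ring.
have SY : \forall n \near \oo, (\sum_i sqnorm P setT (fun w => S n w i 0 - Y t w i 0)%R <= kappa%:E)%E.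
  (* Of the budget kappa / N.+1 per entry, half goes to twice this grid error and half to the drift
     and tail terms controlled by the hypothesis on t. *)
  have kN : 0 < kappa / (4 * N.+1%:R) by rewrite divr_gt0// mulr_gt0.
  have : \forall n \near \oo, forall i, (sqnorm P setT
      (fun w => reversed_sum W h A C t n w i 0 - I w i 0)%R <= (kappa / (4 * N.+1%:R) + 4 * tail t)%:E)%E.
    by apply: filter_forall => i; exact: reversed_near.
  apply: filterS => n Hn; apply: sum_ord_le; first exact: ltW.
  move=> i; have mI : measurable_fun setT (fun w => I w i 0) by case: (wI i).
  pose s := D i 0 - sync A C u t i 0.
  have mrev : measurable_fun setT (fun w => reversed_sum W h A C t n w i 0).
    rewrite (_ : (fun w => _) = (fun w => S n w i 0 - D i 0)); last first.
      by apply/funext => w; rewrite addE addrC addKr.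
    by apply: measurable_funB; [exact: mS|exact: measurable_cst].
  apply: (le_trans (@sqnorm_leD _ _ _ P setT _ (fun w => reversed_sum W h A C t n w i 0 - I w i 0)
    (fun=> s) measurableT _ _ _ _)).
  - by apply: measurable_funB; [exact: mS|exact: mY].
  - exact: measurable_funB.
  - exact: measurable_cst.
  - move=> w _; have e1 : S n w i 0 = D i 0 + reversed_sum W h A C t n w i 0 by rewrite addE.
    have e2 : Y t w i 0 = sync A C u t i 0 + I w i 0 by rewrite YE addE.
    rewrite e1 e2.
    apply: le_trans (ler_normD _ _).
    by rewrite /s le_eqVlt; apply/orP; left; apply/eqP; congr `|_|; ring.
  apply: (@le_trans _ _ (2 * (kappa / (4 * N.+1%:R) + 4 * tail t) + 2 *
     ((Num.sqrt (normsq x0) + b * Num.sqrt (normsq C) / lam) * expR (- lam * t)) ^+ 2)%:E).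
    rewrite [leRHS]EFinD; apply: leeD; first by rewrite EFinM; apply: lee_wpmul2l => //; exact: Hn.
    rewrite EFinM; apply: lee_wpmul2l => //.
    rewrite /sqnorm integral_cst_probability lee_fin -[leLHS]real_normK ?num_real//.
    have ds := drift_sync Alam lam0 C cu ub x0 i (ltW t0).
    by rewrite lerXn2r ?nnegrE ?normr_ge0//; exact: le_trans ds.
  rewrite lee_fin.
  have -> : kappa / N.+1%:R = 2 * (kappa / (4 * N.+1%:R)) + kappa / (2 * N.+1%:R).
    by field; rewrite gt_eqF.
  by rewrite mulrDr -addrA lerD2l mulrA -natrM addrC.
have KX : 'E_P[g \o K n]%E @[n --> \oo] --> ('E_P[g \o X t])%E.
  apply: (expectation_bounded_cvg cg gb) => // w i.
  rewrite (_ : (fun n => K n w i 0) = (fun n => drift A C u x0 t i 0 +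
      \sum_(r < n.+1) weight A C t i (node t n.+1 r) *
        (j (node t n.+1 r.+1) w - j (node t n.+1 r) w))); last first.
    by apply/funext => n; rewrite addE [X in _ + X]mxE.
  by apply: (reservoir_path_cvg Alam cu (j := fun s => j s w)) => //; exact: j_cont.
have cD : continuous (fun v : 'cV[R]_N => D + v).
  move=> v; apply: (@cvg_mx_entries _ (nbhs v) (nbhs_filter v)) => i k.
  rewrite (_ : (fun v => _) = (fun v : 'cV[R]_N => D i k + v i k)); last first.
    by apply/funext => v'; rewrite mxE.
  by rewrite [X in _ --> X]mxE; apply: cvgD; [exact: cvg_cst|exact: coord_continuous].
have LS n : ('E_P[g \o L n] = 'E_P[g \o S n])%E.
  rewrite unlock; apply: (noise_sum_rev h hW A C t0 n (g := fun v => g (D + v))) => v.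
  by apply: continuous_comp; [exact: cD|exact: cg].
(* The bound M on second moments is available for S, which is close to Y; equality in law hands it
   to L, as the comparison of K with L requires. *)
have LS2 n i : sqnorm P setT (fun w => L n w i 0) = sqnorm P setT (fun w => S n w i 0).
  apply: (noise_sum_rev h hW A C t0 n (g := fun v => (D + v) i 0 ^+ 2)) => v.
  apply: (@continuous_comp _ _ _ (fun v => (D + v) i 0) (fun x => x ^+ 2)); last exact: exprn_continuous.
  apply: (@continuous_comp _ _ _ (fun v => D + v) (fun v : 'cV[R]_N => v i 0)); first exact: cD.
  exact: coord_continuous.
have finK n := expectation_bounded_fin P cg gb (mK n).
have finL n := expectation_bounded_fin P cg gb (mL n).
have finS n := expectation_bounded_fin P cg gb (mS n).
have finX := expectation_bounded_fin P cg gb mX.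
have finY := expectation_bounded_fin P cg gb mY.
have KXn : \forall n \near \oo, (`| 'E_P[g \o X t] - 'E_P[g \o K n] | <= e%:E)%E.
  have /fine_cvgP[_ /cvgrPdist_le/(_ _ e0)] : 'E_P[g \o K n]%E @[n --> \oo] --> (fine 'E_P[g \o X t])%:E.
    by rewrite fineK.
  by apply: filterS => n; rewrite -[X in (`|X - _| <= _)%E](fineK finX)
    -[X in (`|_ - X| <= _)%E](fineK (finK n)) lee_fin.
near \oo => n.
have SM : (\sum_i sqnorm P setT (fun w => S n w i 0)%R <= M%:E)%E.
  apply: (@le_trans _ _ (\sum_i (2%:E * sqnorm P setT (fun w => S n w i 0 - Y t w i 0)%R +
      2%:E * sqnorm P setT (fun w => Y t w i 0)%R))%E).
    apply: lee_sum => i _; apply: sqnorm_leD => //.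
    - exact: mS.
    - by apply: measurable_funB; [exact: mS|exact: mY].
    - by move=> w _; rewrite -{1}(subrK (Y t w i 0) (S n w i 0)); exact: ler_normD.
  rewrite big_split/= -!ge0_sume_distrr; last 2 first.
  - by move=> i _; exact: sqnorm_ge0.
  - by move=> i _; exact: sqnorm_ge0.
  have -> : M = 2 * kappa + 2 * (M / 2 - kappa) by field.
  rewrite [leRHS]EFinD; apply: leeD; rewrite EFinM; apply: lee_wpmul2l => //.
  by near: n.
have LM : (\sum_i sqnorm P setT (fun w => L n w i 0)%R <= M%:E)%E.
  by under eq_bigr do rewrite LS2.
have d1 : (`| 'E_P[g \o X t] - 'E_P[g \o K n] | <= e%:E)%E by near: n.
have d2 : (`| 'E_P[g \o K n] - 'E_P[g \o L n] | <= e%:E)%E.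
  by apply: gl2 => //; near: n.
have d3 : (`| 'E_P[g \o S n] - 'E_P[g \o Y t] | <= e%:E)%E.
  apply: gl2 => //; last by near: n.
  apply: (le_trans YM); have : (0 <= (M / 2 - kappa)%:E)%E.
    by apply: le_trans YM; apply: sume_ge0 => i _; exact: sqnorm_ge0.
  rewrite !lee_fin; lra.
move: d1 d2 d3; rewrite LS.
rewrite -(fineK finX) -(fineK finY) -(fineK (finK n)) -(fineK (finS n)).
move: (fine _) (fine _) (fine _) (fine _) => p q r s.
rewrite !lee_fin !ler_norml; lra.
Unshelve. all: by end_near. Qed.

End convergence_in_distribution.

(** * The stochastic reservoir system *)

Section sde.
Context {R : realType} {N : nat} d (T : measurableType d) (P : probability T R).
Variables (W : R -> T -> R) (u h : R -> R) (j : R -> T -> R).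
Hypothesis hW : is_brownian P W.
Hypothesis cu : continuous u.
Hypothesis ch : continuous h.
Hypothesis j_cont : forall w, continuous (fun t => j t w).
Hypothesis j_le0 : forall t w, t <= 0 -> j t w = 0.
Hypothesis j_adapted : forall s t, s <= t -> 0 <= t -> Fmeasurable P W t (j s).
Hypothesis j_ito : forall t, 0 <= t -> is_wiener_integral P W (h \_ `[0, t]) (j t).
Variables (A : 'M[R]_N) (lam : R) (C x0 : 'cV[R]_N).
Hypothesis Alam : forall v, lam * normsq v <= bform A v v.
Hypothesis lam0 : 0 < lam.

Let j0 w : j 0 w = 0. Proof. exact: j_le0. Qed.

Definition reservoir_process t w := reservoir_path A C u x0 (fun s => j s w) t.

Lemma reservoir_process0 w : reservoir_process 0 w = x0.
Proof.
rewrite /reservoir_process (reservoir_pathP Alam C cu x0 (@j_cont w) (lexx 0)) j0 scale0r addr0.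
rewrite (_ : vintegral _ _ = 0) ?addr0//.
by apply/colP => i; rewrite !mxE set_itv1 Rintegral_set1.
Qed.

(** The process is a limit of finite sums of values of j at nodes up to t. The grid needs t > 0, so
    time 0 is separate. *)
Lemma Fmeasurable_reservoir_process t i : 0 <= t ->
  Fmeasurable P W t (fun w => reservoir_process t w i 0).
Proof.
rewrite le_eqVlt => /predU1P[<-|t0].
  rewrite (_ : (fun w => _) = cst (x0 i 0)); first exact: measurable_cst.
  by apply/funext => w; rewrite reservoir_process0.
pose s n w := drift A C u x0 t i 0 + \sum_(r < n.+1) weight A C t i (node t n.+1 r) *
  (j (node t n.+1 r.+1) w - j (node t n.+1 r) w).
apply: (@measurable_fun_cvg _ (g_sigma_algebraType (bm_generators P W t)) _ setT s).
- move=> n; apply: measurable_funD; first exact: measurable_cst.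
  apply: measurable_sum => r; apply: measurable_funM; first exact: measurable_cst.
  by apply: measurable_funB; apply: j_adapted; rewrite ?(ltW t0)//; apply: node_le => //;
    rewrite ?ltn_ord// ltnW// ltnS ltn_ord.
- move=> w _; apply: (reservoir_path_cvg Alam cu (j := fun s => j s w)) => //; exact: j_cont.
Qed.

Lemma patch_scale (t x : R) i : (((fun s => h s *: C) \_ `[0, t]) x) i 0 = C i 0 * (h \_ `[0, t]) x.
Proof. by rewrite !patchE; case: ifP => _; rewrite mxE ?mulr0// mulrC. Qed.

Lemma reservoir_solution :
  sde_solution P W (reservoir A C) u (fun t => h t *: C) x0 reservoir_process.
Proof.
split.
- by move=> t t0 i B mB; apply: Fmeasurable_preimage => //; exact: Fmeasurable_reservoir_process.
- by apply: aeW => w; exact: reservoir_path_continuous.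
- exists (fun t w => j t w *: C); split; last first.
    by apply: aeW => w t t0; exact: (reservoir_pathP Alam).
  split.
    apply: aeW => w; apply/within_continuous_entries => i.
    rewrite (_ : (fun t => _) = (fun t => j t w * C i 0)); last by apply/funext => t; rewrite mxE.
    by apply: continuous_subspaceT; apply: continuous_mulr_cst; exact: j_cont.
  move=> t t0 i.
  rewrite (_ : (fun x => _) = (fun x => C i 0 * (h \_ `[0, t]) x)); last first.
    by apply/funext => x; exact: patch_scale.
  rewrite (_ : (fun w => _) = (fun w => C i 0 * j t w)); last by apply/funext => w; rewrite mxE mulrC.
  by apply: wiener_integralZ => //; exact: j_ito.
Qed.

(** Uniqueness of the Wiener integral gives almost sure equality at each time, hence at all rational
    times together, and continuity of paths does the rest. *)
Lemma ito_process_indistinguishable (J : R -> T -> 'cV[R]_N) :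
  is_ito_process P W (fun t => h t *: C) J ->
  {ae P, forall w, forall t, 0 <= t -> J t w = j t w *: C}.
Proof.
move=> [cJ J_ito].
have J_at t : 0 <= t -> {ae P, forall w, forall i, J t w i 0 = C i 0 * j t w}.
  move=> t0; apply: filter_forall => i.
  apply: (@wiener_integral_unique _ _ _ _ _ hW (fun x => C i 0 * (h \_ `[0, t]) x)).
    have := J_ito t t0 i; congr is_wiener_integral.
    by apply/funext => x; exact: patch_scale.
  by apply: wiener_integralZ => //; exact: j_ito.
(* Rationals are enumerated by [unpickle], with default 0, so that countably many null sets are
   joined; [Num.max 0] keeps the times admissible. *)
have J_rat : {ae P, forall w, forall k : nat, forall i,
    J (Num.max 0 (ratr (odflt 0 (unpickle k)))) w i 0 = C i 0 * j (Num.max 0 (ratr (odflt 0 (unpickle k)))) w}.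
  by apply: ae_foralln => k; apply: J_at; rewrite le_max lexx.
apply: filterS2 cJ J_rat => w /within_continuous_entries cJw Jw t t0; apply/colP => i.
pose f s := J (Num.max 0 s) w i 0 - C i 0 * j (Num.max 0 s) w.
have cf : continuous f.
  apply: continuous_subr; first exact: (continuous_halfline (cJw i)).
  apply: (@continuous_halfline _ (fun s => C i 0 * j s w)).
  apply: continuous_subspaceT; apply: continuous_mulr; first exact: cst_continuous.
  exact: j_cont.
have fq (q : rat) : f (ratr q) = 0.
  by have := Jw (pickle q) i; rewrite pickleK/= /f => ->; rewrite subrr.
have := continuous_rat_eq0 cf fq t; rewrite /f (max_r t0) => /eqP; rewrite subr_eq0 => /eqP ->.
by rewrite mxE mulrC.
Qed.

Lemma reservoir_solution_unique X :
  sde_solution P W (reservoir A C) u (fun t => h t *: C) x0 X ->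
  indistinguishable P reservoir_process X.
Proof.
move=> [_ cX [J [J_ito eqX]]].
apply: filterS3 cX (ito_process_indistinguishable J_ito) eqX => w cXw Jw eXw t t0.
have cR : {within `[0%R, +oo[%classic, continuous (fun t => reservoir_process t w)}.
  exact: reservoir_path_continuous.
have eR (s : R) : 0 <= s -> reservoir_process s w =
    x0 + vintegral `[0, s] (fun r => reservoir A C (reservoir_process r w) (u r)) + J s w.
  by move=> s0; rewrite Jw//; exact: (reservoir_pathP Alam).
exact: (integral_equation_unique Alam cu cR cXw eR eXw t0).
Qed.

Variables b c : R.
Hypothesis ub : forall x, `|u x| <= b.
Hypothesis hc : forall x, `|h x| <= c.

Lemma limit_process_exists : exists Y : R -> T -> 'cV[R]_N, forall t, 0 <= t ->
  exists I : T -> 'cV[R]_N,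
    (forall i, is_wiener_integral P W (kernel A C h t i) (fun w => I w i 0)) /\
    forall w, Y t w = sync A C u t + I w.
Proof.
have ex t i : exists I, is_wiener_integral P W (kernel A C h t i) I.
  apply: (@wiener_integral_exists_exp _ _ _ _ _ _ (c * Num.sqrt (normsq C)) lam hW) => //.
  - exact: kernel_continuous.
  - by move=> x x_ge0; exact: kernel_decay.
have [I wI] := choice (fun ti : R * 'I_N => ex ti.1 ti.2).
exists (fun t w => sync A C u t + \col_i I (t, i) w) => t t0.
exists (fun w => \col_i I (t, i) w); split=> // i.
rewrite (_ : (fun w => _) = I (t, i)); first exact: (wI (t, i)).
by apply/funext => w; rewrite mxE.
Qed.

Lemma reservoir_process_cvg_distribution (Y : R -> T -> 'cV[R]_N) (g : 'cV[R]_N -> R) (bg : R) :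
  (forall t, 0 <= t -> exists I : T -> 'cV[R]_N,
    (forall i, is_wiener_integral P W (kernel A C h t i) (fun w => I w i 0)) /\
    forall w, Y t w = sync A C u t + I w) ->
  continuous g -> (forall v, `|g v| <= bg) ->
  ('E_P[g \o reservoir_process t] - 'E_P[g \o Y t])%E @[t --> +oo%R] --> 0%E.
Proof.
move=> Y_lim cg gb.
pose tail (t : R) := (c * Num.sqrt (normsq C)) ^+ 2 / (2 * lam) * expR (- (2 * lam) * t).
have tail_ge0 t : 0 <= tail t.
  by rewrite mulr_ge0 ?expR_ge0// divr_ge0 ?sqr_ge0// mulr_ge0// ltW.
pose K1 := Num.sqrt (normsq x0) + b * Num.sqrt (normsq C) / lam.
pose MY := N.+1%:R * (2 * (b * Num.sqrt (normsq C) / lam) ^+ 2 + 8 * tail 0).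
have N0 : 0 < N.+1%:R :> R by rewrite ltr0n.
have MY0 : 0 <= MY by rewrite mulr_ge0// addr_ge0// mulr_ge0// sqr_ge0.
(* As k <= 1 below, M / 2 - k is at least MY, the bound on the second moments of Y that holds at all
   times. *)
pose M := 2 * (MY + 1).
have mX t : 0 <= t -> measurable_col (reservoir_process t).
  by move=> t0 i; apply: (Fmeasurable_measurable hW); exact: Fmeasurable_reservoir_process.
have mY t : 0 <= t -> measurable_col (Y t) by exact: (measurable_limit Y_lim).
have near_e (e : R) : 0 < e -> \forall t \near +oo,
    (`| 'E_P[g \o reservoir_process t] - 'E_P[g \o Y t] | <= e%:E)%E.
  move=> e0; have e3 : 0 < e / 3 by rewrite divr_gt0.
  have M0 : 0 <= M by rewrite mulr_ge0// addr_ge0.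
  have [k0 k0_gt0 gl2] := expectation_l2_continuous P cg gb M0 e3.
  pose k := Num.min k0 1.
  have kpos : 0 < k by rewrite lt_min k0_gt0/=.
  have k1 : k <= 1 by rewrite ge_min lexx orbT.
  have l2 : 0 < 2 * lam by rewrite mulr_gt0.
  have kN : 0 < k / (2 * N.+1%:R) by rewrite divr_gt0// mulr_gt0.
  (* The squared drift error and the noise tail both decay like expR (- (2 * lam) * t); B collects
     their coefficients. *)
  pose B := 2 * K1 ^+ 2 + 8 * ((c * Num.sqrt (normsq C)) ^+ 2 / (2 * lam)).
  have B0 : 0 <= B.
    by rewrite addr_ge0// mulr_ge0 ?sqr_ge0// divr_ge0 ?sqr_ge0// ltW.
  have [t0 t0_gt0 t0B] := expR_tail_small B l2 kN.
  near=> t.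
  have tt0 : t0 < t by near: t; apply: nbhs_pinfty_gt; exact: num_real.
  have tpos : 0 < t by exact: lt_trans tt0.
  rewrite (_ : e = 3 * (e / 3)); last by field.
  apply: (expectation_dist hW cu ch j_cont j0 j_ito Alam lam0 ub hc Y_lim cg gb tpos kpos e3 (M := M)).
  - exact/mX/ltW.
  - move=> x y mx my yM xy; apply: gl2 => //; apply: le_trans xy _.
    by rewrite lee_fin ge_min lexx.
  - apply: (@le_trans _ _ MY%:E); last by rewrite lee_fin /M; lra.
    apply: sum_ord_le => // i; rewrite /MY mulrAC divff ?gt_eqF// mul1r.
    by apply: (sqnorm_limit_le hW cu Alam lam0 ub hc Y_lim); exact: ltW.
  - apply: le_trans t0B; apply: (@le_trans _ _ (B * expR (- (2 * lam) * t))); last first.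
      by rewrite ler_wpM2l// ler_expR !mulNr lerN2 ler_wpM2l// ltW.
    rewrite exprMn -/K1 -expRM_natr (_ : - lam * t * 2 = - (2 * lam) * t); last by ring.
    by rewrite /B le_eqVlt; apply/orP; left; apply/eqP; ring.
have fin t : 0 <= t -> ('E_P[g \o reservoir_process t] - 'E_P[g \o Y t] \is a fin_num)%E.
  move=> t0; rewrite fin_numB; apply/andP.
  by split; apply: (expectation_bounded_fin P cg gb); [exact: mX|exact: mY].
apply/fine_cvgP; split.
  near=> t; apply: fin; near: t; exact: nbhs_pinfty_ge.
apply/cvgrPdist_le => e e0; near=> t.
rewrite sub0r normrN -lee_fin -[leLHS]abse_EFin fineK; last first.
  by apply: fin; near: t; exact: nbhs_pinfty_ge.
by near: t; exact: near_e.
Unshelve. all: by end_near. Qed.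

End sde.

Lemma bounded_fun_le (R : realType) (X : Type) (f : X -> R) : bounded_fun f ->
  exists b : R, forall x, `|f x| <= b.
Proof.
move=> [M [_ MP]]; exists (`|M| + 1) => x; apply: (MP (`|M| + 1)) => //.
by rewrite (le_lt_trans (ler_norm _))// ltrDl.
Qed.

Theorem theorem7p1 (R : realType) (n : nat) (M : topologicalType)
    (MS : smooth_manifold R n M) (V : vector_field MS) (phi : R -> M -> M)
    (hphi : is_flow V phi)
    (N : nat) (A : 'M[R]_N) (hA : spd_mx A) (C : 'cV[R]_N)
    (d : measure_display) (T : measurableType d) (P : probability T R)
    (W : R -> T -> R) (hW : is_brownian P W)
    (omega sigma : M -> R)
    (omega_cont : continuous omega) (omega_bnd : bounded_fun omega)
    (sigma_cont : continuous sigma) (sigma_bnd : bounded_fun sigma)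
    (m : M) (x0 : 'cV[R]_N) :
  let solution := sde_solution P W (reservoir A C)
    (fun t => omega (phi t m)) (fun t => sigma (phi t m) *: C) x0 in
  let limit_process := is_limit_process P W A C phi omega sigma m in
  exists X : R -> T -> 'cV[R]_N,
    [/\ solution X,
        forall X' : R -> T -> 'cV[R]_N, solution X' -> indistinguishable P X X',
        exists Y : R -> T -> 'cV[R]_N, limit_process Y &
        forall Y : R -> T -> 'cV[R]_N, limit_process Y ->
        forall g : 'cV[R]_N -> R, continuous g -> bounded_fun g ->
          ('E_P[g \o X t] - 'E_P[g \o Y t])%E @[t --> +oo%R] --> 0%E].
Proof.
move=> solution limit_process.
have [lam lam0 Alam] := spd_coercive hA.
pose u t := omega (phi t m); pose h t := sigma (phi t m).
have along f : continuous f -> continuous (fun t => f (phi t m) : R).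
  by move=> cf t; apply: continuous_comp; [exact: (flow_continuous hphi)|exact: cf].
have cu : continuous u by exact: along.
have ch : continuous h by exact: along.
have [b ub] : exists b, forall t, `|u t| <= b.
  by have [b ob] := bounded_fun_le omega_bnd; exists b => t; exact: ob.
have [c hc] : exists c, forall t, `|h t| <= c.
  by have [c sc] := bounded_fun_le sigma_bnd; exists c => t; exact: sc.
have [j [j_cont j_le0 j_adapted j_ito]] := wiener_process_exists hW ch.
have kernelE t i : kernel A C h t i =
    (fun tau => (sigma (phi (- tau + t) m) *: (expmx (- (tau *: A)) *m C)) i 0).
  by apply/funext => tau; rewrite mxE addrC.
(* The flow property turns phi (- tau) after phi t into phi (t - tau), so only the input u along the
   orbit of m matters. *)
have syncE t : gen_sync A C phi omega (phi t m) = sync A C u t.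
  rewrite /gen_sync /sync; congr vintegral; apply/funext => tau.
  by rewrite -(flowD hphi) addrC.
have limitE Y : limit_process Y <-> forall t, 0 <= t -> exists I : T -> 'cV[R]_N,
    (forall i, is_wiener_integral P W (kernel A C h t i) (fun w => I w i 0)) /\
    forall w, Y t w = sync A C u t + I w.
  split=> HY t t0; have [I [wI YE]] := HY t t0; exists I; split.
  - by move=> i; rewrite kernelE; exact: wI.
  - by move=> w; rewrite -syncE; exact: YE.
  - by move=> i; rewrite -kernelE; exact: wI.
  - by move=> w; rewrite syncE; exact: YE.
exists (reservoir_process u j A C x0); split.
- exact: (reservoir_solution hW cu j_cont j_le0 j_adapted j_ito C x0 Alam).
- by move=> X' X'_sol; exact: (reservoir_solution_unique hW cu j_cont j_ito Alam X'_sol).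
- have [Y HY] := @limit_process_exists R N d T P W u h hW ch A lam C Alam lam0 c hc.
  by exists Y; apply/limitE.
- move=> Y /limitE HY g cg /bounded_fun_le[bg gb].
  exact: (reservoir_process_cvg_distribution hW cu ch j_cont j_le0 j_adapted j_ito x0 Alam lam0 ub hc HY cg gb).
Qed.
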